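(* Let $\alpha\ge\beta\ge-\frac12$, $0<p<1$ and $r>0$. Assume that $r$ is not an even integer if $\alpha+\beta+1>0$, and that $r$ is not an integer if $\alpha+\beta+1=0$. Then, for all integers $n\ge2$, $$\frac{\|G_{n,r}\|_{p,\alpha,\beta}}{\|G_n\|_{p,\alpha,\beta}}\sim\begin{cases} n^r, & \text{if } r>(2\alpha+2)(\tfrac1p-1),\\ n^{(2\alpha+2)(\frac1p-1)}, & \text{if } r<(2\alpha+2)(\tfrac1p-1),\\ n^{(2\alpha+2)(\frac1p-1)}(\log n)^{1/p}, & \text{if } r=(2\alpha+2)(\tfrac1p-1),\end{cases}$$ where the constants of equivalence are independent of $n$.
   Context: $\eta$ is a fixed nonnegative $C^\infty$ function on $\mathbb{R}$ with $\eta(x)=1$ for $|x|\le1$ and $\eta(x)=0$ for $|x|\ge2$. $P_k^{(\alpha,\beta)}$ is the usual (Szegő-normalized) Jacobi polynomial of degree $k$, and $$E_k^{(\alpha,\beta)}(t)=\frac{(2k+\alpha+\beta+1)\Gamma(k+\alpha+\beta+1)}{\Gamma(k+\beta+1)}P_k^{(\alpha,\beta)}(t)$$ (when $k=0$ and $\alpha+\beta+1=0$ the product $(2k+\alpha+\beta+1)\Gamma(k+\alpha+\beta+1)$ is understood as its limit $\Gamma(\alpha+\beta+2)=1$). For $r\ge0$, $$G_{n,r}(t)=G_{n,r}^{(\alpha,\beta)}(t)=\sum_{k=0}^\infty \eta(\tfrac kn)\,(k(k+\alpha+\beta+1))^{r/2}E_k^{(\alpha,\beta)}(t),$$ and $G_n=G_{n,0}=\sum_{k=0}^\infty\eta(\tfrac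 kn)E_k^{(\alpha,\beta)}$. For $g:[-1,1]\to\mathbb{R}$ and $0<p<\infty$, $$\|g\|_{p,\alpha,\beta}=\Bigl(\int_0^\pi|g(\cos\theta)|^p(\sin\tfrac\theta2)^{2\alpha+1}(\cos\tfrac\theta2)^{2\beta+1}\,d\theta\Bigr)^{1/p}.$$ $A\sim B$ means $c^{-1}A\le B\le cA$ for some constant $c>0$, which here may depend on $\alpha,\beta,p,r,\eta$. *)

(* Defs.v *)
From HB Require Import structures.
From mathcomp Require Import all_boot all_order all_algebra.
From mathcomp Require Import all_classical all_reals all_analysis.
Set Implicit Arguments.
Unset Strict Implicit.
Unset Printing Implicit Defensive.
Import Order.TTheory GRing.Theory Num.Theory.
Import numFieldNormedType.Exports.

Local Open Scope classical_set_scope.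
Local Open Scope ring_scope.

Definition smooth (R : realType) (f : R -> R) : Prop :=
  forall (m : nat) (x : R), derivable (derive1n m f) x 1.

(* Euler's integral: it is the Gamma function only for [0 < x]. *)
Definition gammaR (R : realType) (x : R) : R :=
  \int[lebesgue_measure]_(t in `]0, +oo[) (t `^ (x - 1) * expR (- t)).

Definition binomR (R : realType) (x : R) (k : nat) : R :=
  (\prod_(i < k) (x - i%:R)) / k`!%:R.

(* Szego, Orthogonal Polynomials, (4.3.2); the normalization is jacobi_at1. *)
Definition jacobi (R : realType) (a b : R) (k : nat) : {poly R} :=
  \sum_(s < k.+1) (binomR (k%:R + a) (k - s) * binomR (k%:R + b) s)
    *: ((2^-1 *: ('X - 1)) ^+ s * (2^-1 *: ('X + 1)) ^+ (k - s)).

Lemma jacobi_at1 (R : realType) (a b : R) (k : nat) :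
  (jacobi a b k).[1] = binomR (k%:R + a) k.
Proof.
rewrite /jacobi horner_sum big_ord_recl /= big1 ?addr0 => [|s _]; last first.
  by rewrite !hornerE subrr mulr0 expr0n /= !(mul0r, mulr0).
have -> : binomR (k%:R + b) 0 = 1 by rewrite /binomR big_ord0 fact0 divr1.
rewrite subn0 mulr1 expr0 mul1r hornerZ horner_exp !hornerE.
by rewrite mulVf ?pnatr_eq0 // expr1n mulr1.
Qed.

(* [(2k+a+b+1) Gamma(k+a+b+1)]; when [k = 0] and [a + b + 1 = 0] it is the
   limit [Gamma(a+b+2) = 1]. *)
Definition jacobi_weight (R : realType) (a b : R) (k : nat) : R :=
  if (k == 0%N) && (a + b + 1 == 0) then 1
  else (2 * k%:R + a + b + 1) * gammaR (k%:R + a + b + 1).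

Definition jacobiE (R : realType) (a b : R) (k : nat) (t : R) : R :=
  jacobi_weight a b k / gammaR (k%:R + b + 1) * (jacobi a b k).[t].

(* Since [0 `^ 0 = 1] and [0 `^ x = 0] for [x != 0], the term [k = 0] is
   present exactly when [r = 0]. *)
Definition jacobiG (R : realType) (eta : R -> R) (a b : R) (n : nat) (r t : R) : R :=
  limn (series (fun k : nat =>
    eta (k%:R / n%:R) * (k%:R * (k%:R + a + b + 1)) `^ (r / 2)
      * jacobiE a b k t)).

Definition jacobi_norm (R : realType) (a b p : R) (g : R -> R) : R :=
  (\int[lebesgue_measure]_(th in `[0, pi])
     (`|g (cos th)| `^ p * (sin (th / 2)) `^ (2 * a + 1)
        * (cos (th / 2)) `^ (2 * b + 1))) `^ p^-1.

Definition equiv_from2 (R : realType) (A B : nat -> R) : Prop :=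
  exists2 c : R, 0 < c &
    forall n : nat, (2 <= n)%N -> c^-1 * B n <= A n <= c * B n.

(* Main.v *)
(* In the variable [y = (1 - cos t) / 2], [jacobiE a b k] is [jw a b k * F_k y]
   with [F_k 0 = 1], [|F_k| <= 1] and [jw a b k ~ k^(2a+1)].  By the three-term
   recurrence, multiplying the kernel [sum_k m_k jw_k F_k(y)] by [2 y] amounts to
   applying to [m] a difference operator that lowers the order of a symbol by two.
   With [Q = r + 2a + 2], summation by parts thus gives
   [|G_{n,r}(cos t)| <= C min(n, 1/t)^Q], and for [r = 0] a decay in [n t] faster
   than any power; moreover [G_{n,r}(cos t) >= c n^Q] for [t <= c/n].  Finally
   [(k (k + a + b + 1))^(r/2)] agrees to leading order with a multiplier whose
   kernel is exactly a multiple of [y^(-Q/2)], nonzero unless [r] is an even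
   integer, so that [|G_{n,r}(cos t)| >= c t^(-Q)] for [A/n <= t <= delta].
   Integrating [|G|^p] against the weight, which behaves like [t^(2a+1)] near 0,
   gives [n^(Qp-2a-2)], [1] or [log n] according to the sign of [Qp - (2a+2)]. *)
Require Import Defs.
From HB Require Import structures.
From mathcomp Require Import all_boot all_order all_algebra.
From mathcomp Require Import all_classical all_reals all_analysis.
From mathcomp Require Import measurable_realfun ring lra zify.
Set Implicit Arguments.
Unset Strict Implicit.
Unset Printing Implicit Defensive.
Import Order.TTheory GRing.Theory Num.Theory.
Import numFieldNormedType.Exports.

Local Open Scope classical_set_scope.
Local Open Scope ring_scope.

(** * Symbol classes of sequences *)

(** The delicate estimate is the lower bound in the tail, because the Jacobi expansion of [y^(-Q/2)]
    diverges. Its coefficients are nevertheless explicit: Rodrigues' formula gives those of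
    [y^sigma] for large [sigma] as quotients of Gamma functions, and [bs i] continues them to
    [sigma = i - Q/2]. Multiplication by [2 y] raises [i] by one and produces the factor [2 i - r],
    which is where an even [r] fails. After enough multiplications the expansion converges
    absolutely. Its sum satisfies [y K' = sigma K], an identity that can be read off the
    coefficients, so it is a multiple of [y^sigma]. That the multiple is nonzero follows from a
    maximum principle for the resolvent of the Jacobi operator; this takes the place of
    orthogonality, and integrals against the Jacobi weight occur only in the final norm estimates.
    Symbol classes are stated for families of sequences, since every constant must be uniform in [n]
    and sometimes in a second cutoff that depends on [t]. *)

Section Symbols.
Variable R : realType.
Implicit Types (d e s t : R) (k : nat).

Definition pw k s : R := k.+1%:R `^ s.

Lemma pw_gt0 k s : 0 < pw k s.
Proof. by rewrite powR_gt0. Qed.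

Lemma pw_ge0 k s : 0 <= pw k s.
Proof. exact: ltW (pw_gt0 k s). Qed.

Lemma pwD k s t : pw k (s + t) = pw k s * pw k t.
Proof. by rewrite /pw powRD// pnatr_eq0 implybT. Qed.

Lemma pwN k s : pw k (- s) = (pw k s)^-1.
Proof. by rewrite /pw powRN. Qed.

Lemma pw0 k : pw k 0 = 1.
Proof. exact: powRr0. Qed.

Lemma pwn k (n : nat) : pw k n%:R = k.+1%:R ^+ n.
Proof. by rewrite /pw powR_mulrn. Qed.

Lemma pwN1 k : pw k (-1) = k.+1%:R^-1.
Proof. by rewrite pwN -[1]/(1%:R) pwn expr1. Qed.

Lemma ler_pw k s t : s <= t -> pw k s <= pw k t.
Proof. by move=> st; apply: ler_powR => //; rewrite ler1n. Qed.

(* Peetre: [x^s] and [y^s] are comparable when [x / y] is bounded. *)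
Lemma powR_le_ratio (x y c s : R) : 1 <= c -> 0 < y ->
  y <= x * c -> x <= c * y -> 0 < x -> x `^ s <= c `^ `|s| * y `^ s.
Proof.
move=> c1 y0 yx xy x0; have c0 : 0 < c by lra.
have [s0|s0] := leP 0 s.
  rewrite ger0_norm// -powRM ?(ltW c0) ?(ltW y0)//.
  by rewrite ge0_ler_powR// nnegrE ltW// mulr_gt0.
rewrite ltr0_norm//; have [t st] : exists t, s = - t by exists (- s); rewrite opprK.
rewrite {}st in s0 *.
rewrite opprK !powRN ler_pdivlMr ?powR_gt0// mulrC ler_pdivrMr ?powR_gt0//.
rewrite -powRM ?(ltW c0) ?(ltW x0)//.
rewrite ge0_ler_powR// ?nnegrE ?(ltW y0) ?mulr_ge0 ?(ltW x0) ?(ltW c0)//; first by lra.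
by rewrite mulrC.
Qed.

Lemma pw_shift k s : pw k.+1 s <= 2 `^ `|s| * pw k s.
Proof.
apply: powR_le_ratio; rewrite ?ltr0n ?ler1n//.
  by rewrite -natrM ler_nat; lia.
by rewrite -natrM ler_nat; lia.
Qed.

Definition dif (f : nat -> R) k := f k.+1 - f k.

Definition bnd (I : Type) d (f : I -> nat -> R) :=
  exists C, forall i k, `|f i k| <= C * pw k d.

(** Discrete symbols in the sense of Hörmander, with [J] differences controlled. The constants may
    depend on [J] and on the family but not on its member, which is how the estimates below become
    uniform in [n]. *)
Fixpoint symb (J : nat) (I : Type) d (f : I -> nat -> R) : Prop :=
  bnd d f /\ if J is J'.+1 then symb J' (d - 1) (fun i => dif (f i)) else True.

Definition sym (I : Type) d (f : I -> nat -> R) := forall J, symb J d f.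

Lemma bnd_ge0 (I : Type) d (f : I -> nat -> R) : bnd d f ->
  exists2 C, 0 <= C & forall i k, `|f i k| <= C * pw k d.
Proof.
case=> C Cf; exists `|C| => // i k; apply: le_trans (Cf i k) _.
by rewrite ler_wpM2r ?pw_ge0 ?ler_norm.
Qed.

Lemma bndD (I : Type) d (f g : I -> nat -> R) :
  bnd d f -> bnd d g -> bnd d (fun i k => f i k + g i k).
Proof.
move=> [C Cf] [D Dg]; exists (C + D) => i k.
by rewrite mulrDl (le_trans (ler_normD _ _))// lerD.
Qed.

Lemma bndM (I : Type) d e (f g : I -> nat -> R) :
  bnd d f -> bnd e g -> bnd (d + e) (fun i k => f i k * g i k).
Proof.
move=> /bnd_ge0[C C0 Cf] /bnd_ge0[D D0 Dg]; exists (C * D) => i k.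
by rewrite pwD mulrACA normrM ler_pM.
Qed.

Lemma bndW (I : Type) d e (f : I -> nat -> R) : d <= e -> bnd d f -> bnd e f.
Proof.
move=> de /bnd_ge0[C C0 Cf]; exists C => i k; apply: le_trans (Cf i k) _.
by rewrite ler_wpM2l// ler_pw.
Qed.

Lemma bndS (I : Type) d (f : I -> nat -> R) :
  bnd d f -> bnd d (fun i k => f i k.+1).
Proof.
move=> /bnd_ge0[C C0 Cf]; exists (C * 2 `^ `|d|) => i k.
by rewrite (le_trans (Cf i _))// -mulrA ler_wpM2l// pw_shift.
Qed.

Lemma bndS_inv (I : Type) d (f : I -> nat -> R) :
  bnd d (fun i k => f i k.+1) -> (exists M, forall i, `|f i 0%N| <= M) ->
  bnd d f.
Proof.
move=> /bnd_ge0[C C0 Cf] [M Mf].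
exists (C * 2 `^ `|d| + `|M|) => i [|k].
  rewrite (le_trans (Mf i))// (le_trans (ler_norm M))// /pw powR1 mulr1.
  by rewrite lerDr mulr_ge0 ?powR_ge0.
rewrite (le_trans (Cf i k))// mulrDl -mulrA.
rewrite -[leLHS]addr0 lerD ?mulr_ge0 ?pw_ge0// ler_wpM2l//.
rewrite powR_le_ratio ?ltr0n ?ler1n//.
  by rewrite -natrM ler_nat; lia.
by rewrite -natrM ler_nat; lia.
Qed.

Lemma symb_bnd J (I : Type) d (f : I -> nat -> R) : symb J d f -> bnd d f.
Proof. by case: J => [|J] []. Qed.

Lemma symbW J (I : Type) d e (f : I -> nat -> R) :
  d <= e -> symb J d f -> symb J e f.
Proof.
elim: J d e f => [|J IH] d e f de /= [bf sf]; split=> //.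
- exact: bndW bf.
- exact: bndW bf.
- by apply: IH sf; rewrite lerD2r.
Qed.

Lemma symb_pred J (I : Type) d (f : I -> nat -> R) : symb J.+1 d f -> symb J d f.
Proof.
elim: J d f => [|J IH] d f; first by case=> bf _; split.
by move=> [bf sf]; split=> //; apply: IH.
Qed.

Lemma symb_ext J (I : Type) d (f g : I -> nat -> R) :
  (forall i k, f i k = g i k) -> symb J d f -> symb J d g.
Proof. by move=> fg; have -> : f = g by apply/funext=> i; apply/funext. Qed.

Lemma symbD J (I : Type) d (f g : I -> nat -> R) :
  symb J d f -> symb J d g -> symb J d (fun i k => f i k + g i k).
Proof.
elim: J d f g => [|J IH] d f g [bf sf] [bg sg]; split=> //; try exact: bndD.
apply: symb_ext (IH _ _ _ sf sg) => i k; rewrite /dif; ring.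
Qed.

Lemma symbS J (I : Type) d (f : I -> nat -> R) :
  symb J d f -> symb J d (fun i k => f i k.+1).
Proof.
elim: J d f => [|J IH] d f [bf sf]; split=> //; try exact: bndS.
exact: (IH _ (fun i => dif (f i))).
Qed.

(** Discrete Leibniz rule: the difference of [f g] is the difference of [f] times the shifted [g],
    plus [f] times the difference of [g]. Hence the induction relies on stability under shifts and
    on giving up one difference. *)
Lemma symbM J (I : Type) d e (f g : I -> nat -> R) :
  symb J d f -> symb J e g -> symb J (d + e) (fun i k => f i k * g i k).
Proof.
elim: J d e f g => [|J IH] d e f g sf sg.
  by split=> //; apply: bndM; [exact: symb_bnd sf|exact: symb_bnd sg].
split; first by apply: bndM; [exact: symb_bnd sf|exact: symb_bnd sg].
have h1 := IH _ _ _ _ sf.2 (symbS (symb_pred sg)).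
have h2 := IH _ _ _ _ (symb_pred sf) sg.2.
have -> : d + e - 1 = d + (e - 1) by ring.
have E : d - 1 + e = d + (e - 1) by ring.
rewrite E in h1; apply: symb_ext (symbD h1 h2) => i k; rewrite /dif; ring.
Qed.

Lemma symW (I : Type) d e (f : I -> nat -> R) : d <= e -> sym d f -> sym e f.
Proof. by move=> de sf J; apply: symbW (sf J). Qed.

Lemma sym_ext (I : Type) d (f g : I -> nat -> R) :
  (forall i k, f i k = g i k) -> sym d f -> sym d g.
Proof. by move=> fg sf J; apply: symb_ext (sf J). Qed.

Lemma symD (I : Type) d (f g : I -> nat -> R) :
  sym d f -> sym d g -> sym d (fun i k => f i k + g i k).
Proof. by move=> sf sg J; apply: symbD. Qed.

Lemma symM (I : Type) d e (f g : I -> nat -> R) :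
  sym d f -> sym e g -> sym (d + e) (fun i k => f i k * g i k).
Proof. by move=> sf sg J; apply: symbM. Qed.

Lemma sym_S (I : Type) d (f : I -> nat -> R) :
  sym d f -> sym d (fun i k => f i k.+1).
Proof. by move=> sf J; apply: symbS. Qed.

Lemma sym_dif (I : Type) d (f : I -> nat -> R) :
  sym d f -> sym (d - 1) (fun i => dif (f i)).
Proof. by move=> sf J; case: (sf J.+1). Qed.

Lemma sym_bnd (I : Type) d (f : I -> nat -> R) : sym d f -> bnd d f.
Proof. by move=> sf; apply: symb_bnd (sf 0%N). Qed.

Lemma sym_of_dif (I : Type) d (f : I -> nat -> R) :
  bnd d f -> sym (d - 1) (fun i => dif (f i)) -> sym d f.
Proof. by move=> bf sf [|J]; split => //; apply: sf. Qed.

Lemma sym_zero (I : Type) d : sym d (fun (_ : I) _ => 0).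
Proof.
move=> J; elim: J d => [|J IH] d; split=> //; try by exists 0 => i k; rewrite normr0 mul0r.
by apply: symb_ext (IH _) => i k; rewrite /dif subr0.
Qed.

Lemma sym_cst (I : Type) (c : R) : sym 0 (fun (_ : I) _ => c).
Proof.
apply: sym_of_dif; first by exists `|c| => i k; rewrite pw0 mulr1.
by apply: sym_ext (sym_zero I _) => i k; rewrite /dif subrr.
Qed.

Lemma symZ (I : Type) d c (f : I -> nat -> R) :
  sym d f -> sym d (fun i k => c * f i k).
Proof. by move=> sf; rewrite -[d]add0r; apply: symM => //; exact: sym_cst. Qed.

Lemma symN (I : Type) d (f : I -> nat -> R) :
  sym d f -> sym d (fun i k => - f i k).
Proof. by move=> /(symZ (-1)); apply: sym_ext => i k; rewrite mulN1r. Qed.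

Lemma symB (I : Type) d (f g : I -> nat -> R) :
  sym d f -> sym d g -> sym d (fun i k => f i k - g i k).
Proof. by move=> sf sg; apply: symD => //; exact: symN. Qed.

Lemma sym_comp (I I' : Type) (h : I' -> I) d (f : I -> nat -> R) :
  sym d f -> sym d (fun i => f (h i)).
Proof.
move=> sf J; have {sf} := sf J; elim: J d f => [|J IH] d f [[C Cf] sf].
  by split=> //; exists C => i; apply: Cf.
by split; [exists C => i; apply: Cf|apply: (IH _ (fun i => dif (f i)))].
Qed.

(** Closed formulas for the recurrence coefficients hold only from index 1 on, and difference
    operators treat index 0 apart; a uniformly bounded initial value costs only a constant. *)
Lemma symb_S_inv J (I : Type) d (f : I -> nat -> R) :
  symb J d (fun i k => f i k.+1) -> (exists M, forall i, `|f i 0%N| <= M) ->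
  symb J d f.
Proof.
elim: J d f => [|J IH] d f [bf sf] [M Mf]; split=> //.
- by apply: bndS_inv => //; exists M.
- by apply: bndS_inv => //; exists M.
apply: IH => //; have [C Cf] := bf.
exists (C * pw 0 d + M) => i; rewrite /dif (le_trans (ler_normB _ _))//.
by rewrite lerD.
Qed.

Lemma sym_S_inv (I : Type) d (f : I -> nat -> R) :
  sym d (fun i k => f i k.+1) -> (exists M, forall i, `|f i 0%N| <= M) ->
  sym d f.
Proof. by move=> sf Mf J; apply: symb_S_inv (sf J) Mf. Qed.

(* An unindexed sequence may be altered at finitely many places. *)
Lemma sym_addn_inv d (f : nat -> R) (m : nat) :
  sym d (fun (_ : unit) k => f (k + m)%N) -> sym d (fun (_ : unit) k => f k).
Proof.
elim: m f => [|m IH] f sf; first by apply: sym_ext sf => i k; rewrite addn0.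
apply: sym_S_inv; last by exists `|f 0%N|.
apply: (IH (fun k => f k.+1)); apply: sym_ext sf => i k.
by rewrite addnS.
Qed.

End Symbols.

(** * Symbols from smooth functions, and sequences asymptotic to a power *)

Section SymbolCalculus.
Variable R : realType.
Implicit Types (d e s t c : R) (k : nat).

Lemma MVT_ge0 (f df : R -> R) (x : R) : 0 <= x ->
  (forall y : R, 0 <= y -> is_derive y 1 f (df y)) ->
  exists2 z, x <= z <= x + 1 & f (x + 1) - f x = df z.
Proof.
move=> x0 fdf.
have dfx y : y \in `]x, x + 1[ -> is_derive y 1 f (df y).
  by rewrite in_itv /= => /andP[xy _]; apply: fdf; lra.
have cf : {within `[x, x + 1], continuous f}.
  apply: derivable_within_continuous => y; rewrite in_itv /= => /andP[xy _].
  by have [] := fdf y (le_trans x0 xy).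
have [|z zI E] := MVT _ dfx cf; first by rewrite ltrDl.
exists z; last by rewrite E; ring.
by move: zI; rewrite in_itv /= => /andP[h1 h2]; rewrite !ltW.
Qed.

Lemma powR_le_shift (x z s : R) : 0 <= x -> x <= z <= x + 1 ->
  (z + 1) `^ s <= 2 `^ `|s| * (x + 1) `^ s.
Proof. by move=> x0 /andP[xz zx]; apply: powR_le_ratio; lra. Qed.

Lemma chain_dif (I : Type) (F : I -> nat -> R -> R) d j :
  (forall (i : I) (x : R), 0 <= x -> is_derive x 1 (F i j) (F i j.+1 x)) ->
  (exists C, forall i (x : R), 0 <= x -> `|F i j.+1 x| <= C * (x + 1) `^ d) ->
  exists C, forall i (x : R), 0 <= x -> `|F i j (x + 1) - F i j x| <= C * (x + 1) `^ d.
Proof.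
move=> dF [C CF]; exists (`|C| * 2 `^ `|d|) => i x x0.
have [z zx ->] := MVT_ge0 x0 (dF i).
have z0 : 0 <= z by case/andP: zx => xz _; apply: le_trans xz.
rewrite (le_trans (CF i z z0))// -mulrA.
apply: (@le_trans _ _ (`|C| * (z + 1) `^ d)).
  by rewrite ler_wpM2r ?powR_ge0 ?ler_norm.
by rewrite ler_wpM2l// powR_le_shift.
Qed.

Lemma is_derive_shift1 (f : R -> R) (x df : R) : is_derive (x + 1) 1 f df ->
  is_derive x 1 (fun y => f (y + 1)) df.
Proof.
move=> fd; have h : is_derive x 1 (fun y : R => y + 1) 1.
  by apply: trigger_derive; rewrite addr0.
by have := @is_derive1_comp _ f (fun y => y + 1) x _ _ fd h; rewrite mulr1.
Qed.

Lemma is_derive_dif (f df : R -> R) (x : R) : 0 <= x ->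
  (forall y : R, 0 <= y -> is_derive y 1 f (df y)) ->
  is_derive x 1 (fun y => f (y + 1) - f y) (df (x + 1) - df x).
Proof.
move=> x0 fd; have h1 : is_derive x 1 (fun y => f (y + 1)) (df (x + 1)).
  by apply: is_derive_shift1; apply: fd; lra.
have h2 := fd x x0.
exact: (is_deriveB h1 h2).
Qed.

(** The difference of the restriction to the integers is again the restriction of a chain of
    derivatives, [F i j (x + 1) - F i j x], whose order is one lower by the mean value theorem.
    Carrying all derivatives as data makes this induction possible. *)
Lemma sym_chain (I : Type) (F : I -> nat -> R -> R) d :
  (forall (i : I) j (x : R), 0 <= x -> is_derive x 1 (F i j) (F i j.+1 x)) ->
  (forall j, exists C, forall i (x : R), 0 <= x ->
    `|F i j x| <= C * (x + 1) `^ (d - j%:R)) ->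
  sym d (fun i k => F i 0%N k%:R).
Proof.
move=> dF bF J; elim: J F d dF bF => [|J IH] F d dF bF.
  split=> //; have [C CF] := bF 0%N; exists C => i k.
  by have := CF i k%:R (ler0n _ _); rewrite subr0 natr1.
split.
  have [C CF] := bF 0%N; exists C => i k.
  by have := CF i k%:R (ler0n _ _); rewrite subr0 natr1.
have := IH (fun i j x => F i j (x + 1) - F i j x) (d - 1).
move=> H; apply: symb_ext (H (fun i j x x0 => is_derive_dif x0 (dF i j)) _).
- by move=> i k; rewrite /dif natr1.
- move=> j; apply: (@chain_dif I F (d - 1 - j%:R) j (fun i x => dF i j x)).
  have [C CF] := bF j.+1; exists C => i x x0; apply: le_trans (CF i x x0) _.
  by rewrite -natr1 opprD addrA addrAC.
Qed.

(** The first-order Taylor remainder costs two derivatives and therefore gains two orders; its own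
    differences are covered because the remainders of the [F i j] form a chain again. *)
Lemma sym_chain_taylor (I : Type) (F : I -> nat -> R -> R) d :
  (forall (i : I) j (x : R), 0 <= x -> is_derive x 1 (F i j) (F i j.+1 x)) ->
  (forall j, exists C, forall i (x : R), 0 <= x ->
    `|F i j x| <= C * (x + 1) `^ (d - j%:R)) ->
  sym (d - 2) (fun i k => F i 0%N k.+1%:R - F i 0%N k%:R - F i 1%N k%:R).
Proof.
move=> dF bF.
have := @sym_chain I (fun i j x => F i j (x + 1) - F i j x - F i j.+1 x) (d - 2).
move=> H.
have D i j (x : R) (x0 : 0 <= x) := is_deriveB (is_derive_dif x0 (dF i j)) (dF i j.+1 x x0).
apply: sym_ext (H D _).
- by move=> i k /=; rewrite natr1.
move=> j; have [C CF] := bF j.+2.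
exists (`|C| * 2 `^ `|d - j.+2%:R|) => i x x0.
have [z /andP[xz zx] ->] := MVT_ge0 x0 (dF i j).
have dG y : y \in `]x, z[%R -> is_derive y 1 (F i j.+1) (F i j.+2 y).
  by rewrite in_itv /= => /andP[xy _]; apply: dF; lra.
(* A second mean value step turns the difference of first derivatives at [z] and [x] into a second
   derivative times [z - x], which is at most 1. *)
have [|y] := MVT_segment xz dG.
  apply: derivable_within_continuous => y; rewrite in_itv /= => /andP[xy _].
  by have [] := dF i j.+1 y (le_trans x0 xy).
rewrite in_itv /= => /andP[xy yz] ->.
have y0 : 0 <= y by lra.
rewrite normrM -[leRHS]mulr1 ler_pM//; last by rewrite ger0_norm; lra.
rewrite (le_trans (CF i y y0))//.
have -> : d - 2 - j%:R = d - j.+2%:R by rewrite -addn2 natrD; ring.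
rewrite -mulrA; apply: (@le_trans _ _ (`|C| * (y + 1) `^ (d - j.+2%:R))).
  by rewrite ler_wpM2r ?powR_ge0 ?ler_norm.
by rewrite ler_wpM2l// powR_le_shift//; lra.
Qed.

Fixpoint ffallR (s : R) (j : nat) : R :=
  if j is j'.+1 then ffallR s j' * (s - j'%:R) else 1.

Definition pchain s c (_ : unit) (j : nat) (x : R) := ffallR s j * (x + c) `^ (s - j%:R).

Lemma is_derive_pchain s c i j (x : R) : 0 < c -> 0 <= x ->
  is_derive x 1 (pchain s c i j) (pchain s c i j.+1 x).
Proof.
move=> c0 x0; have h1 : is_derive x 1 (fun y : R => y + c) 1.
  by apply: trigger_derive; rewrite addr0.
have xc : 0 < x + c by lra.
have h2 := @is_derive1_comp _ (fun y => y `^ (s - j%:R)) (fun y => y + c) x _ _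
  (is_derive1_powR (s - j%:R) xc) h1.
have h3 := is_deriveZ (ffallR s j) h2.
apply: trigger_derive h3 _.
rewrite /pchain /= -[j.+1%:R]natr1 opprD addrA mulr1 -mulrA.
by [].
Qed.

Lemma bnd_pchain s c j : 0 < c ->
  exists C, forall i (x : R), 0 <= x -> `|pchain s c i j x| <= C * (x + 1) `^ (s - j%:R).
Proof.
move=> c0; exists (`|ffallR s j| * (1 + c + c^-1) `^ `|s - j%:R|) => i x x0.
have ci : 0 < c^-1 by rewrite invr_gt0.
have cc : c * c^-1 = 1 by rewrite divff ?gt_eqF.
rewrite normrM -mulrA ler_wpM2l// ger0_norm ?powR_ge0// powR_le_ratio//; last lra; nra.
Qed.

Lemma sym_powR s c : 0 < c -> sym s (fun (_ : unit) k => (k%:R + c) `^ s).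
Proof.
move=> c0; have := @sym_chain _ (pchain s c) s.
move=> H; apply: sym_ext (H (fun i j x => is_derive_pchain s i j c0) _) => //.
- by move=> i k; rewrite /pchain mul1r subr0.
- by move=> j; apply: bnd_pchain.
Qed.

Lemma sym_pw s : sym s (fun (_ : unit) k => pw k s).
Proof. by apply: sym_ext (sym_powR s ltr01) => i k; rewrite natr1. Qed.

Lemma sym_inv c : 0 < c -> sym (-1) (fun (_ : unit) k => (k%:R + c)^-1).
Proof.
move=> c0; apply: sym_ext (sym_powR (-1) c0) => i k.
by rewrite powR_inv1// addr_ge0// ltW.
Qed.

Lemma sym_pw_taylor s :
  sym (s - 2) (fun (_ : unit) k => pw k.+1 s - pw k s - s * pw k (s - 1)).
Proof.
have := @sym_chain_taylor _ (pchain s 1) s.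
move=> H; apply: sym_ext (H (fun i j x => is_derive_pchain s i j ltr01) _) => //.
- by move=> i k; rewrite /pchain /= !mul1r !subr0 !natr1.
- by move=> j; apply: bnd_pchain.
Qed.

(* [ratio_like t f]: f behaves as the quotient of consecutive values of k^t. *)
Definition ratio_like t (f : nat -> R) :=
  sym (-2) (fun (_ : unit) k => f k - 1 - t / k.+1%:R).

Lemma sym_invS : sym (-1) (fun (_ : unit) k => k.+1%:R^-1 : R).
Proof. by apply: sym_ext (sym_inv ltr01) => i k; rewrite natr1. Qed.

Lemma sym_id_add c : 0 < c -> sym 1 (fun (_ : unit) k => k%:R + c).
Proof.
move=> c0; apply: sym_ext (sym_powR 1 c0) => i k.
by rewrite powRr1// addr_ge0// ltW.
Qed.

Lemma ratio_likeM s t (f g : nat -> R) : ratio_like s f -> ratio_like t g ->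
  ratio_like (s + t) (fun k => f k * g k).
Proof.
rewrite /ratio_like => sf sg.
have c1 := sym_cst unit (1 : R).
have i1 := sym_invS.
have h1 : sym (-2) (fun (_ : unit) k => (f k - 1 - s / k.+1%:R) * g k).
  have gg : sym 0 (fun (_ : unit) k => g k).
    have h2 : sym (0 : R) (fun (_ : unit) k => t / k.+1%:R).
      by apply: symW (symZ t i1); lra.
    have h3 : sym (0 : R) (fun (_ : unit) k => g k - 1 - t / k.+1%:R).
      by apply: symW sg; lra.
    apply: sym_ext (symD (symD h3 h2) c1) => i k; ring.
  by have := symM sf gg; rewrite addr0.
have h4 : sym (-2) (fun (_ : unit) k => (1 + s / k.+1%:R) * (g k - 1 - t / k.+1%:R)).
  have ff : sym (0 : R) (fun (_ : unit) k => 1 + s / k.+1%:R).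
    by apply: symD => //; apply: symW (symZ s i1); lra.
  by have := symM ff sg; rewrite add0r.
have h5 : sym (-2) (fun (_ : unit) k => s * t * (k.+1%:R^-1 * k.+1%:R^-1) : R).
  have := symZ (s * t) (symM i1 i1).
  by have -> : -1 + -1 = -2 :> R by ring.
apply: sym_ext (symD h1 (symD h4 h5)) => i k.
have : k.+1%:R != 0 :> R by rewrite pnatr_eq0.
by move=> k0; field.
Qed.

Lemma ratio_like_ext s (f g : nat -> R) : (forall k, f k = g k) ->
  ratio_like s f -> ratio_like s g.
Proof. by move=> fg; have -> : f = g by apply/funext. Qed.

(** Subtracting [(x - y) / (k + 1)] from [(x - y) / (k + y)] leaves
    [(x - y)(1 - y) / ((k + y)(k + 1))], a product of two symbols of order -1. *)
Lemma ratio_like_frac (x y : R) : 0 < y ->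
  ratio_like (x - y) (fun k => (k%:R + x) / (k%:R + y)).
Proof.
move=> y0; rewrite /ratio_like; have -> : -2 = -1 + -1 :> R by ring.
apply: sym_ext (symZ ((x - y) * (1 - y)) (symM (sym_inv y0) sym_invS)) => i k.
have h : k%:R + y != 0 by rewrite gt_eqF// ltr_wpDl.
have h' : 1 + k%:R != 0 :> R by rewrite gt_eqF// ltr_wpDr.
by rewrite -natr1; field; rewrite addrC h'.
Qed.

Lemma ratio_like_pw s : ratio_like s (fun k => pw k.+1 s / pw k s).
Proof.
rewrite /ratio_like; have -> : -2 = s - 2 + - s by ring.
apply: sym_ext (symM (sym_pw_taylor s) (sym_pw (- s))) => i k.
rewrite pwN [pw k (s - 1)]pwD pwN1.
have := pw_gt0 k s; have : k.+1%:R != 0 :> R by rewrite pnatr_eq0.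
by move=> k0 /gt_eqF/negbT p0; field; rewrite ?natr1 ?nat1r p0 k0.
Qed.

Lemma ratio_like_powR s c : 0 < c ->
  ratio_like s (fun k => (k%:R + 1 + c) `^ s / (k%:R + c) `^ s).
Proof.
move=> c0.
have st : sym (s - 2) (fun (_ : unit) k =>
    (k%:R + 1 + c) `^ s - (k%:R + c) `^ s - s * (k%:R + c) `^ (s - 1)).
  have := @sym_chain_taylor _ (pchain s c) s.
  move=> H; apply: sym_ext (H (fun i j x => is_derive_pchain s i j c0) _) => //.
  - by move=> i k; rewrite /pchain /= !mul1r !subr0 -natr1.
  - by move=> j; apply: bnd_pchain.
have h1 := symM st (sym_powR (- s) c0).
have e1 : s - 2 + - s = -2 by ring.
rewrite e1 in h1.
have h2 := symZ (s * (1 - c)) (symM (sym_inv c0) sym_invS).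
have e2 : -1 + -1 = -2 :> R by ring.
rewrite e2 in h2.
apply: sym_ext (symD h1 h2) => _ k.
have kc : 0 < k%:R + c by rewrite ltr_wpDl.
rewrite powRN powRB ?(gt_eqF kc) ?implybT// powRr1 ?(ltW kc)//.
have : (k%:R + c) `^ s != 0 by rewrite gt_eqF// powR_gt0.
move: ((k%:R + 1 + c) `^ s) ((k%:R + c) `^ s) => x z z0.
have kc0 := lt0r_neq0 kc; have k0 : 1 + k%:R != 0 :> R by rewrite nat1r pnatr_eq0.
by rewrite -natr1; field; rewrite z0 kc0 addrC k0.
Qed.

(** The bound equals [C / (k + 1) - C / (k + 2)], so [a k - C / (k + 1)] increases while
    [a k + C / (k + 1)] decreases: the limit comes with its rate. *)
Lemma telescoping_cvg (C : R) (a : nat -> R) :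
  (forall k, `|a k.+1 - a k| <= C / (k.+1%:R * k.+2%:R)) ->
  exists l, forall k, `|a k - l| <= C / k.+1%:R.
Proof.
move=> Ca.
have C0 : 0 <= C.
  have := le_trans (normr_ge0 _) (Ca 0%N).
  by rewrite pmulr_lge0// invr_gt0 mulr_gt0.
have step k : C / (k.+1%:R * k.+2%:R) = C / k.+1%:R - C / k.+2%:R.
  have k0 : k.+1%:R != 0 :> R by rewrite pnatr_eq0.
  have k1 : k.+2%:R != 0 :> R by rewrite pnatr_eq0.
  apply/(mulIf (mulf_neq0 k0 k1)); rewrite divfK ?mulf_neq0// mulrBl.
  by rewrite mulrA divfK// [k.+1%:R * _]mulrC mulrA divfK// -[k.+2%:R]natr1; ring.
pose b k := a k - C / k.+1%:R; pose c k := a k + C / k.+1%:R.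
have bS k : b k <= b k.+1.
  by rewrite /b; have := Ca k; rewrite step ler_norml => /andP[];
    move: (C / _) (C / _) => x y h1 h2; lra.
have cS k : c k.+1 <= c k.
  by rewrite /c; have := Ca k; rewrite step ler_norml => /andP[];
    move: (C / _) (C / _) => x y h1 h2; lra.
have bmono m k : b k <= b (k + m)%N.
  by elim: m => [|m IH]; rewrite ?addn0// addnS (le_trans IH).
have cmono m k : c (k + m)%N <= c k.
  by elim: m => [|m IH]; rewrite ?addn0// addnS (le_trans _ IH).
have bc k m : b k <= c m.
  apply: le_trans (bmono m k) _; apply: le_trans (cmono k m).
  rewrite addnC /b /c lerD2l (@le_trans _ _ 0)// ?oppr_le0 divr_ge0//.
have hs : has_sup (range b).
  by split; [exists (b 0%N); exists 0%N|exists (c 0%N) => _ [k _ <-]].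
exists (sup (range b)) => k; rewrite ler_norml.
have h1 : b k <= sup (range b) by apply: ub_le_sup; [case: hs|exists k].
have h2 : sup (range b) <= c k by apply: ge_sup => [|_ [m _ <-]//]; case: hs.
by move: h1 h2; rewrite /b /c; move: (C / _) => x h1 h2; apply/andP; split; lra.
Qed.

Lemma bnd2_telescope (f : nat -> R) : bnd (-2) (fun (_ : unit) k => f k) ->
  exists C, forall k, `|f k| <= C / (k.+1%:R * k.+2%:R).
Proof.
move=> /bnd_ge0[C C0 Cf]; exists (C * 2) => k; apply: le_trans (Cf tt k) _.
rewrite pwN -[2]/(2%:R) pwn -mulrA ler_wpM2l// expr2.
rewrite -[k.+2%:R]natr1; have : 1 <= k.+1%:R :> R by rewrite ler1n.
move: (k.+1%:R : R) => x x1; have x0 : 0 < x by lra.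
by rewrite ler_pdivlMr ?mulr_gt0 ?addr_gt0// mulrC ler_pdivrMr ?mulr_gt0//; nra.
Qed.

(** Divide by [k^t]: the logarithm of the quotient [q] has summable increments, so [q] stays between
    positive constants and converges. Both quotients of neighbours are assumed because
    [ln x - ln y <= x / y - 1] bounds a logarithmic increment from one side only. *)
Lemma asymp_power (h : nat -> R) t : (forall k, 0 < h k) ->
  ratio_like t (fun k => h k.+1 / h k) ->
  ratio_like (- t) (fun k => h k / h k.+1) ->
  (exists2 kappa, 0 < kappa & sym (t - 1) (fun (_ : unit) k => h k - kappa * pw k t))
  /\ exists2 c, 0 < c & exists C, forall k, c * pw k t <= h k <= C * pw k t.
Proof.
move=> h0 r1 r2; pose q k := h k * pw k (- t).
have q0 k : 0 < q k by rewrite mulr_gt0 ?pw_gt0.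
have hq k : h k = q k * pw k t.
  by rewrite /q pwN mulfVK// gt_eqF ?pw_gt0.
have qE k : q k.+1 / q k = h k.+1 / h k * (pw k.+1 (- t) / pw k (- t)).
  by rewrite invfM mulrACA.
have qE' k : q k / q k.+1 = h k / h k.+1 * (pw k.+1 t / pw k t).
  by rewrite /q !pwN invfM !invrK; ring.
have s1 : sym (-2) (fun (_ : unit) k => q k.+1 / q k - 1).
  have := ratio_likeM r1 (ratio_like_pw (- t)); rewrite subrr.
  by apply: sym_ext => i k; rewrite -qE; ring.
have s2 : sym (-2) (fun (_ : unit) k => q k / q k.+1 - 1).
  have := ratio_likeM r2 (ratio_like_pw t); rewrite addNr.
  by apply: sym_ext => i k; rewrite -qE'; ring.
have [C1 b1] := bnd2_telescope (sym_bnd s1).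
have [C2 b2] := bnd2_telescope (sym_bnd s2).
have lnq k : `|ln (q k.+1) - ln (q k)| <= (`|C1| + `|C2|) / (k.+1%:R * k.+2%:R).
  have ln_le (x y : R) : 0 < x -> 0 < y -> ln x - ln y <= x / y - 1.
    move=> x0 y0; rewrite -ln_div ?posrE//.
    have /le_ln1Dx : -1 < x / y - 1 by rewrite ltrBrDr addNr divr_gt0.
    by rewrite addrC subrK.
  have P : 0 < (k.+1%:R * k.+2%:R)^-1 :> R by rewrite invr_gt0 mulr_gt0.
  have := ln_le _ _ (q0 k.+1) (q0 k); have := ln_le _ _ (q0 k) (q0 k.+1).
  move: P (b1 k) (b2 k); move: (k.+1%:R * k.+2%:R)^-1 => Q Q0.
  rewrite !ler_norml => /andP[_ h3] /andP[_ h4] h5 h6.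
  have E1 : C1 * Q <= `|C1| * Q by rewrite ler_wpM2r ?ler_norm// ltW.
  have E2 : C2 * Q <= `|C2| * Q by rewrite ler_wpM2r ?ler_norm// ltW.
  have E3 : 0 <= `|C1| * Q by rewrite mulr_ge0// ltW.
  have E4 : 0 <= `|C2| * Q by rewrite mulr_ge0// ltW.
  by rewrite mulrDl; apply/andP; split; lra.
have [l ll] := telescoping_cvg lnq.
pose M := expR (`|l| + (`|C1| + `|C2|)).
have qM k : q k <= M.
  rewrite -[q k]lnK ?posrE// ler_expR.
  have := ll k; rewrite ler_norml => /andP[_].
  have : (`|C1| + `|C2|) / k.+1%:R <= `|C1| + `|C2|.
    by rewrite ler_pdivrMr// ler_peMr ?addr_ge0// ler1n.
  by move: (_ / _) => x; have := ler_norm l; lra.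
have bq : bnd 0 (fun (_ : unit) k => q k).
  by exists M => i k; rewrite pw0 mulr1 ger0_norm// ltW.
have difq k : q k.+1 - q k = (q k.+1 / q k - 1) * q k.
  by rewrite mulrBl mul1r mulfVK// gt_eqF.
(* Bootstrap: the difference of [q] is [q] times a symbol of order -2, so control of [J] differences
   of [q] gives control of one more. *)
have symq J : symb J 0 (fun (_ : unit) k => q k).
  elim: J => [|J IH]; split => //.
  apply: (@symbW _ _ _ (-2 + 0)); first by lra.
  apply: symb_ext (symbM (s1 J) IH) => i k.
  by rewrite /dif difq.
have sdq : sym (-2) (fun (_ : unit) => dif q).
  rewrite -[-2]addr0 => J; apply: symb_ext (symbM (s1 J) (symq J)) => i k.
  by rewrite /dif difq.
have low k : expR (- (`|l| + (`|C1| + `|C2|))) <= q k.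
  rewrite -[q k]lnK ?posrE// ler_expR.
  have := ll k; rewrite ler_norml => /andP[+ _].
  have : (`|C1| + `|C2|) / k.+1%:R <= `|C1| + `|C2|.
    by rewrite ler_pdivrMr// ler_peMr ?addr_ge0// ler1n.
  by move: (_ / _) => x; have := ler_norm (- l); rewrite normrN; lra.
split; last first.
  exists (expR (- (`|l| + (`|C1| + `|C2|)))); first exact: expR_gt0.
  by exists M => k; rewrite hq !ler_wpM2r ?pw_ge0.
have [C3 b3] := bnd2_telescope (sym_bnd sdq).
have [kappa kq] := telescoping_cvg b3.
(* A limit [kappa <= 0] would push [q] below its positive lower bound [m] at an index beyond
   [|C3| / m]. *)
have kpos : 0 < kappa.
  rewrite ltNge; apply/negP => kle0.
  set m := expR _ in low; have m0 : 0 < m := expR_gt0 _.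
  pose k := Num.truncn (`|C3| / m).
  have kk : `|C3| / m < k.+1%:R := truncnS_gt _.
  have := kq k; rewrite ler_norml => /andP[_].
  have : C3 / k.+1%:R < m.
    rewrite ltr_pdivrMr//; move: kk; rewrite ltr_pdivrMr//.
    by have := ler_norm C3; rewrite mulrC; lra.
  by move: (_ / _) => x; have := low k; lra.
exists kappa => //.
have s3 : sym (-1) (fun (_ : unit) k => q k - kappa).
  apply: sym_of_dif.
    by exists C3 => i k; rewrite pwN1.
  have -> : -1 - 1 = -2 :> R by ring.
  by apply: sym_ext sdq => i k; rewrite /dif; ring.
have -> : t - 1 = -1 + t by ring.
apply: sym_ext (symM s3 (sym_pw t)) => i k.
by rewrite hq; ring.
Qed.

End SymbolCalculus.

(** * The dilated cutoffs as a uniform family of symbols *)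

Section Cutoff.
Variables (R : realType) (eta : R -> R).
Hypothesis eta_smooth : smooth eta.
Hypothesis eta_eq1 : forall x : R, `|x| <= 1 -> eta x = 1.
Hypothesis eta_eq0 : forall x : R, 2 <= `|x| -> eta x = 0.

Lemma cutoff_derive (m : nat) (x : R) :
  is_derive x 1 (derive1n m eta) (derive1n m.+1 eta x).
Proof.
by apply: DeriveDef; [exact: eta_smooth|rewrite derive1nS derive1E].
Qed.

Lemma cutoff_derive_eq0 (m : nat) (x : R) : 2 < x -> derive1n m eta x = 0.
Proof.
elim: m x => [|m IH] x x2.
  by apply: eta_eq0; rewrite (le_trans (ltW x2))// ler_norm.
rewrite derive1nS derive1E.
have -> : 'D_1 (derive1n m eta) x = 'D_1 (cst 0 : R -> R) x.
  apply: near_eq_derive.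
  by near=> y; rewrite IH//; near: y; exact: lt_nbhsr.
by rewrite derive_cst.
Unshelve. all: by end_near. Qed.

Lemma cutoff_bound (m : nat) :
  exists2 C, 0 <= C & forall x : R, 0 <= x -> `|derive1n m eta x| <= C.
Proof.
have cf : {within `[0, 3 : R], continuous (derive1n m eta)}.
  by apply: derivable_within_continuous => x _; exact: eta_smooth.
have [c1 _ h1] := EVT_max (ler0n R 3) cf.
have [c2 _ h2] := EVT_min (ler0n R 3) cf.
exists (`|derive1n m eta c1| + `|derive1n m eta c2|); first by rewrite addr_ge0.
move=> x x0; have [x3|x3] := leP x 3; last first.
  by rewrite cutoff_derive_eq0 ?normr0 ?addr_ge0//; lra.
have xI : x \in `[0, 3] by rewrite in_itv /= x0 x3.
have := h1 x xI; have := h2 x xI.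
have := ler_norm (derive1n m eta c1); have := ler_norm (- derive1n m eta c2).
have := normr_ge0 (derive1n m eta c1); have := normr_ge0 (derive1n m eta c2).
by rewrite normrN ler_norml => *; apply/andP; split; lra.
Qed.

(** The [j]-th derivative of [x -> eta (x / n)] is of size [n^-j] and lives on [x <= 2 n], where
    [x + 1 <= 3 n]. So [n^-1] may be replaced by [3 / (x + 1)], and the bound no longer depends on
    [n]. *)
Lemma sym_cutoff : sym 0 (fun n k => eta (k%:R / n%:R)).
Proof.
pose F (n : nat) (j : nat) (x : R) := derive1n j eta (x / n%:R) * n%:R^-1 ^+ j.
have dF n j (x : R) : 0 <= x -> is_derive x 1 (F n j) (F n j.+1 x).
  move=> x0.
  have h1 : is_derive x 1 (fun y : R => y / n%:R) (n%:R^-1).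
    by have := is_deriveM (is_derive_id x (1:R)) (is_derive_cst (n%:R^-1 : R) x 1);
       move/trigger_derive; apply; rewrite scaler0 add0r /GRing.scale /= mulr1.
  have h2 := @is_derive1_comp _ (derive1n j eta) (fun y => y / n%:R) x _ _
     (cutoff_derive j _) h1.
  have h3 := is_deriveM h2 (is_derive_cst (n%:R^-1 ^+ j : R) x 1).
  apply: trigger_derive h3 _.
  by rewrite scaler0 add0r /F exprSr /GRing.scale /= mulrC mulrA mulrAC.
apply: sym_ext (sym_chain dF _).
  by move=> n k; rewrite /F expr0 mulr1.
move=> j; have [C C0 Ce] := cutoff_bound j.
exists (C * 3 ^+ j) => n x x0; rewrite sub0r powRN powR_mulrn; last by rewrite addr_ge0.
have x1 : 0 < x + 1 by rewrite ltr_wpDl.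
rewrite -mulrA -expr_div_n /F normrM normrX.
(* For [n = 0] division by zero turns the member of the family into the constant [eta 0], and the
   higher terms of the chain into 0. *)
have [->|n0] := posnP n.
  rewrite !invr0 normr0 mulr0.
  case: j C0 Ce => [|j] C0 Ce; first by rewrite !expr0 ler_wpM2r// Ce.
  by rewrite expr0n mulr0 mulr_ge0// exprn_ge0 ?divr_ge0// ltW.
have n0' : 0 < n%:R :> R by rewrite ltr0n.
have [xn|xn] := leP (x / n%:R) 2; last first.
  by rewrite cutoff_derive_eq0// normr0 mul0r mulr_ge0// exprn_ge0// divr_ge0// ltW.
apply: ler_pM; rewrite ?exprn_ge0 ?Ce ?divr_ge0//.
apply: lerXn2r; rewrite ?nnegrE ?divr_ge0 ?(ltW x1)//.
rewrite ger0_norm ?invr_ge0 ?(ltW n0')// ler_pdivlMr// mulrC ler_pdivrMr//.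
rewrite ler_pdivrMr// in xn.
have n1 : 1 <= n%:R :> R by rewrite ler1n.
by lra.
Qed.

Lemma cutoff_one n k : (0 < n)%N -> (k <= n)%N -> eta (k%:R / n%:R) = 1.
Proof.
move=> n0 kn; apply: eta_eq1; rewrite ger0_norm ?divr_ge0//.
by rewrite ler_pdivrMr ?ltr0n// mul1r ler_nat.
Qed.

Lemma cutoff_zero n k : (0 < n)%N -> (n.*2 <= k)%N -> eta (k%:R / n%:R) = 0.
Proof.
move=> n0 kn; apply: eta_eq0; rewrite ger0_norm ?divr_ge0//.
by rewrite ler_pdivlMr ?ltr0n// -natrM ler_nat mul2n.
Qed.

End Cutoff.

(** * Euler's integral *)

Section Integrals.
Variable R : realType.
Notation mu := (@lebesgue_measure R).
Implicit Types (f g F : R -> R) (a b c : R).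

Lemma itv_within_continuous f a b :
  (forall x, a <= x <= b -> {for x, continuous f}) ->
  {within `[a, b], continuous f}.
Proof.
by move=> cf; apply: continuous_in_subspaceT => x; rewrite inE /= in_itv /=; exact: cf.
Qed.

Lemma itv_integrable f a b :
  (forall x, a <= x <= b -> {for x, continuous f}) ->
  mu.-integrable `[a, b] (EFin \o f).
Proof.
move=> cf; apply: continuous_compact_integrable; first exact: segment_compact.
exact: itv_within_continuous.
Qed.

Lemma Rint_FTC f F a b : a < b ->
  (forall x, a <= x <= b -> is_derive x 1 F (f x)) ->
  (forall x, a <= x <= b -> {for x, continuous f}) ->
  \int[mu]_(x in `[a, b]) f x = F b - F a.
Proof.
move=> ab dF cf; rewrite /Rintegral (@continuous_FTC2 _ f F)//.
- exact: itv_within_continuous.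
- have cF x : a <= x <= b -> {for x, continuous F}.
    move=> xab; apply: differentiable_continuous; apply/derivable1_diffP.
    by case: (dF x xab).
  split.
  + by move=> x; rewrite in_itv /= => /andP[ax xb]; case: (dF x) => //; rewrite !ltW.
  + by apply: cvg_at_right_filter; apply: cF; rewrite lexx ltW.
  + by apply: cvg_at_left_filter; apply: cF; rewrite lexx ltW.
- move=> x; rewrite in_itv /= => /andP[ax xb]; rewrite derive1E.
  by case: (dF x) => //; rewrite !ltW.
Qed.

Lemma le_Rint_itv f g a b :
  (forall x, a <= x <= b -> {for x, continuous f}) ->
  (forall x, a <= x <= b -> {for x, continuous g}) ->
  (forall x, a <= x <= b -> f x <= g x) ->
  \int[mu]_(x in `[a, b]) f x <= \int[mu]_(x in `[a, b]) g x.
Proof.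
move=> cf cg fg; apply: le_Rintegral => //; exact: itv_integrable.
Qed.

Lemma Rint_cst_itv c a b : a <= b -> \int[mu]_(x in `[a, b]) c = c * (b - a).
Proof.
move=> ab; have [->|ba] := eqVneq a b.
  by rewrite set_itv1 Rintegral_set1 subrr mulr0.
have D x : a <= x <= b -> is_derive x 1 ( *%R c) (cst c x).
  move=> _; have h := is_deriveZ c (is_derive_id x (1 : R)).
  by apply: trigger_derive h _; rewrite /GRing.scale /= mulr1.
have ab' : a < b by rewrite lt_neqAle ba.
rewrite (Rint_FTC ab' D); first by rewrite mulrBr.
by move=> x _; exact: cst_continuous.
Qed.

End Integrals.

Section Gamma.
Variable R : realType.
Notation mu := (@lebesgue_measure R).
Implicit Types (x t : R) (n : nat).

Definition gint x t : R := t `^ (x - 1) * expR (- t).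

(** Integration by parts is carried out on compact intervals exhausting the half line; for [n = 0]
    the interval is the point 1. *)
Definition gitv n : set R := `[n.+1%:R^-1, n.+1%:R].

Definition gtrunc n x : R := \int[mu]_(t in gitv n) gint x t.

Lemma gint_ge0 x t : 0 <= gint x t.
Proof. by rewrite mulr_ge0 ?powR_ge0 ?expR_ge0. Qed.

Lemma is_derive_powRexp x t : 0 < t ->
  is_derive t 1 (fun t => t `^ x * expR (- t)) (x * gint x t - gint (x + 1) t).
Proof.
move=> t0; have h1 := is_derive1_powR x t0.
have h2 : is_derive t 1 (fun t => expR (- t)) (- expR (- t)).
  have h3 := @is_derive1_comp _ expR (fun t => - t) t _ _ (is_derive_expR (- t))
    (is_deriveN (is_derive_id t (1 : R))).
  by apply: trigger_derive h3 _; rewrite mulrN1.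
apply: trigger_derive (is_deriveM h1 h2) _.
by rewrite /gint /GRing.scale /= addrK; ring.
Qed.

Lemma continuous_powR x t : 0 < t -> {for t, continuous (fun t => t `^ x)}.
Proof.
move=> t0; apply: differentiable_continuous; apply/derivable1_diffP.
by have [] := is_derive1_powR x t0.
Qed.

Lemma continuous_gint x t : 0 < t -> {for t, continuous (gint x)}.
Proof.
move=> t0; apply: differentiable_continuous; apply/derivable1_diffP.
by have [] := is_derive_powRexp (x - 1) t0.
Qed.

Lemma gitv_gt0 n t : n.+1%:R^-1 <= t <= n.+1%:R -> 0 < t.
Proof. by move=> /andP[+ _]; apply: lt_le_trans; rewrite invr_gt0. Qed.

Lemma gtrunc_ge0 n x : 0 <= gtrunc n x.
Proof. by apply: Rintegral_ge0 => t _; exact: gint_ge0. Qed.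

Lemma ltr_invS n : (0 < n)%N -> n.+1%:R^-1 < n.+1%:R :> R.
Proof. by move=> n0; rewrite (@lt_trans _ _ 1)// ?invf_lt1 ?ltr1n. Qed.

Lemma gtrunc_rec n x : (0 < n)%N ->
  gtrunc n (x + 1) = x * gtrunc n x -
    (n.+1%:R `^ x * expR (- n.+1%:R) - n.+1%:R^-1 `^ x * expR (- n.+1%:R^-1)).
Proof.
move=> n0.
have cg y s : n.+1%:R^-1 <= s <= n.+1%:R -> {for s, continuous (gint y)}.
  by move=> /gitv_gt0; exact: continuous_gint.
have ci y : mu.-integrable `[n.+1%:R^-1, n.+1%:R] (EFin \o gint y).
  by apply: itv_integrable => s; exact: cg.
have cx s : n.+1%:R^-1 <= s <= n.+1%:R -> {for s, continuous (fun t => x * gint x t)}.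
  by move=> ss; apply: continuousM; [exact: cst_continuous|exact: cg].
have D t (h : n.+1%:R^-1 <= t <= n.+1%:R) := is_derive_powRexp x (gitv_gt0 h).
rewrite -(Rint_FTC (ltr_invS n0) D).
  rewrite RintegralB// ?RintegralZl//; first by rewrite /gtrunc; ring.
  exact: itv_integrable.
by move=> t tt'; apply: continuousB; [exact: cx|exact: cg].
Qed.

Lemma powRexp_le x : exists2 C, 0 <= C & forall t, 1 <= t -> t `^ x * expR (- t) <= C / t.
Proof.
pose m := (Num.truncn `|x|).+1; exists m.+1`!%:R => // t t1.
have t0 : 0 < t by apply: lt_le_trans t1.
have h1 : t `^ x <= t ^+ m.
  rewrite -powR_mulrn ?(ltW t0)// ler_powR//.
  by rewrite (le_trans (ler_norm x))// ltW// truncnS_gt.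
have h2 : t ^+ m.+1 / m.+1`!%:R <= expR t.
  by have := expR_ge1Dxn m (ltW t0); lra.
rewrite expRN ler_pdivrMr ?expR_gt0// mulrAC ler_pdivlMr//.
rewrite ler_pdivrMr ?ltr0n ?fact_gt0// in h2.
apply: le_trans (ler_wpM2r (ltW t0) h1) _.
by rewrite -exprSr (le_trans h2)// mulrC.
Qed.

Lemma cvg_of_le_invn (u : nat -> R) (C : R) :
  (forall n, (0 < n)%N -> `|u n| <= C / n.+1%:R) -> u @ \oo --> (0 : R).
Proof.
move=> uC; apply/cvgrPdist_le => e e0; near=> n.
rewrite sub0r normrN (le_trans (uC n _))//; first by near: n; exists 1%N.
rewrite ler_pdivrMr// mulrC -ler_pdivrMr// (le_trans (ler_norm _))//.
rewrite (@le_trans _ _ n%:R)//; last by rewrite ler_nat.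
near: n; exists (Num.truncn (`|C / e|)).+1 => // n /= hn.
by rewrite (le_trans (ltW (truncnS_gt _)))// ler_nat.
Unshelve. all: by end_near. Qed.

Lemma powRexp_invn x : 0 < x ->
  (fun n => n.+1%:R^-1 `^ x * expR (- n.+1%:R^-1) : R) @ \oo --> (0 : R).
Proof.
move=> x0; have h : (fun n => n.+1%:R^-1 `^ x : R) @ \oo --> (0 : R).
  apply/cvgrPdist_le => e e0; near=> n.
  rewrite sub0r normrN ger0_norm ?powR_ge0//.
  have -> : e = (e `^ x^-1) `^ x by rewrite -powRrM mulVf ?gt_eqF// powRr1// ltW.
  rewrite ge0_ler_powR ?nnegrE ?powR_ge0 ?(ltW x0) ?invr_ge0//.
  rewrite -[leRHS]invrK lef_pV2 ?posrE ?invr_gt0 ?powR_gt0//.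
  near: n; exists (Num.truncn ((e `^ x^-1)^-1)) => // n /= hn.
  by rewrite (le_trans (ltW (truncnS_gt _)))// ler_nat.
apply/cvgrPdist_le => e e0; move/cvgrPdist_le : h => /(_ _ e0); apply: filterS => n.
rewrite !sub0r !normrN; apply: le_trans; rewrite normrM ler_piMr//.
by rewrite ger0_norm ?expR_ge0// expR_le1 oppr_le0.
Unshelve. all: by end_near. Qed.

Lemma powRexp_n x : (fun n => n.+1%:R `^ x * expR (- n.+1%:R) : R) @ \oo --> (0 : R).
Proof.
have [C C0 h] := powRexp_le x; apply: (@cvg_of_le_invn _ C) => n _.
by rewrite ger0_norm ?mulr_ge0 ?powR_ge0 ?expR_ge0// h// ler1n.
Qed.

Lemma gtrunc_cvge x :
  (\int[mu]_(t in gitv n) (gint x t)%:E)%E @[n --> \oo]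
    --> (\int[mu]_(t in `]0%R, +oo[) (gint x t)%:E)%E.
Proof.
have -> : `]0%R, +oo[%classic =
    \bigcup_n gitv n.
  apply/seteqP; split => [t|t [n _]]; rewrite /gitv /= !in_itv /=; last first.
    by rewrite andbT; exact: gitv_gt0.
  rewrite andbT => t0; exists (maxn (Num.truncn t) (Num.truncn t^-1)) => //=.
  rewrite in_itv /=; apply/andP; split; last first.
    by rewrite (le_trans (ltW (truncnS_gt _)))// ler_nat ltnS leq_maxl.
  rewrite -[leRHS]invrK lef_pV2 ?posrE ?invr_gt0//.
  by rewrite (le_trans (ltW (truncnS_gt _)))// ler_nat ltnS leq_maxr.
apply: ge0_nondecreasing_set_cvg_integral.
- apply/nondecreasing_seqP => n; rewrite subsetEset => t; rewrite /gitv /= !in_itv /=.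
  move=> /andP[h1 h2]; rewrite (le_trans _ h1) ?lef_pV2 ?posrE ?ler_nat//.
  by rewrite (le_trans h2)// ler_nat.
- by move=> n; exact: measurable_itv.
- move=> n; have := @itv_integrable _ (gint x) n.+1%:R^-1 n.+1%:R.
  have h t : n.+1%:R^-1 <= t <= n.+1%:R -> {for t, continuous (gint x)}.
    by move=> /gitv_gt0; exact: continuous_gint.
  by move=> /(_ h) /(measurable_int mu).
- by move=> n t _; rewrite lee_fin gint_ge0.
Qed.

Lemma gtrunc_fin n x :
  (\int[mu]_(t in gitv n) (gint x t)%:E = (gtrunc n x)%:E)%E.
Proof.
rewrite /gtrunc /Rintegral fineK//; apply: integrable_fin_num; rewrite /gitv//.
by apply: itv_integrable => t /gitv_gt0; exact: continuous_gint.
Qed.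

Lemma gammaR_fin x (M : R) : (forall n, gtrunc n x <= M) ->
  (\int[mu]_(t in `]0%R, +oo[) (gint x t)%:E)%E = (gammaR x)%:E.
Proof.
move=> bM; rewrite /gammaR /Rintegral fineK// ge0_fin_numE; last first.
  by apply: integral_ge0 => t _; rewrite lee_fin gint_ge0.
apply: (@le_lt_trans _ _ M%:E); last by rewrite ltry.
apply: (cvge_le _ (@gtrunc_cvge x)); near=> n.
by rewrite gtrunc_fin lee_fin.
Unshelve. all: by end_near. Qed.

Lemma gtrunc_le_gamma x (M : R) : (forall n, gtrunc n x <= M) ->
  gtrunc n x @[n --> \oo] --> gammaR x.
Proof.
move=> bM; have := @gtrunc_cvge x; rewrite (gammaR_fin bM).
under eq_fun do rewrite gtrunc_fin.
exact: fine_cvg.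
Qed.

Lemma gtrunc0 x : gtrunc 0 x = 0.
Proof. by rewrite /gtrunc /gitv invr1 set_itv1 Rintegral_set1. Qed.

Lemma gtrunc1 n : (0 < n)%N -> gtrunc n 1 = expR (- n.+1%:R^-1) - expR (- n.+1%:R).
Proof.
move=> n0; have := @gtrunc_rec n 0 n0.
by rewrite add0r !powRr0 !mul1r mul0r sub0r opprB.
Qed.

(** The recurrence bounds natural exponents. For general [x > 0] the exponent is first raised by one
    with the same recurrence, because [t^x <= 1 + t^m] holds on the whole half line, whereas
    [t^(x - 1)] may blow up at 0. *)
Lemma gtrunc_bounded x : 0 < x -> exists M, forall n, gtrunc n x <= M.
Proof.
have b1 : exists M, forall n, gtrunc n 1 <= M.
  exists 1 => -[|n]; first by rewrite gtrunc0.
  by rewrite gtrunc1// lerBlDr (@le_trans _ _ 1)// lerDl expR_ge0.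
have nstep (m : nat) : exists M, forall n, gtrunc n m.+1%:R <= M.
  elim: m => [//|m [M IH]].
  exists (m.+1%:R * M + 1) => -[|n]; first by rewrite gtrunc0 addr_ge0// mulr_ge0//
     (le_trans _ (IH 0%N)) ?gtrunc_ge0.
  rewrite -natr1 gtrunc_rec// opprB addrA -addrA lerD ?ler_wpM2l//.
  rewrite lerBlDr (@le_trans _ _ 1)//; last by rewrite lerDl mulr_ge0 ?powR_ge0 ?expR_ge0.
  rewrite mulr_ile1 ?powR_ge0 ?expR_ge0//.
  rewrite powR_mulrn// exprn_ile1// invf_le1//.
  by rewrite ler1n.
move=> x0; have [m xm] : exists m : nat, x <= m%:R.
  by exists (Num.truncn x).+1; rewrite ltW// truncnS_gt.
have [M1 h1] := b1; have [M2 h2] := nstep m; have [C C0 hC] := powRexp_le x.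
exists ((M1 + M2 + C) / x) => -[|n].
  rewrite gtrunc0 divr_ge0 ?(ltW x0)//.
  rewrite !addr_ge0//; first by apply: le_trans (h1 0%N); exact: gtrunc_ge0.
  by apply: le_trans (h2 0%N); exact: gtrunc_ge0.
rewrite ler_pdivlMr// mulrC.
have -> : x * gtrunc n.+1 x = gtrunc n.+1 (x + 1) +
    (n.+2%:R `^ x * expR (- n.+2%:R) - n.+2%:R^-1 `^ x * expR (- n.+2%:R^-1)).
  by rewrite gtrunc_rec//; ring.
have cg y s : n.+2%:R^-1 <= s <= n.+2%:R -> {for s, continuous (gint y)}.
  by move=> /gitv_gt0; exact: continuous_gint.
rewrite lerD//.
  apply: (@le_trans _ _ (gtrunc n.+1 1 + gtrunc n.+1 m.+1%:R)); last exact: lerD.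
  rewrite /gtrunc /gitv -RintegralD//; try by apply: itv_integrable => s; exact: cg.
  apply: le_Rint_itv; [by move=> s; exact: cg| |].
    by move=> s ss; apply: continuousD; exact: cg.
  move=> t /gitv_gt0 t0; rewrite /gint addrK subrr powRr0 -natr1 addrK -mulrDl.
  rewrite ler_wpM2r ?expR_ge0//.
  have [t1|t1] := leP t 1.
    rewrite -[leLHS]addr0 lerD ?powR_ge0//.
    have <- : 1 `^ x = 1 :> R by rewrite powR1.
    by rewrite ge0_ler_powR ?nnegrE ?(ltW x0) ?(ltW t0).
  by rewrite -[leLHS]add0r lerD// ler_powR// ltW.
rewrite lerBlDr -[leLHS]addr0 lerD ?mulr_ge0 ?powR_ge0 ?expR_ge0//.
rewrite (le_trans (hC _ _)) ?ler1n//.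
by rewrite ler_pdivrMr// ler_peMr// ler1n.
Qed.

Lemma gtrunc_cvg x : 0 < x -> gtrunc n x @[n --> \oo] --> gammaR x.
Proof. by move=> /gtrunc_bounded[M]; exact: gtrunc_le_gamma. Qed.

Lemma gammaR_rec x : 0 < x -> gammaR (x + 1) = x * gammaR x.
Proof.
move=> x0; have x1 : 0 < x + 1 by rewrite addr_gt0.
apply: (cvg_unique _ (gtrunc_cvg x1)).
  exact: Rhausdorff.
have h : (fun n => x * gtrunc n x -
    (n.+1%:R `^ x * expR (- n.+1%:R) - n.+1%:R^-1 `^ x * expR (- n.+1%:R^-1)))
    @ \oo --> x * gammaR x.
  rewrite -[x * gammaR x]subr0 -[X in _ - X](subrr 0).
  apply: cvgB; first by apply: cvgM; [exact: cvg_cst|exact: gtrunc_cvg].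
  by apply: cvgB; [exact: powRexp_n|exact: powRexp_invn].
apply: cvg_trans h; apply: near_eq_cvg; near=> n.
by rewrite gtrunc_rec//; near: n; exists 1%N.
Unshelve. all: by end_near. Qed.

Lemma gammaR1 : gammaR 1 = 1 :> R.
Proof.
apply: (cvg_unique _ (gtrunc_cvg ltr01)); first exact: Rhausdorff.
have h0 := @powRexp_n 0.
have h1 : (fun n => expR (- n.+1%:R^-1) : R) @ \oo --> (1 : R).
  have hh : (fun n => - n.+1%:R^-1 : R) @ \oo --> (0 : R).
    apply: (@cvg_of_le_invn _ 1) => n _.
    by rewrite normrN ger0_norm ?invr_ge0// mul1r.
  have := @continuous_expR R 0; rewrite /continuous_at expR0 => h2.
  exact: cvg_comp hh h2.
have h : (fun n => expR (- n.+1%:R^-1) - n.+1%:R `^ 0 * expR (- n.+1%:R) : R)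
    @ \oo --> (1 : R).
  by rewrite -[X in _ --> X]subr0; apply: cvgB.
apply: cvg_trans h; apply: near_eq_cvg; near=> n.
by rewrite gtrunc1 ?powRr0 ?mul1r//; near: n; exists 1%N.
Unshelve. all: by end_near. Qed.

Lemma gammaR_gt0 x : 0 < x -> 0 < gammaR x.
Proof.
move=> x0.
have ineq : gtrunc 1 x <= gammaR x.
  have [M bM] := gtrunc_bounded x0.
  rewrite -lee_fin -(gtrunc_fin 1) -(gammaR_fin bM).
  apply: ge0_subset_integral => //.
  - exact: measurable_itv.
  - apply/measurable_EFinP; apply: open_continuous_measurable_fun => //.
    by move=> t; rewrite inE /= in_itv /= andbT; exact: continuous_gint.
  - by move=> t _; rewrite lee_fin gint_ge0.
  - by move=> t; rewrite /gitv /= !in_itv /= andbT; exact: (@gitv_gt0 1).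
apply: lt_le_trans ineq.
have cg s : 2^-1 <= s <= 2 -> {for s, continuous (gint x)}.
  by move=> /(@gitv_gt0 1); exact: continuous_gint.
have [|c] := @EVT_min _ (gint x) (2^-1) 2 _ (itv_within_continuous cg); first lra.
rewrite in_itv /= => cI hc.
have c0 : 0 < gint x c.
  by rewrite mulr_gt0 ?expR_gt0// powR_gt0// (@gitv_gt0 1).
apply: (@lt_le_trans _ _ (\int[mu]_(t in `[2^-1, 2]) gint x c)).
  by rewrite Rint_cst_itv; [rewrite mulr_gt0//; lra|lra].
by apply: le_Rint_itv => // s _; exact: cst_continuous.
Qed.

End Gamma.

(** * Jacobi polynomials *)

Section JacobiAlgebra.
Variables (R : realType) (a b : R).
Hypotheses (ba : b <= a) (hb : - 2^-1 <= b).
Let la := a + b + 1.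
Implicit Types (j k s : nat).

Let la_ge0 : 0 <= la.
Proof. by rewrite /la; have := hb; have := ba; lra. Qed.

(** Taylor coefficients of the Gauss function [2F1(- k, k + la; a + 1; y)]. *)
Definition hcoef k j : R :=
  \prod_(i < j) ((i%:R - k%:R) * (i%:R + k%:R + la) / ((i%:R + a + 1) * i.+1%:R)).

Definition hpoly k : {poly R} := \poly_(j < k.+1) hcoef k j.

Lemma hcoefS k j : hcoef k j.+1 =
  hcoef k j * ((j%:R - k%:R) * (j%:R + k%:R + la) / ((j%:R + a + 1) * j.+1%:R)).
Proof. by rewrite /hcoef big_ord_recr. Qed.

Lemma hcoef0 k : hcoef k 0 = 1.
Proof. by rewrite /hcoef big_ord0. Qed.

Lemma hcoef_eq0 k j : (k < j)%N -> hcoef k j = 0.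
Proof.
move=> kj; rewrite /hcoef (bigD1 (Ordinal kj)) //= subrr.
by rewrite !mul0r.
Qed.

Lemma coef_hpoly k j : (hpoly k)`_j = hcoef k j.
Proof. by rewrite coef_poly ltnS; case: leqP => // /hcoef_eq0. Qed.

Let ja_neq0 j : j%:R + a + 1 != 0.
Proof. by rewrite gt_eqF//; have := hb; have := ba; have := ler0n R j; lra. Qed.

Let jS_neq0 j : j.+1%:R != 0 :> R.
Proof. by rewrite pnatr_eq0. Qed.

Lemma hcoef_rec k j : j.+1%:R * (j%:R + a + 1) * hcoef k j.+1 =
  (j%:R - k%:R) * (j%:R + k%:R + la) * hcoef k j.
Proof.
rewrite hcoefS -natr1; move: (ja_neq0 j) (jS_neq0 j); rewrite -natr1 => h1 h2.
by field; rewrite ?h1 ?h2.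
Qed.

Definition rising (x : R) j : R := \prod_(i < j) (x + i%:R).

Lemma risingS x j : rising x j.+1 = rising x j * (x + j%:R).
Proof. by rewrite /rising big_ord_recr. Qed.

Lemma risingSl x j : rising x j.+1 = x * rising (x + 1) j.
Proof.
rewrite /rising big_ord_recl addr0; congr *%R; apply: eq_bigr => i _.
by rewrite -natr1; ring.
Qed.

Lemma rising0 x : rising x 0 = 1.
Proof. by rewrite /rising big_ord0. Qed.

Lemma hcoef_rising k j : hcoef k j =
  rising (- k%:R) j * rising (k%:R + la) j / (rising (a + 1) j * j`!%:R).
Proof.
elim: j => [|j IH]; first by rewrite hcoef0 !rising0 fact0 !mulr1 divr1.
have h0 m : rising (a + 1) m != 0.
  by apply/prodf_neq0 => i _; have -> : a + 1 + i%:R = i%:R + a + 1 by ring.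
have h1 : j`!%:R != 0 :> R by rewrite pnatr_eq0 -lt0n fact_gt0.
have := ja_neq0 j; have := jS_neq0 j.
rewrite hcoefS IH !risingS factS natrM -[j.+1%:R]natr1 => h2 h3.
by field; rewrite h0 h1 h2 [a + 1 + _]addrC addrA h3.
Qed.

(** At [k = 0] the general formula contains the quotient [la / la]. The cancelled form is needed
    because [la] vanishes for [a = b = - 1/2]. *)
Definition recA k : R := if k is 0%N then 2 * (a + 1) / (la + 1)
  else 2 * (k%:R + la) * (k%:R + a + 1) / ((2 * k%:R + la) * (2 * k%:R + la + 1)).

Definition recC k : R :=
  2 * k%:R * (k%:R + b) / ((2 * k%:R + la - 1) * (2 * k%:R + la)).

Lemma recC0 : recC 0 = 0.
Proof. by rewrite /recC mulr0 !mul0r. Qed.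

(** The coefficients that meet in a contiguous relation share the factor [z] and have polynomial
    cofactors, so each relation becomes an identity of rational functions. Quotients of neighbouring
    coefficients would not do: factors such as [j - k] vanish. *)
Lemma hcoef_neighbours k j : exists z, [/\
  hcoef k.+1 j.+1 = - (k%:R + 1) * (k%:R + 1 + la) * (a + 2 + j%:R) * (j%:R + 2) * z,
  hcoef k.+1 j.+2 = - (k%:R + 1) * (k%:R + 1 + la) * (j%:R - k%:R) * (k%:R + la + 2 + j%:R) * z,
  hcoef k.+2 j.+2 = (k%:R + 2) * (k%:R + 1) * (k%:R + la + 2 + j%:R) * (k%:R + la + 3 + j%:R) * z
& hcoef k j.+2 = (j%:R - k%:R) * (j%:R + 1 - k%:R) * (k%:R + la) * (k%:R + 1 + la) * z].
Proof.
exists (rising (- k%:R) j * rising (k%:R + la + 2) j / (rising (a + 1) j.+2 * j.+2`!%:R)).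
have h0 m : rising (a + 1) m != 0.
  by apply/prodf_neq0 => i _; have -> : a + 1 + i%:R = i%:R + a + 1 by ring.
have h1 : j.+2`!%:R != 0 :> R by rewrite pnatr_eq0 -lt0n fact_gt0.
have h1' : j.+1`!%:R != 0 :> R by rewrite pnatr_eq0 -lt0n fact_gt0.
have h2 := h0 j.+2; have h2' := h0 j.+1.
have h3 := ja_neq0 j.+1; have h4 := jS_neq0 j.+1.
have e1 : - k.+1%:R = - k%:R - 1 :> R by rewrite -natr1; ring.
have e2 : - k.+2%:R = - k%:R - 2 :> R by rewrite -addn2 natrD; ring.
have r1 : rising (- k%:R - 1) j.+1 = - (k%:R + 1) * rising (- k%:R) j.
  by rewrite risingSl subrK; ring.
have r2 : rising (k.+1%:R + la) j.+1 = (k%:R + 1 + la) * rising (k%:R + la + 2) j.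
  rewrite risingSl -natr1; congr (_ * rising _ _); ring.
split; rewrite hcoef_rising.
- rewrite e1 r1 r2 [rising (a + 1) j.+2]risingS (factS j.+1) natrM.
  rewrite -[j.+2%:R]natr1 -[j.+1%:R]natr1 in h4 h3 *.
  by field; rewrite h2' h1'; rewrite (_ : a + 1 + _ = j%:R + 1 + a + 1) ?h3 ?h4//; ring.
- rewrite e1 [rising _ j.+2]risingS r1 [rising (_ + la) _]risingS r2 -[j.+1%:R]natr1 -[k.+1%:R]natr1.
  by field; rewrite h1 h2.
- rewrite e2 risingSl (_ : _ - 2 + 1 = - k%:R - 1) ?r1; last by ring.
  rewrite [rising (k.+2%:R + la) _]risingS [rising (k.+2%:R + la) _]risingS.
  rewrite (_ : k.+2%:R = k%:R + 2); last by rewrite -addn2 natrD.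
  rewrite (_ : k%:R + 2 + la = k%:R + la + 2); last by ring.
  by rewrite -[j.+1%:R]natr1; field; rewrite h1 h2.
- rewrite [rising (- _) _]risingS [rising (- _) _]risingS.
  rewrite [rising (k%:R + la) _]risingSl [rising (k%:R + la + 1) _]risingSl.
  rewrite (_ : k%:R + la + 1 + 1 = k%:R + la + 2); last by ring.
  by rewrite -[j.+1%:R]natr1; field; rewrite h1 h2.
Qed.

Lemma recAS k : recA k.+1 =
  2 * (k%:R + 1 + la) * (k%:R + a + 2) / ((2 * k%:R + 2 + la) * (2 * k%:R + la + 3)).
Proof. by rewrite /recA -natr1; congr (_ / _); ring. Qed.

Lemma recCS k : recC k.+1 =
  2 * (k%:R + 1) * (k%:R + 1 + b) / ((2 * k%:R + la + 1) * (2 * k%:R + la + 2)).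
Proof. by rewrite /recC -natr1; congr (_ / _); ring. Qed.

Lemma hcoef1 k : hcoef k 1 = - k%:R * (k%:R + la) / (a + 1).
Proof. by rewrite hcoefS hcoef0 mulr0n !add0r mul1r mulr1. Qed.

Let dens k : [/\ 2 * k%:R + la + 1 != 0, 2 * k%:R + la + 2 != 0,
   2 * k%:R + la + 3 != 0, a + 1 != 0 & la + 1 != 0].
Proof.
have := ler0n R k; have := la_ge0; have := hb; have := ba => h1 h2 h3 h4.
by split; rewrite gt_eqF//; lra.
Qed.

Lemma hpoly_rec0 : 2 *: ('X * hpoly 0) = - recA 0 *: hpoly 1 + recA 0 *: hpoly 0.
Proof.
have [_ _ _ d4 d5] := dens 0.
apply/polyP => -[|[|j]]; rewrite !(coefD, coefZ, coefXM) !coef_hpoly /=.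
- by rewrite !hcoef0; ring.
- rewrite hcoef0 !hcoef1 /=; field; rewrite d4 //=.
- by rewrite !hcoef_eq0// !mulr0 addr0.
Qed.

Lemma hpoly_rec k : 2 *: ('X * hpoly k.+1) =
  - recA k.+1 *: hpoly k.+2 + (recA k.+1 + recC k.+1) *: hpoly k.+1
  - recC k.+1 *: hpoly k.
Proof.
have [d1 d2 d3 d4 d5] := dens k; rewrite recAS recCS.
have d2' : 2 * k%:R + 2 + la != 0 by rewrite addrAC.
apply/polyP => -[|[|j]]; rewrite !(coefD, coefN, coefZ, coefXM) !coef_hpoly /=.
- by rewrite !hcoef0; field; rewrite d1 d2 d3.
- rewrite hcoef0 !hcoef1 /= (_ : k.+2%:R = k%:R + 2) -?[k.+1%:R]natr1; last by rewrite -addn2 natrD.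
  by rewrite /la in d1 d2 d3 d2' *; field; rewrite d1 d2 d3 d4.
- have [z [-> -> -> ->]] := hcoef_neighbours k j.
  by rewrite /la in d1 d2 d3 d2' *; field; rewrite d1 d2 d3.
Qed.

Lemma hpoly_deriv0 : (hpoly 0)^`() = 0.
Proof.
apply/polyP => j; rewrite coef_deriv coef_hpoly coef0 hcoef_eq0//.
by rewrite mul0rn.
Qed.

(** Structure relation, the first-order companion of the three-term recurrence; it is later
    transferred to multipliers as [Mop]. *)
Lemma hpoly_deriv k : - 2 *: ('X * (1 - 'X) * (hpoly k.+1)^`()) =
  (k.+1%:R * recA k.+1) *: (hpoly k.+1 - hpoly k.+2)
  - ((k.+1%:R + la) * recC k.+1) *: (hpoly k.+1 - hpoly k).
Proof.
have [d1 d2 d3 d4 d5] := dens k; rewrite recAS recCS.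
have d2' : 2 * k%:R + 2 + la != 0 by rewrite addrAC.
have -> : 'X * (1 - 'X) * (hpoly k.+1)^`() =
  'X * (hpoly k.+1)^`() - 'X * ('X * (hpoly k.+1)^`()) by ring.
apply/polyP => -[|[|j]]; rewrite !(coefD, coefN, coefZ, coefXM, coef_deriv) !coef_hpoly /=.
- by rewrite !hcoef0; ring.
- rewrite !hcoef1 /= (_ : k.+2%:R = k%:R + 2) -?[k.+1%:R]natr1; last by rewrite -addn2 natrD.
  by rewrite /la in d1 d2 d3 d2' *; field; rewrite d1 d2 d3 d4.
- rewrite -[hcoef _ _ *+ j.+2]mulr_natr -[hcoef _ _ *+ j.+1]mulr_natr.
  have [z [-> -> -> ->]] := hcoef_neighbours k j.
  rewrite (_ : j.+2%:R = j%:R + 2) -?[j.+1%:R]natr1 -?[k.+1%:R]natr1; last by rewrite -addn2 natrD.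
  by rewrite /la in d1 d2 d3 d2' *; field; rewrite d1 d2 d3.
Qed.

Lemma hpoly_ode k : 'X * (1 - 'X) * (hpoly k)^`()^`() +
  ((a + 1)%:P - (la + 1) *: 'X) * (hpoly k)^`() + (k%:R * (k%:R + la)) *: hpoly k = 0.
Proof.
have -> : 'X * (1 - 'X) * (hpoly k)^`()^`() =
  'X * (hpoly k)^`()^`() - 'X * ('X * (hpoly k)^`()^`()) by ring.
rewrite mulrBl -scalerAl.
apply/polyP => j; rewrite !(coefD, coefN, coefZ, coefXM, coefCM, coef_deriv, coef0) !coef_hpoly /=.
have h m : hcoef k m.+1 *+ m.+1 = (m%:R - k%:R) * (m%:R + k%:R + la) / (m%:R + a + 1) * hcoef k m.
  apply: (mulIf (ja_neq0 m)); rewrite [RHS]mulrAC divfK// -hcoef_rec.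
  by rewrite -[_ *+ m.+1]mulr_natr; ring.
case: j => [|[|j]] /=.
- rewrite (h 0%N) mulr0n; have := ja_neq0 0; rewrite mulr0n add0r => ?; by field.
- rewrite (h 1%N); have := ja_neq0 1; rewrite !mulr1n => ?; by field.
- rewrite (h j.+2) -[_ *+ j.+2]mulr_natr -[hcoef _ _ *+ j.+2]mulr_natr -[_ *+ j.+1]mulr_natr.
  have := ja_neq0 j.+2; rewrite (_ : j.+2%:R = j%:R + 2) -?[j.+1%:R]natr1 => [?|]; last by rewrite -addn2 natrD.
  by field.
Qed.

End JacobiAlgebra.

(** * Hypergeometric form of the Jacobi polynomials, and size of the weights [jw] *)

Section JacobiExplicit.
Variables (R : realType) (a b : R).
Hypotheses (ba : b <= a) (hb : - 2^-1 <= b).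
Let la := a + b + 1.
Implicit Types (j k s t : nat).

Let bern s t : {poly R} := (- 'X) ^+ s * (1 - 'X) ^+ t.

Let deriv_bern s t :
  (bern s t)^`() = - (s%:R * bern s.-1 t) - t%:R * bern s t.-1.
Proof.
have d1 : (1 - 'X : {poly R})^`() = -1.
  by rewrite derivB derivX -[X in X^`() - _]polyC1 derivC sub0r.
rewrite /bern derivM !deriv_exp d1 derivN derivX.
rewrite -(mulr_natl _ s) -(mulr_natl _ t).
by case: s t => [|s] [|t] /=; ring.
Qed.

Let bern_ode s t :
  'X * (1 - 'X) * (bern s t)^`()^`()
  + ((a + 1)%:P - (a + b + 2)%:P * 'X) * (bern s t)^`()
  + s%:R * (s%:R + a%:P) * bern s.-1 t.+1
  + (2 * s%:R * t%:R + (a%:P + 1) * t%:R + (b%:P + 1) * s%:R) * bern s t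
  + t%:R * (t%:R + b%:P) * bern s.+1 t.-1 = 0.
Proof.
have dn n : (n%:R : {poly R})^`() = 0 by rewrite -polyC_natr derivC.
have dM n p : (n%:R * p : {poly R})^`() = n%:R * p^`() by rewrite derivM dn mul0r add0r.
rewrite deriv_bern derivB derivN !dM !deriv_bern.
rewrite !polyCD polyC1 /bern.
by case: s t => [|[|s]] [|[|t]] /=; rewrite ?exprS ?expr0 -?natr1; ring.
Qed.

Lemma binomR0 (x : R) : binomR x 0 = 1.
Proof. by rewrite /binomR big_ord0 fact0 divr1. Qed.

Lemma binomR_rec (x : R) k : k.+1%:R * binomR x k.+1 = (x - k%:R) * binomR x k.
Proof.
rewrite /binomR big_ord_recr /= factS natrM.
have k0 : k.+1%:R != 0 :> R by rewrite pnatr_eq0.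
have k1 : k`!%:R != 0 :> R by rewrite pnatr_eq0 -lt0n fact_gt0.
by rewrite invfM; field; rewrite ?nat1r k0 k1.
Qed.

Lemma binomR_diag (x : R) k :
  k.+1%:R * binomR (k.+1%:R + x) k.+1 = (k%:R + 1 + x) * binomR (k%:R + x) k.
Proof.
rewrite /binomR big_ord_recl /= factS natrM subr0.
have -> : \prod_(i < k) (k.+1%:R + x - (bump 0 i)%:R) = \prod_(i < k) (k%:R + x - i%:R).
  by apply: eq_bigr => i _; rewrite /bump /= add1n -!natr1; ring.
have k0 : k.+1%:R != 0 :> R by rewrite pnatr_eq0.
have k1 : k`!%:R != 0 :> R by rewrite pnatr_eq0 -lt0n fact_gt0.
rewrite -natr1 in k0 *.
by rewrite invfM; field; rewrite ?k0 ?k1.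
Qed.

Lemma binomR_diag_gt0 (x : R) k : -1 < x -> 0 < binomR (k%:R + x) k.
Proof.
move=> x1; elim: k => [|k IH]; first by rewrite binomR0.
have k0 : 0 < k.+1%:R :> R by [].
rewrite -(pmulr_rgt0 _ k0) binomR_diag mulr_gt0//.
by have := ler0n R k; lra.
Qed.

Lemma binomR_diag_le (x y : R) k : -1 < x -> x <= y ->
  binomR (k%:R + x) k <= binomR (k%:R + y) k.
Proof.
move=> x1 xy; elim: k => [|k IH]; first by rewrite !binomR0.
have k0 : 0 < k.+1%:R :> R by [].
rewrite -(ler_pM2l k0) !binomR_diag ler_pM//; have := ler0n R k; try lra.
by move=> _; apply/ltW/binomR_diag_gt0.
Qed.

Let jcoef k s := binomR (k%:R + a) (k - s) * binomR (k%:R + b) s.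

Let jcoef_rec k s : (s < k)%N ->
  jcoef k s.+1 * (s.+1%:R * (s.+1%:R + a)) =
  jcoef k s * ((k - s)%:R * ((k - s)%:R + b)).
Proof.
move=> sk; rewrite /jcoef; have := binomR_rec (k%:R + b) s.
have := binomR_rec (k%:R + a) (k - s.+1).
rewrite -subSn// subSS natrB ?(ltnW sk)// natrB// => h1 h2.
set B1 := binomR _ (k - s.+1) in h1 *; set B2 := binomR _ s.+1 in h2 *.
transitivity ((k%:R + a - (k%:R - s.+1%:R)) * B1 * (s.+1%:R * B2)); first by ring.
by rewrite -h1 h2; ring.
Qed.

Definition jpoly k : {poly R} := \sum_(s < k.+1) (jcoef k s)%:P * bern s (k - s).

Lemma jacobi_jpoly k (t : R) : (jacobi a b k).[t] = (jpoly k).[(1 - t) / 2].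
Proof.
rewrite /jacobi /jpoly !horner_sum; apply: eq_bigr => s _.
have h1 : 2^-1 * (t - 1) = - ((1 - t) / 2) by field.
have h2 : 2^-1 * (t + 1) = 1 - (1 - t) / 2 by field.
by rewrite !hornerE /= h1 h2 /jcoef [binomR _ s]/binomR !mulrA.
Qed.

(** On the products [bern s (k - s)] the operator is tridiagonal, with off-diagonal weights [- lo]
    and [- hi] and diagonal weight [lo + hi]. Since [lo (s + 1) = hi s], everything cancels after
    reindexing. *)
Lemma jpoly_ode k : 'X * (1 - 'X) * (jpoly k)^`()^`()
  + ((a + 1)%:P - (a + b + 2)%:P * 'X) * (jpoly k)^`()
  + (k%:R * (k%:R + a%:P + b%:P + 1)) * jpoly k = 0.
Proof.
have dC (c : R) p : (c%:P * p)^`() = c%:P * p^`() by rewrite derivM derivC mul0r add0r.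
rewrite /jpoly !(raddf_sum (@deriv R)) /= mulr_sumr mulr_sumr mulr_sumr -!big_split /=.
pose c s : {poly R} := (jcoef k s)%:P.
pose lo s := c s * (s%:R * (s%:R + a%:P)).
pose hi s := c s * ((k - s)%:R * ((k - s)%:R + b%:P)).
have lohi s : (s < k)%N -> lo s.+1 = hi s.
  move=> sk; move: (jcoef_rec sk); rewrite /lo /hi /c.
  move: (jcoef k s.+1) (jcoef k s) => x y /(congr1 polyC).
  by rewrite !polyCM !polyCD !polyC_natr.
have E : \sum_(s < k.+1) (lo s * bern s.-1 (k - s).+1) = \sum_(s < k.+1) hi s * bern s (k - s).
  rewrite big_ord_recl big_ord_recr /= {1}/lo mulr0n !mul0r mulr0 mul0r add0r.
  rewrite {2}/hi subnn mul0r mulr0 mul0r addr0; apply: eq_bigr => i _.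
  by rewrite /bump /= add1n lohi ?ltn_ord// subnSK.
have E' : \sum_(s < k.+1) (hi s * bern s.+1 (k - s).-1) = \sum_(s < k.+1) lo s * bern s (k - s).
  rewrite big_ord_recr [RHS]big_ord_recl /= {2}/hi subnn mul0r mulr0 mul0r addr0.
  rewrite {1}/lo mulr0n !mul0r mulr0 mul0r add0r; apply: eq_bigr => i _.
  by rewrite /bump /= add1n lohi ?ltn_ord// subnS.
apply: (@etrans _ _ (\sum_(s < k.+1) (hi s * bern s (k - s) - lo s * bern s.-1 (k - s).+1)
  + \sum_(s < k.+1) (lo s * bern s (k - s) - hi s * bern s.+1 (k - s).-1))); last first.
  by rewrite !sumrB E E' !subrr addr0.
rewrite -big_split /=; apply: eq_bigr => s _.
have := bern_ode s (k - s); rewrite !dC.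
have sk : (s <= k)%N by have := ltn_ord s; rewrite ltnS.
rewrite /hi /lo natrB//; set d2 := (bern s _)^`()^`(); set d1 := (bern s _)^`().
set b1 := bern s _; set b2 := bern _ _; set b3 := bern _ _ => H.
apply/eqP; rewrite -subr_eq0; apply/eqP.
apply: (@etrans _ _ (c s * 0)); last by rewrite mulr0.
by rewrite -H /c; ring.
Qed.

Lemma ode_coef k (p : {poly R}) :
  'X * (1 - 'X) * p^`()^`() + ((a + 1)%:P - (a + b + 2)%:P * 'X) * p^`()
    + (k%:R * (k%:R + a%:P + b%:P + 1)) * p = 0 ->
  forall j, j.+1%:R * (j%:R + a + 1) * p`_j.+1 = (j%:R - k%:R) * (j%:R + k%:R + la) * p`_j.
Proof.
move=> ode j; have := congr1 (fun q : {poly R} => q`_j) ode.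
have -> : 'X * (1 - 'X) * p^`()^`() = 'X * p^`()^`() - 'X * ('X * p^`()^`()) by ring.
have -> : k%:R * (k%:R + a%:P + b%:P + 1) = (k%:R * (k%:R + a + b + 1))%:P :> {poly R}.
  by rewrite polyCM !polyCD polyC1 polyC_natr.
have -> : ((a + 1)%:P - (a + b + 2)%:P * 'X) * p^`() =
    (a + 1)%:P * p^`() - (a + b + 2)%:P * ('X * p^`()) by ring.
rewrite !(coefD, coefN, coefXM, coefCM, coef_deriv, coef0) /=.
have aux (x y z : R) : z = 0 -> x - y = z -> x = y.
  by move=> -> /eqP; rewrite subr_eq0 => /eqP.
case: j => [|[|j]] /=.
- by rewrite mulr1n mulr0n => H; apply: (aux _ _ _ H); rewrite /la; ring.
- by rewrite mulr1n => H; apply: (aux _ _ _ H); rewrite /la ?mulr1n; ring.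
- rewrite -[_ *+ j.+3]mulr_natr -[_ * _ *+ j.+2]mulr_natr -[p`__ *+ j.+2]mulr_natr.
  rewrite -[_ *+ j.+1]mulr_natr => H; apply: (aux _ _ _ H).
  by rewrite /la -[j.+3%:R]natr1 -[j.+2%:R]natr1 -[j.+1%:R]natr1; ring.
Qed.

(** On coefficients the hypergeometric equation is a two-term recurrence, so the value at 0
    determines a polynomial solution. *)
Lemma jpoly_hpoly k : jpoly k = binomR (k%:R + a) k *: hpoly a b k.
Proof.
have j0 : (jpoly k)`_0 = binomR (k%:R + a) k.
  by rewrite -horner_coef0 -(jacobi_at1 a b) jacobi_jpoly subrr mul0r.
apply/polyP => j; rewrite coefZ coef_hpoly; elim: j => [|j IH].
  by rewrite j0 hcoef0 mulr1.
have d0 : j.+1%:R * (j%:R + a + 1) != 0.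
  rewrite mulf_neq0 ?pnatr_eq0// gt_eqF//.
  by have := hb; have := ba; have := ler0n R j; lra.
apply: (mulfI d0); rewrite (ode_coef (jpoly_ode k)) IH mulrCA [RHS]mulrCA.
by rewrite hcoef_rec.
Qed.

Let a_gtN1 : -1 < a. Proof. by have := hb; have := ba; lra. Qed.
Let b_gtN1 : -1 < b. Proof. by have := hb; lra. Qed.
Let la_ge0 : 0 <= la. Proof. by rewrite /la; have := hb; have := ba; lra. Qed.

Lemma hpoly_at0 k : (hpoly a b k).[0] = 1.
Proof. by rewrite horner_coef0 coef_hpoly hcoef0. Qed.

(** Up to sign, the value is the quotient of [binomR (k + b) k] by [binomR (k + a) k], which
    [b <= a] keeps below 1. *)
Lemma hpoly_at1 k : `|(hpoly a b k).[1]| <= 1.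
Proof.
have B0 := binomR_diag_gt0 k a_gtN1.
have : (jpoly k).[1] = (-1) ^+ k * binomR (k%:R + b) k.
  rewrite horner_sum big_ord_recr big1 /= ?add0r => [|s _]; last first.
    rewrite /bern !hornerE /= subrr expr0n; have -> : (k - s == 0)%N = false by rewrite subn_eq0 leqNgt ltn_ord.
    by rewrite mulr0.
  rewrite /bern subnn expr0 mulr1 !hornerE /= /jcoef subnn binomR0 mul1r.
  by rewrite [LHS]mulrC /binomR mulrA.
have B1 := binomR_diag_gt0 k b_gtN1; have := binomR_diag_le k b_gtN1 ba.
rewrite jpoly_hpoly hornerZ.
move: (binomR (k%:R + a) k) (binomR (k%:R + b) k) B0 B1 => A B A0 B0 AB /(congr1 Num.norm).
rewrite !normrM normrX normrN1 expr1n mul1r (gtr0_norm A0) (gtr0_norm B0) => h.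
by rewrite -(ler_pM2l A0) h mulr1.
Qed.

Definition jw k : R := jacobi_weight a b k / gammaR (k%:R + b + 1) * binomR (k%:R + a) k.

Lemma jacobiE_hpoly k (t : R) : jacobiE a b k t = jw k * (hpoly a b k).[(1 - t) / 2].
Proof. by rewrite /jacobiE jacobi_jpoly jpoly_hpoly hornerZ mulrA. Qed.

Lemma jacobi_weight0 : jacobi_weight a b 0 = gammaR (la + 1).
Proof.
rewrite /jacobi_weight eqxx /= -/la mulr0 add0r -/la.
have [->|la0] := eqVneq la 0; first by rewrite add0r gammaR1.
by rewrite gammaR_rec// lt_neqAle eq_sym la0 la_ge0.
Qed.

Lemma jacobi_weightS k :
  jacobi_weight a b k.+1 = (2 * k.+1%:R + la) * gammaR (k.+1%:R + la).
Proof. by rewrite /jacobi_weight /= /la !addrA. Qed.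

Lemma jw_gt0 k : 0 < jw k.
Proof.
rewrite /jw mulr_gt0 ?binomR_diag_gt0// divr_gt0//; last first.
  by rewrite gammaR_gt0//; have := ler0n R k; have := b_gtN1; lra.
case: k => [|k]; first by rewrite jacobi_weight0 gammaR_gt0// ltr_wpDl.
rewrite jacobi_weightS; have k0 : 0 < k.+1%:R :> R by [].
by rewrite mulr_gt0 ?gammaR_gt0// ltr_wpDr// mulr_gt0.
Qed.

(** Detailed balance: the three-term recurrence is symmetric with respect to the weights [jw], which
    lets summation by parts move it from the polynomials to the multiplier. *)
Lemma jw_rec k : jw k * recA a b k = jw k.+1 * recC a b k.+1.
Proof.
have k0 : k.+1%:R != 0 :> R by rewrite pnatr_eq0.
have kb : 0 < k%:R + b + 1 by have := ler0n R k; have := b_gtN1; lra.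
have gb : gammaR (k%:R + b + 1) != 0 by rewrite gt_eqF ?gammaR_gt0.
have eb : gammaR (k.+1%:R + b + 1) = (k%:R + b + 1) * gammaR (k%:R + b + 1).
  by have <- : k%:R + b + 1 + 1 = k.+1%:R + b + 1; [rewrite -natr1; ring|rewrite gammaR_rec].
have eB : binomR (k.+1%:R + a) k.+1 = (k%:R + 1 + a) / k.+1%:R * binomR (k%:R + a) k.
  apply: (mulfI k0); rewrite binomR_diag; move: (binomR _ k) => B.
  by field; rewrite nat1r k0.
rewrite /jw eb eB jacobi_weightS recCS.
move: gb (binomR _ k) => gb B; have kb' := lt0r_neq0 kb.
have := la_ge0; have := ler0n R k => kk ll.
(* Index 0 is separate because [jacobi_weight] and [recA] both take special forms there. *)
case: k k0 kb gb eb eB kb' kk => [|k] k0 kb gb eb eB kb' kk.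
  rewrite jacobi_weight0 /= mulr0n !add0r mulr1n (_ : 1 + la = la + 1); last by ring.
  have l1 : la + 1 != 0 by rewrite gt_eqF//; clear k0 kb gb eb eB kb'; lra.
  have l2 : la + 2 != 0 by rewrite gt_eqF//; clear k0 kb gb eb eB kb'; lra.
  rewrite mulr0n add0r in gb kb'.
  rewrite !mulr1 !mulr0 !add0r; move: (gammaR _) gb => G gb.
  by rewrite -!/la; field; rewrite gb kb' l1 l2.
rewrite jacobi_weightS recAS -[k.+2%:R]natr1 in k0 *.
have e : gammaR (k.+1%:R + 1 + la) = (k.+1%:R + la) * gammaR (k.+1%:R + la).
  rewrite -gammaR_rec; first by congr gammaR; ring.
  by have : 0 < k.+1%:R :> R; [|move: (k.+1%:R : R) => x; clear k0 kb gb eb eB kb'; lra].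
rewrite e; move: (gammaR (k.+1%:R + la)) (gammaR (k.+1%:R + b + 1)) gb kb' k0 => G H gb kb' k0.
rewrite -[k.+1%:R]natr1 in kb' k0 *.
have n2 : 2 * k%:R + 2 + la != 0 by rewrite gt_eqF//; have := ler0n R k; clear k0 kb gb eb eB kb'; lra.
have n3 : 2 * (k%:R + 1) + la + 1 != 0 by rewrite gt_eqF//; have := ler0n R k; clear k0 kb gb eb eB kb'; lra.
have n4 : 2 * (k%:R + 1) + la + 2 != 0 by rewrite gt_eqF//; have := ler0n R k; clear k0 kb gb eb eB kb'; lra.
by rewrite -/la; field; rewrite n2 n3 n4 gb kb' k0.
Qed.

Lemma recC_gt0 k : 0 < recC a b k.+1.
Proof.
rewrite recCS -/la; have := la_ge0; have := ler0n R k; have := b_gtN1 => b1 k0 l0.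
by rewrite divr_gt0 ?mulr_gt0//; lra.
Qed.

Let frac (x y : R) k : R := (k%:R + x) / (k%:R + y).

Let recA_frac k : recA a b k.+1 =
  2^-1 * (frac (1 + la) (1 + la / 2) k * frac (a + 2) ((la + 3) / 2) k).
Proof.
rewrite recAS -/la /frac; have := la_ge0; have := ler0n R k => k0 l0.
have n1 : 2 * k%:R + 2 + la != 0 by rewrite gt_eqF//; lra.
have n2 : 2 * k%:R + la + 3 != 0 by rewrite gt_eqF//; lra.
have -> : k%:R + (1 + la / 2) = (2 * k%:R + 2 + la) / 2 by field.
have -> : k%:R + (la + 3) / 2 = (2 * k%:R + la + 3) / 2 by field.
by field; rewrite n1 n2.
Qed.

Let recC_frac k : recC a b k.+1 =
  2^-1 * (frac 1 ((la + 1) / 2) k * frac (1 + b) (1 + la / 2) k).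
Proof.
rewrite recCS -/la /frac; have := la_ge0; have := ler0n R k => k0 l0.
have n1 : 2 * k%:R + la + 2 != 0 by rewrite gt_eqF//; lra.
have n2 : 2 * k%:R + la + 1 != 0 by rewrite gt_eqF//; lra.
have -> : k%:R + (1 + la / 2) = (2 * k%:R + la + 2) / 2 by field.
have -> : k%:R + (la + 1) / 2 = (2 * k%:R + la + 1) / 2 by field.
by field; rewrite n1 n2.
Qed.

Let sym_ratio_like_half (t : R) (f g : nat -> R) : ratio_like t f ->
  (forall k, g k.+1 = 2^-1 * f k) -> sym (-1) (fun _ : unit => fun k => g k - 2^-1).
Proof.
move=> rf fg; apply: sym_S_inv; last by exists `|g 0%N - 2^-1|.
have h1 : sym (-1) (fun _ : unit => fun k => f k - 1 - t / k.+1%:R).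
  by apply: symW rf; lra.
apply: sym_ext (symZ 2^-1 (symD h1 (symZ t (@sym_invS R)))) => _ k.
by rewrite fg; ring.
Qed.

Lemma sym_recA : sym (-1) (fun _ : unit => fun k => recA a b k - 2^-1).
Proof.
have l0 := la_ge0; apply: sym_ratio_like_half recA_frac.
by apply: ratio_likeM; apply: ratio_like_frac; lra.
Qed.

Lemma sym_recC : sym (-1) (fun _ : unit => fun k => recC a b k - 2^-1).
Proof.
have l0 := la_ge0; apply: sym_ratio_like_half recC_frac.
by apply: ratio_likeM; apply: ratio_like_frac; lra.
Qed.

(** By [jw_rec] the quotient of neighbours is [recA / recC], a product of three linear fractions
    whose exponents add up to [2 a + 1]. The shift by one avoids the special values at 0. *)
Lemma jw_asymp : exists2 c : R, 0 < c &
  exists C, forall k, c * pw k (2 * a + 1) <= jw k <= C * pw k (2 * a + 1).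
Proof.
have l0 := la_ge0; have a1 := a_gtN1; have b1 := b_gtN1.
pose h k := jw k.+1.
have h0 k : 0 < h k := jw_gt0 k.+1.
have hE k : h k.+1 / h k = frac (1 + la) 2 k * frac (2 + a) (2 + b) k
    * frac (2 + la / 2) (1 + la / 2) k.
  have c0 := recC_gt0 k.+1; have kk := ler0n R k.
  have -> : h k.+1 / h k = recA a b k.+1 / recC a b k.+2.
    have cN := lt0r_neq0 c0; have hN := lt0r_neq0 (h0 k).
    have E : h k.+1 = h k * recA a b k.+1 / recC a b k.+2 by rewrite jw_rec mulfK.
    by rewrite E mulrAC [h k * _]mulrC mulfK.
  rewrite recAS recCS -[k.+1%:R]natr1 -/la /frac.
  have n0 : k%:R + 2 != 0 :> R by rewrite gt_eqF//; lra.
  have n1 : 2 * (k%:R + 1) + la + 2 != 0 by rewrite gt_eqF//; lra.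
  have n2 : 2 * k%:R + 2 + la != 0 by rewrite gt_eqF//; lra.
  have n3 : 2 * k%:R + la + 3 != 0 by rewrite gt_eqF//; lra.
  have n4 : k%:R + (2 + b) != 0 by rewrite gt_eqF//; lra.
  have n5 : 2 * (k%:R + 1) + la + 1 != 0 by rewrite gt_eqF//; lra.
  have -> : k%:R + 1 + 1 = k%:R + 2 :> R by ring.
  have -> : k%:R + (1 + la / 2) = (2 * k%:R + 2 + la) / 2 by field.
  have -> : k%:R + (2 + la / 2) = (2 * (k%:R + 1) + la + 2) / 2 by field.
  have -> : k%:R + 2 + b = k%:R + (2 + b) by ring.
  by field; rewrite n0 n1 n2 n4 n5.
have r1 : ratio_like (2 * a + 1) (fun k => h k.+1 / h k).
  have -> : 2 * a + 1 = (1 + la - 2) + (2 + a - (2 + b)) + (2 + la / 2 - (1 + la / 2)).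
    by rewrite /la; ring.
  apply: (ratio_like_ext (fun k => esym (hE k))).
  by apply: ratio_likeM; first apply: ratio_likeM; apply: ratio_like_frac; lra.
have hE' k : h k / h k.+1 = frac 2 (1 + la) k * frac (2 + b) (2 + a) k
    * frac (1 + la / 2) (2 + la / 2) k.
  by rewrite -[LHS]invrK invf_div hE (invfM (frac _ _ k * _)) (invfM (frac _ _ k)) /frac !invf_div.
have r2 : ratio_like (- (2 * a + 1)) (fun k => h k / h k.+1).
  have -> : - (2 * a + 1) = (2 - (1 + la)) + ((2 + b) - (2 + a)) + ((1 + la / 2) - (2 + la / 2)).
    by rewrite /la; ring.
  apply: (ratio_like_ext (fun k => esym (hE' k))).
  by apply: ratio_likeM; first apply: ratio_likeM; apply: ratio_like_frac; lra.
have [_ [c c0 [C hC]]] := asymp_power h0 r1 r2.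
have C0 : 0 < C.
  have /andP[_] := hC 0%N; rewrite /pw powR1 mulr1; exact: lt_le_trans.
have p0 : pw 0 (2 * a + 1) = 1 :> R by rewrite /pw powR1.
have t2 : 0 < 2 `^ `|2 * a + 1| :> R by rewrite powR_gt0.
have m1 (k : nat) : (k.+2 <= k.+1 * 2)%N by lia.
have m2 (k : nat) : (k.+1 <= 2 * k.+2)%N by lia.
exists (Num.min (jw 0) (c / 2 `^ `|2 * a + 1|)).
  by rewrite lt_min jw_gt0 divr_gt0.
exists (Num.max (jw 0) (C * 2 `^ `|2 * a + 1|)) => -[|k].
  by rewrite p0 !mulr1 ge_min le_max lexx.
have /andP[h1 h2] := hC k; apply/andP; split.
  apply: le_trans h1; apply: (@le_trans _ _ (c / 2 `^ `|2 * a + 1| * pw k.+1 (2 * a + 1))).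
    by rewrite ler_wpM2r ?pw_ge0// ge_min lexx orbT.
  by rewrite -mulrA ler_pM2l// [leLHS]mulrC ler_pdivrMr// [leRHS]mulrC pw_shift.
apply: le_trans h2 _; apply: (@le_trans _ _ (C * 2 `^ `|2 * a + 1| * pw k.+1 (2 * a + 1))).
  rewrite -mulrA ler_pM2l// powR_le_ratio ?ltr0n ?ler1n//.
    by rewrite -natrM ler_nat m1.
  by rewrite -natrM ler_nat m2.
by rewrite ler_wpM2r ?pw_ge0// le_max lexx orbT.
Qed.

End JacobiExplicit.

(** * Sonin bound and maximum principle on the unit interval *)

Section PolynomialBounds.
Variable R : realType.
Implicit Types (p q u : {poly R}) (x y c : R).

Lemma poly_MVT p x y : x < y ->
  exists2 z, x < z < y & p.[y] - p.[x] = p^`().[z] * (y - x).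
Proof.
move=> xy; have h z : z \in `]x, y[%R -> is_derive z 1 (horner p) p^`().[z].
  by move=> _; exact: is_derive_poly.
have [|z zI E] := MVT xy h.
  by apply: continuous_subspaceT; exact: continuous_horner.
by exists z => //; move: zI; rewrite in_itv.
Qed.

Lemma poly_gt0_near p c : 0 < p.[c] ->
  exists2 d, 0 < d & forall y, `|c - y| < d -> 0 < p.[y].
Proof.
move=> p0; have /cvgr_gt : horner p y @[y --> c] --> p.[c] by exact: continuous_horner.
move=> /(_ 0 p0) /nbhs_ballP[d /= d0 hd].
by exists d => // y yc; apply: hd.
Qed.

Lemma poly_incr_right p c : 0 < p^`().[c] ->
  exists2 d, 0 < d & forall y, c < y < c + d -> p.[c] < p.[y].
Proof.
move=> /poly_gt0_near[d d0 hd]; exists d => // y /andP[cy yd].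
have [z /andP[cz zy] E] := poly_MVT p cy.
have := hd z; rewrite ltr_distlC => /(_ _)/wrap[|h]; first by apply/andP; split; lra.
by rewrite -subr_gt0 E mulr_gt0// subr_gt0.
Qed.

Lemma poly_incr_left p c : p^`().[c] < 0 ->
  exists2 d, 0 < d & forall y, c - d < y < c -> p.[c] < p.[y].
Proof.
move=> pc; have : 0 < (- p)^`().[c] by rewrite derivN hornerN oppr_gt0.
move=> /poly_gt0_near[d d0 hd]; exists d => // y /andP[yd yc].
have [z /andP[cz zy] E] := poly_MVT p yc.
have := hd z; rewrite ltr_distlC => /(_ _)/wrap[|h]; first by apply/andP; split; lra.
rewrite derivN hornerN oppr_gt0 in h.
by rewrite -subr_lt0 E pmulr_llt0// subr_gt0.
Qed.

End PolynomialBounds.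

Section JacobiBounds.
Variables (R : realType) (a b : R).
Hypotheses (ba : b <= a) (hb : - 2^-1 <= b).
Let la := a + b + 1.
Implicit Types (j k N : nat) (x y : R) (u q : {poly R}).

Let la_ge0 : 0 <= la.
Proof. by rewrite /la; have := hb; have := ba; lra. Qed.

Let eig k : R := k%:R * (k%:R + la).

Let eig_ge0 k : 0 <= eig k.
Proof. by rewrite mulr_ge0// addr_ge0. Qed.

Definition jop u : {poly R} := 'X * (1 - 'X) * u^`()^`() +
  ((a + 1)%:P - (la + 1) *: 'X) * u^`().

Lemma jop_hpoly k : jop (hpoly a b k) = - eig k *: hpoly a b k.
Proof.
have /eqP := hpoly_ode ba hb k; rewrite addr_eq0 scaleNr => /eqP; exact.
Qed.

Let energy k : {poly R} := eig k *: hpoly a b k ^+ 2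
  + 'X * (1 - 'X) * (hpoly a b k)^`() ^+ 2.

Let energyE k y : (energy k).[y] =
  eig k * (hpoly a b k).[y] ^+ 2 + y * (1 - y) * (hpoly a b k)^`().[y] ^+ 2.
Proof. by rewrite !hornerE. Qed.

(* Sonin's argument: the weight below is affine and increasing in [y], so the
   energy decreases and then increases. *)
Let energy_deriv k y : (energy k)^`().[y] =
  (hpoly a b k)^`().[y] ^+ 2 * (2 * la * y - (2 * a + 1)).
Proof.
have d1 : (1 - 'X : {poly R})^`() = -1.
  by rewrite derivB derivX -[X in X^`() - _]polyC1 derivC sub0r.
have := congr1 (horner^~ y) (jop_hpoly k).
rewrite /jop /energy; set P := hpoly a b k; rewrite !expr2.
rewrite !(derivD, derivZ, derivM, d1, derivX) !(hornerD, hornerM, hornerN, hornerZ, hornerC, hornerX) /=.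
set p := P.[y]; set p1 := P^`().[y]; set p2 := P^`()^`().[y] => H.
have E : y * (1 - y) * p2 = - eig k * p - (a + 1 - (la + 1) * y) * p1.
  by rewrite -H; ring.
transitivity (2 * p1 * (eig k * p + y * (1 - y) * p2) + (1 - 2 * y) * (p1 * p1)).
  by ring.
by rewrite E; ring.
Qed.

(** The energy is largest at an endpoint. There [y (1 - y)] removes the derivative term, and the
    polynomial is 1 at 0 and at most 1 in modulus at 1. *)
Lemma hpoly_sonin k y : 0 <= y <= 1 ->
  eig k * (hpoly a b k).[y] ^+ 2 + y * (1 - y) * (hpoly a b k)^`().[y] ^+ 2 <= eig k.
Proof.
move=> /andP[y0 y1]; rewrite -energyE.
have e0 : (energy k).[0] <= eig k.
  by rewrite energyE hpoly_at0 mul0r mul0r addr0 expr1n mulr1.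
have e1 : (energy k).[1] <= eig k.
  rewrite energyE subrr mulr0 mul0r addr0 -[leRHS]mulr1 ler_wpM2l//.
  by rewrite -real_normK ?num_real// exprn_ile1// hpoly_at1.
have [s0|s0] := leP 0 (2 * la * y - (2 * a + 1)).
- have [->//|y1'] := eqVneq y 1; have {}y1' : y < 1 by rewrite lt_neqAle y1'.
  apply: le_trans e1; have [z /andP[yz z1] E] := poly_MVT (energy k) y1'.
  rewrite -subr_ge0 E mulr_ge0 ?subr_ge0// energy_deriv mulr_ge0 ?sqr_ge0//.
  have : la * y <= la * z by rewrite ler_wpM2l// ltW.
  by lra.
- have [->//|y0'] := eqVneq y 0; have {}y0' : 0 < y by rewrite lt_neqAle eq_sym y0'.
  apply: le_trans e0; have [z /andP[z0 zy] E] := poly_MVT (energy k) y0'.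
  rewrite -subr_le0 E mulr_le0_ge0 ?subr_ge0// energy_deriv mulr_ge0_le0 ?sqr_ge0//.
  have : la * z <= la * y by rewrite ler_wpM2l// ltW.
  by lra.
Qed.

Lemma hpoly_zero : hpoly a b 0 = 1.
Proof.
apply/polyP => j; rewrite coef_hpoly coef1; case: j => [|j]; first by rewrite hcoef0.
by rewrite hcoef_eq0.
Qed.

Lemma hpoly_le1 k y : 0 <= y <= 1 -> `|(hpoly a b k).[y]| <= 1.
Proof.
case: k => [|k] yI; first by rewrite hpoly_zero hornerC normr1.
have e0 : 0 < eig k.+1 by rewrite mulr_gt0// ltr_wpDr.
have := hpoly_sonin k.+1 yI; case/andP: yI => y0 y1 h.
have h2 : (hpoly a b k.+1).[y] ^+ 2 <= 1.
  rewrite -(ler_pM2l e0) mulr1 (le_trans _ h)// lerDl.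
  by rewrite mulr_ge0 ?sqr_ge0// mulr_ge0// subr_ge0.
by rewrite -(@ler_pXn2r _ 2)// ?nnegrE// expr1n real_normK ?num_real.
Qed.

(** In the angle [s] the factor [y (1 - y)] is [(sin s)^2 / 4], so the Sonin energy bounds the
    angular derivative by the square root of [eig k], hence by [k + la]: an inequality of Bernstein
    type. *)
Lemma hpoly_cos_ge k (t : R) : 0 <= t -> 1 - (k%:R + la) * t <= (hpoly a b k).[(1 - cos t) / 2].
Proof.
rewrite le_eqVlt => /predU1P[<-|t0].
  by rewrite cos0 subrr mul0r hpoly_at0 mulr0 subr0.
pose g s := (hpoly a b k).[(1 - cos s) / 2].
have dg (s : R) : is_derive s 1 g ((hpoly a b k)^`().[(1 - cos s) / 2] * (sin s / 2)).
  have d1 : is_derive s 1 (fun s => (1 - cos s) / 2 : R) (sin s / 2).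
    have h := is_deriveM (is_deriveB (is_derive_cst (1 : R) s 1) (is_derive_cos s))
      (is_derive_cst (2^-1 : R) s 1).
    apply: trigger_derive h _.
    by rewrite scaler0 add0r /GRing.scale /= sub0r opprK mulrC.
  exact: (@is_derive1_comp _ (horner (hpoly a b k)) (fun s => (1 - cos s) / 2) s _ _
    (is_derive_poly _ _) d1).
have [|s _ E] := MVT t0 (fun s (_ : s \in `]0, t[) => dg s).
  by apply: derivable_within_continuous => s _; case: (dg s).
move: E; rewrite /g cos0 subrr mul0r hpoly_at0 subr0 => E.
suff : - ((k%:R + la) * t) <= (hpoly a b k).[(1 - cos t) / 2] - 1 by lra.
rewrite E -mulNr ler_wpM2r ?(ltW t0)//.
set p1 := _^`().[_]; suff : `|p1 * (sin s / 2)| <= k%:R + la by rewrite ler_norml => /andP[].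
have kl : 0 <= k%:R + la by rewrite addr_ge0.
rewrite -(@ler_pXn2r _ 2)// ?nnegrE// real_normK ?num_real//.
have yI : 0 <= (1 - cos s) / 2 <= 1.
  by have := cos_le1 s; have := cos_geN1 s => h1 h2; apply/andP; split; lra.
have := hpoly_sonin k yI; rewrite -/p1 => h.
have -> : (p1 * (sin s / 2)) ^+ 2 = (1 - cos s) / 2 * (1 - (1 - cos s) / 2) * p1 ^+ 2.
  by rewrite exprMn expr_div_n sin2cos2; field.
have : 0 <= eig k * (hpoly a b k).[(1 - cos s) / 2] ^+ 2 by rewrite mulr_ge0 ?sqr_ge0.
have : eig k <= (k%:R + la) ^+ 2 by rewrite expr2 ler_wpM2r ?lerDl.
by lra.
Qed.

(* Maximum principle for the resolvent of the Jacobi operator. *)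
Lemma resolvent_max u (t M : R) : 0 <= t ->
  (forall y, 0 <= y <= 1 -> (u - t *: jop u).[y] <= M) ->
  forall y, 0 <= y <= 1 -> u.[y] <= M.
Proof.
move=> t0 uM.
have [|c cI cmax] := @EVT_max R (horner u) 0 1 ler01.
  by apply: continuous_subspaceT; exact: continuous_horner.
(* The operator is nonpositive at a maximum. At the endpoints 0 and 1 it reduces to [(a + 1) u'] and
   [- (b + 1) u'], whose sign is dictated by the one-sided maximum; inside, [u' = 0] and
   [u'' <= 0]. *)
suff j0 : (jop u).[c] <= 0.
  move=> y yI; apply: (@le_trans _ _ u.[c]); first by apply: cmax; rewrite in_itv.
  have := uM c; rewrite in_itv /= in cI => /(_ cI); apply: le_trans.
  by rewrite hornerD hornerN hornerZ lerDl oppr_ge0 mulr_ge0_le0.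
have jE y : (jop u).[y] = y * (1 - y) * u^`()^`().[y] + (a + 1 - (la + 1) * y) * u^`().[y].
  by rewrite /jop !hornerE.
have a1 : 0 < a + 1 by have := hb; have := ba; lra.
rewrite in_itv /= in cI; case/andP: cI => c0 c1.
have [c00|c00] := eqVneq c 0.
  rewrite jE c00 !mul0r add0r mulr0 subr0 pmulr_rle0// leNgt; apply/negP => du.
  have [d d0 hd] := poly_incr_right du; pose y := Num.min (d / 2) 1.
  have y1 : y <= 1 by rewrite ge_min lexx orbT.
  have y0 : 0 < y by rewrite lt_min ltr01 divr_gt0.
  have yd : y < d by rewrite gt_min; apply/orP; left; lra.
  have := hd y; rewrite y0 add0r yd => /(_ isT); rewrite ltNge.
  by rewrite -c00 cmax// in_itv /= (ltW y0).
have [c11|c11] := eqVneq c 1.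
  rewrite jE c11 subrr mulr0 mul0r add0r mulr1.
  have -> : a + 1 - (la + 1) = - (b + 1) by rewrite /la; ring.
  have b1 : 0 < b + 1 by have := hb; lra.
  rewrite mulNr oppr_le0 pmulr_rge0// leNgt; apply/negP => du.
  have [d d0 hd] := poly_incr_left du; pose y := Num.max (1 - d / 2) 0.
  have y1 : 0 <= y by rewrite le_max lexx orbT.
  have y0 : y < 1 by rewrite gt_max ltr01 andbT; lra.
  have yd : 1 - d < y by rewrite lt_max; apply/orP; left; lra.
  have := hd y; rewrite y0 yd => /(_ isT); rewrite ltNge.
  by rewrite -c11 cmax// in_itv /= y1 ltW.
have cI : c \in `]0, 1[ by rewrite in_itv /= !lt_neqAle c0 c1 c11 eq_sym c00.
have d0 : u^`().[c] = 0.
  have cm y : y \in `]0, 1[ -> u.[y] <= u.[c].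
    by rewrite in_itv /= => /andP[y0 y1]; apply: cmax; rewrite in_itv /= !ltW.
  have h := derive1_at_max ler01 (fun y _ => @derivable_horner R u y) cI cm.
  by rewrite derivE derive1E; exact: derive_val.
rewrite jE d0 mulr0 addr0; move: cI; rewrite in_itv /= => /andP[c0' c1'].
rewrite pmulr_rle0 ?mulr_gt0 ?subr_gt0// leNgt; apply/negP => ddu.
have [d dp hd] := poly_incr_right ddu; pose y := c + Num.min (d / 2) (1 - c).
have y1 : y <= 1 by rewrite /y -lerBrDl ge_min lexx orbT.
have y0 : c < y by rewrite /y ltrDl lt_min subr_gt0 c1' divr_gt0.
have yd : y < c + d by rewrite /y ltrD2l gt_min; apply/orP; left; lra.
have [z /andP[cz zy] E] := poly_MVT u y0.
have := hd z; rewrite cz (lt_trans zy yd) d0 => /(_ isT) dz.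
have : u.[y] <= u.[c] by apply: cmax; rewrite in_itv /= y1 (le_trans c0 (ltW y0)).
by rewrite -subr_le0 E pmulr_rle0// leNgt subr_gt0 y0.
Qed.

Lemma jopZ (c : R) u : jop (c *: u) = c *: jop u.
Proof. by rewrite /jop !derivZ scalerDr -!scalerAr. Qed.

Lemma jop_sum N (f : nat -> {poly R}) : jop (\sum_(k < N) f k) = \sum_(k < N) jop (f k).
Proof. by rewrite /jop !(raddf_sum (@deriv R)) /= !mulr_sumr -big_split. Qed.

(** Substitute for integration against the weight. The resolvent with parameter [t] divides the
    [k]-th coefficient by [1 + t eig k] and, by the maximum principle, preserves the bound [M]; as
    [t] grows only the coefficient of index 0 survives. *)
Lemma coef0_le N (f : nat -> R) (M : R) :
  (forall y, 0 <= y <= 1 -> `|(\sum_(k < N.+1) f k *: hpoly a b k).[y]| <= M) ->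
  `|f 0%N| <= M.
Proof.
move=> fM; pose S := \sum_(k < N) `|f k.+1|.
have S0 : 0 <= S by apply: sumr_ge0.
suff key t : 0 < t -> `|f 0%N| <= M + S / (1 + t).
  rewrite leNgt; apply/negP => Mf; pose e := `|f 0%N| - M.
  have e0 : 0 < e by rewrite subr_gt0.
  have t0 : 0 < S / e + 1 by rewrite ltr_wpDl// divr_ge0// ltW.
  have := key _ t0; rewrite -lerBlDl -/e leNgt; apply/negP/negPn.
  rewrite ltr_pdivrMr; last lra.
  by rewrite mulrC mulrDl mul1r mulrDl divfK ?gt_eqF// mul1r; lra.
move=> t0; pose g k := f k / (1 + t * eig k).
have te k : 0 < 1 + t * eig k by rewrite ltr_wpDr// mulr_ge0// ltW.
pose u := \sum_(k < N.+1) g k *: hpoly a b k.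
have uE : u - t *: jop u = \sum_(k < N.+1) f k *: hpoly a b k.
  rewrite /u (jop_sum N.+1 (fun k => g k *: hpoly a b k)) scaler_sumr -sumrB; apply: eq_bigr => k _.
  rewrite jopZ jop_hpoly !scalerA -scalerBl /g; congr (_ *: _).
  by have := te k => /lt0r_neq0 h; field.
have u0 : `|u.[0]| <= M.
  have b0 : (0 <= (0 : R)) && ((0 : R) <= 1) by rewrite lexx ler01.
  rewrite ler_norml; apply/andP; split; last first.
    apply: (@resolvent_max u t M (ltW t0) _ 0 b0) => y yI.
    by rewrite uE (le_trans (ler_norm _))// fM.
  rewrite lerNl -hornerN; apply: (@resolvent_max (- u) t M (ltW t0) _ 0 b0) => y yI.
  rewrite -scaleN1r jopZ scalerA mulrC -scalerA -scalerBr uE scaleN1r hornerN.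
  by rewrite (le_trans (ler_norm _))// normrN fM.
have E : f 0%N = u.[0] - \sum_(k < N) g k.+1.
  rewrite /u horner_sum big_ord_recl /= hornerZ hpoly_at0 mulr1 {1}/g /eig mul0r mulr0 addr0 divr1.
  rewrite (eq_bigr (fun k : 'I_N => g k.+1)) ?addrK// => k _.
  by rewrite hornerZ hpoly_at0 mulr1.
rewrite E (le_trans (ler_normB _ _))// lerD// (le_trans (ler_norm_sum _ _ _))//.
rewrite /S mulr_suml ler_sum// => k _; rewrite /g normrM ler_wpM2l//.
have t1 : 0 < 1 + t by lra.
rewrite ger0_norm ?invr_ge0 ?(ltW (te _))// lef_pV2 ?posrE ?te//.
rewrite lerD2l ler_peMr ?(ltW t0)// /eig.
have : 1 <= k.+1%:R :> R by rewrite ler1n.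
by have := la_ge0; move: la (k.+1%:R : R) => l x l0 x1; nra.
Qed.

End JacobiBounds.

(** * Kernels of multipliers *)

Section PowerSums.
Variable R : realType.
Implicit Types (s x y : R) (k p N : nat).

Lemma powR_mean_value s x : 0 < x ->
  exists2 z, x < z < x + 1 & (x + 1) `^ s - x `^ s = s * z `^ (s - 1).
Proof.
move=> x0; have x1 : x < x + 1 by rewrite ltrDl.
have d (z : R) : z \in `]x, x + 1[ -> is_derive z 1 (fun t => t `^ s) (s * z `^ (s - 1)).
  by rewrite in_itv /= => /andP[xz _]; apply: is_derive1_powR; exact: lt_trans xz.
have [|z zI ->] := MVT x1 d.
  apply: derivable_within_continuous => z; rewrite in_itv /= => /andP[xz _].
  by have [] := is_derive1_powR s (lt_le_trans x0 xz).
by exists z; [move: zI; rewrite in_itv|ring].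
Qed.

Lemma pw_tail_sum s : s < -1 -> exists2 C, 0 <= C &
  forall p N, \sum_(p <= k < N) pw k s <= C * pw p (s + 1).
Proof.
move=> s1; pose c := - (s + 1); have c0 : 0 < c by rewrite /c; lra.
exists (2 `^ `|s| / c); first by rewrite divr_ge0 ?powR_ge0 ?ltW.
move=> p N.
have step k : pw k s <= 2 `^ `|s| / c * (pw k (s + 1) - pw k.+1 (s + 1)).
  have [|z /andP[z1 z2] E] := @powR_mean_value (s + 1) k.+1%:R; first by [].
  have -> : pw k (s + 1) - pw k.+1 (s + 1) = c * z `^ s.
    by rewrite /pw -[k.+2%:R]natr1 -opprB E addrK /c; ring.
  rewrite mulrA divfK ?gt_eqF// /pw powR_le_ratio//; last 3 first.
  - by rewrite (lt_trans _ z1).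
  - by rewrite (le_trans (ltW z2))// -[k.+1%:R]natr1; have := ler0n R k; lra.
  - have z0 : 0 < z by rewrite (lt_trans _ z1).
    by rewrite (le_trans (ltW z1))// ler_peMl ?ltW// ltr1n.
  by rewrite ler1n.
have [pN|pN] := leqP p N; last first.
  by rewrite big_geq ?(ltnW pN)// !mulr_ge0 ?pw_ge0 ?invr_ge0 ?powR_ge0 ?(ltW c0).
apply: (@le_trans _ _ (2 `^ `|s| / c * (pw p (s + 1) - pw N (s + 1)))).
  rewrite -[pw p _ - _]opprB -(telescope_sumr (fun k => pw k (s + 1)) pN) -sumrN mulr_sumr.
  by apply: ler_sum => k _; rewrite opprB.
by rewrite ler_wpM2l ?divr_ge0 ?powR_ge0 ?(ltW c0)// gerBl pw_ge0.
Qed.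

Lemma pw_head_sum s N : 0 <= s -> \sum_(k < N) pw k s <= N%:R `^ (s + 1).
Proof.
move=> s0; have [->|N0] := posnP N; first by rewrite big_ord0 powR_ge0.
apply: (@le_trans _ _ (\sum_(k < N) N%:R `^ s)).
  apply: ler_sum => k _; rewrite /pw ge0_ler_powR ?nnegrE//.
  by rewrite ler_nat ltn_ord.
have NN : N%:R != 0 :> R by rewrite pnatr_eq0 -lt0n.
by rewrite sumr_const card_ord -(mulr_natr (N%:R `^ s)) powRD ?NN ?implybT// powRr1.
Qed.

Lemma pw_subn_le s l p : pw (p - l) s <= l.+1%:R `^ `|s| * pw p s.
Proof.
apply: powR_le_ratio; rewrite ?ler1n ?ltr0n//; rewrite -natrM ler_nat.
  by rewrite -[p.+1]addn1; nia.
by nia.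
Qed.

End PowerSums.

Arguments recA : simpl never.

Section Kernels.
Variables (R : realType) (a b : R).
Hypotheses (ba : b <= a) (hb : - 2^-1 <= b).
Implicit Types (d y : R) (k N l n : nat) (m : nat -> R).

Let a_ge : - 2^-1 <= a. Proof. exact: le_trans ba. Qed.

Definition ksum N m y : R := \sum_(k < N) m k * jw a b k * (hpoly a b k).[y].

(** Transpose of the three-term recurrence for the weights [jw]. The truncated predecessor at
    [k = 0] is harmless, as [recC 0 = 0]. *)
Definition Dop m k : R :=
  recA a b k * (m k - m k.+1) + recC a b k * (m k - m k.-1).

Lemma ksumD N m1 m2 y :
  ksum N (fun k => m1 k + m2 k) y = ksum N m1 y + ksum N m2 y.
Proof. by rewrite /ksum -big_split; apply: eq_bigr => k _ /=; ring. Qed.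

Lemma ksumZ N c m y : ksum N (fun k => c * m k) y = c * ksum N m y.
Proof. by rewrite /ksum mulr_sumr; apply: eq_bigr => k _ /=; ring. Qed.

Lemma eq_ksum N m1 m2 y : (forall k, (k < N)%N -> m1 k = m2 k) ->
  ksum N m1 y = ksum N m2 y.
Proof. by move=> e; apply: eq_bigr => k _; rewrite e. Qed.

Lemma ksum_widen N M m y : (N <= M)%N -> (forall k, (N <= k)%N -> m k = 0) ->
  ksum M m y = ksum N m y.
Proof.
move=> NM m0; rewrite /ksum -!(big_mkord xpredT (fun k => m k * _ k * (_ k).[_])).
rewrite (big_cat_nat (n := N))//= [X in _ + X]big_nat_cond [X in _ + X]big1 ?addr0//.
by move=> k /andP[/andP[Nk _] _]; rewrite m0// !mul0r.
Qed.

Lemma hpoly_rec_at k y : 2 * y * (hpoly a b k).[y] =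
  - recA a b k * (hpoly a b k.+1).[y] + (recA a b k + recC a b k) * (hpoly a b k).[y]
  - recC a b k * (hpoly a b k.-1).[y].
Proof.
case: k => [|k].
  have := congr1 (horner^~ y) (hpoly_rec0 ba hb).
  rewrite !(hornerD, hornerZ, hornerM, hornerX) => h.
  by rewrite recC0 -mulrA h; ring.
have := congr1 (horner^~ y) (hpoly_rec ba hb k).
rewrite !(hornerD, hornerN, hornerZ, hornerM, hornerX) => h.
by rewrite -mulrA h.
Qed.

(** Summation by parts through [jw_rec]; what remains at the upper end is a boundary term of
    Christoffel-Darboux type. *)
Lemma ksum_Dop n m y : 2 * y * ksum n.+1 m y = ksum n.+1 (Dop m) y +
  jw a b n * recA a b n * (m n.+1 * (hpoly a b n).[y] - m n * (hpoly a b n.+1).[y]).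
Proof.
elim: n => [|n IH].
  rewrite /ksum !big_ord_recl !big_ord0 !addr0 /= /Dop recC0 mul0r addr0.
  have := hpoly_rec_at 0 y; rewrite recC0 => h.
  transitivity (m 0%N * jw a b 0 * (2 * y * (hpoly a b 0).[y])); first by ring.
  by rewrite h /=; ring.
rewrite /ksum !(big_ord_recr n.+1) /= -!/(ksum _ _ _) mulrDr IH.
have := hpoly_rec_at n.+1 y; rewrite /= => h.
have -> : 2 * y * (m n.+1 * jw a b n.+1 * (hpoly a b n.+1).[y]) =
  m n.+1 * jw a b n.+1 * (2 * y * (hpoly a b n.+1).[y]) by ring.
by rewrite h jw_rec// [Dop m n.+1]/Dop /=; ring.
Qed.

Lemma ksum_Dop_supp N m y : (forall k, (N <= k)%N -> m k = 0) ->
  2 * y * ksum N m y = ksum N.+1 (Dop m) y.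
Proof.
move=> m0; rewrite -(@ksum_widen N N.+1 m)// ksum_Dop !m0//.
by rewrite !mul0r subrr mulr0 addr0.
Qed.

Lemma Dop_supp N m : (forall k, (N <= k)%N -> m k = 0) ->
  forall k, (N.+1 <= k)%N -> Dop m k = 0.
Proof.
move=> m0 [|k]// Nk; rewrite /Dop /= !m0 ?subrr ?mulr0 ?addr0//; lia.
Qed.

Lemma iter_Dop_supp l N m : (forall k, (N <= k)%N -> m k = 0) ->
  forall k, (N + l <= k)%N -> iter l Dop m k = 0.
Proof.
move=> m0; elim: l => [|l IH] k; first by rewrite addn0; exact: m0.
by rewrite addnS; exact: Dop_supp.
Qed.

Lemma Dop_low n m : (forall k, (k < n)%N -> m k = 0) ->
  forall k, (k < n.-1)%N -> Dop m k = 0.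
Proof.
by move=> m0 k kn; rewrite /Dop /= !m0 ?subrr ?mulr0 ?addr0//; lia.
Qed.

Lemma iter_Dop_low l n m : (forall k, (k < n)%N -> m k = 0) ->
  forall k, (k < n - l)%N -> iter l Dop m k = 0.
Proof.
move=> m0; elim: l => [|l IH] k; first by rewrite subn0; exact: m0.
by rewrite subnS; exact: Dop_low.
Qed.

Lemma ksum_iter_Dop l N m y : (forall k, (N <= k)%N -> m k = 0) ->
  (2 * y) ^+ l * ksum N m y = ksum (N + l) (iter l Dop m) y.
Proof.
move=> m0; elim: l => [|l IH]; first by rewrite addn0 expr0 mul1r.
by rewrite exprS -mulrA IH addnS /= -ksum_Dop_supp//; exact: iter_Dop_supp.
Qed.

(** Both recurrence coefficients tend to [1/2], so [Dop] is to leading order minus half a second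
    difference. The rest is a first difference times [recC - recA], which has order -1. *)
Lemma sym_Dop (I : Type) d (m : I -> nat -> R) :
  sym d m -> sym (d - 2) (fun i => Dop (m i)).
Proof.
move=> sm.
have l1 : (-1 : R) <= 0 by lra.
have sA : sym 0 (fun (i : I) k => recA a b k.+1).
  apply: (@sym_comp _ unit _ (fun=> tt) 0 (fun=> fun k => recA a b k.+1)).
  apply: (@sym_S _ _ _ (fun=> fun k => recA a b k)).
  apply: sym_ext (symD (symW l1 (sym_recA ba hb)) (sym_cst unit 2^-1)) => _ k.
  by rewrite subrK.
have sCA : sym (-1) (fun (i : I) k => recC a b k.+1 - recA a b k.+1).
  apply: (@sym_comp _ unit _ (fun=> tt) (-1) (fun=> fun k => recC a b k.+1 - recA a b k.+1)).
  apply: (@sym_S _ _ _ (fun=> fun k => recC a b k - recA a b k)).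
  apply: sym_ext (symB (sym_recC ba hb) (sym_recA ba hb)) => _ k; ring.
have sd := sym_dif sm; have sdd := sym_dif sd.
have h1 := symM sA sdd; have h2 := symM sCA sd.
have e1 : 0 + (d - 1 - 1) = d - 2 by ring.
have e2 : -1 + (d - 1) = d - 2 by ring.
rewrite e1 in h1; rewrite e2 in h2.
apply: sym_S_inv.
  apply: sym_ext (symB h2 h1) => i k; rewrite /Dop /dif /=; ring.
have [C Cd] := sym_bnd sd.
exists (`|recA a b 0| * (C * pw 0 (d - 1))) => i.
rewrite /Dop recC0 mul0r addr0 normrM ler_wpM2l// -normrN opprB.
exact: Cd.
Qed.

Lemma sym_iter_Dop (I : Type) l d (m : I -> nat -> R) :
  sym d m -> sym (d - 2 * l%:R) (fun i => iter l Dop (m i)).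
Proof.
move=> sm; elim: l => [|l IH]; first by rewrite mulr0 subr0.
have -> : d - 2 * l.+1%:R = d - 2 * l%:R - 2 by rewrite -natr1; ring.
exact: sym_Dop IH.
Qed.

Lemma bnd_jw (I : Type) d (m : I -> nat -> R) : bnd d m ->
  exists2 C, 0 <= C &
    forall i k, `|m i k| * jw a b k <= C * pw k (d + 2 * a + 1).
Proof.
move=> /bnd_ge0[C C0 Cm]; have [c c0 [D hD]] := jw_asymp ba hb.
have D0 : 0 <= D.
  have /andP[h1 h2] := hD 0%N; have := le_trans h1 h2.
  by rewrite /pw powR1 !mulr1; apply: le_trans; exact: ltW.
exists (C * D); first exact: mulr_ge0.
move=> i k; rewrite -addrA pwD mulrACA ler_pM//; first exact/ltW/jw_gt0.
by have /andP[] := hD k.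
Qed.

Lemma ksum_le N m y : 0 <= y <= 1 ->
  `|ksum N m y| <= \sum_(k < N) `|m k| * jw a b k.
Proof.
move=> yI; rewrite (le_trans (ler_norm_sum _ _ _))//; apply: ler_sum => k _.
rewrite (normrM (m k * jw a b k)) (normrM (m k)) (gtr0_norm (jw_gt0 ba hb k)).
rewrite ler_piMr ?hpoly_le1//.
by rewrite mulr_ge0// ltW// jw_gt0.
Qed.

Lemma ksum_tail (I : Type) d (m : I -> nat -> R) (p : I -> nat) :
  bnd d m -> (forall i k, (k < p i)%N -> m i k = 0) -> d + 2 * a + 2 < 0 ->
  exists2 C, 0 <= C & forall i N y, 0 <= y <= 1 ->
    `|ksum N (m i) y| <= C * pw (p i) (d + 2 * a + 2).
Proof.
move=> bm m0 dneg; have [C C0 hC] := bnd_jw bm.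
have [|D D0 hD] := @pw_tail_sum R (d + 2 * a + 1); first lra.
exists (C * D); first exact: mulr_ge0.
move=> i N y yI; apply: le_trans (ksum_le N (m i) yI) _.
have [Np|pN] := leqP N (p i).
  rewrite big1 ?mulr_ge0 ?pw_ge0// => k _; rewrite m0 ?normr0 ?mul0r//.
  exact: leq_trans Np.
rewrite -(big_mkord xpredT (fun k => `|m i k| * jw a b k)).
rewrite (big_cat_nat (n := p i)) ?(ltnW pN)//= big_nat_cond big1 ?add0r; last first.
  by move=> k /andP[/andP[_ kp] _]; rewrite m0// normr0 mul0r.
apply: (@le_trans _ _ (\sum_(p i <= k < N) C * pw k (d + 2 * a + 1))).
  by apply: ler_sum => k _; exact: hC.
rewrite -mulr_sumr -mulrA ler_wpM2l//.
have -> : d + 2 * a + 2 = d + 2 * a + 1 + 1 by ring.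
exact: hD.
Qed.

(** After [l] applications of [Dop] the series converges absolutely and starts no earlier than
    [p i - l], so that a tail sum of powers yields the power of [p i]. *)
Lemma kernel_decay (I : Type) d l (m : I -> nat -> R) (p : I -> nat) :
  sym d m -> (forall i k, (k < p i)%N -> m i k = 0) -> d + 2 * a + 2 < 2 * l%:R ->
  exists2 C, 0 <= C & forall i N y, 0 <= y <= 1 ->
    (forall k, (N <= k)%N -> m i k = 0) ->
    y ^+ l * `|ksum N (m i) y| <= C * pw (p i) (d + 2 * a + 2 - 2 * l%:R).
Proof.
move=> sm m0 dl; set e := d + 2 * a + 2 - 2 * l%:R.
have eE : d - 2 * l%:R + 2 * a + 2 = e by rewrite /e; ring.
have [|||C C0 hC] := @ksum_tail I (d - 2 * l%:R) (fun i => iter l Dop (m i)) (fun i => p i - l)%N.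
- exact: sym_bnd (sym_iter_Dop l sm).
- by move=> i; apply: iter_Dop_low; exact: m0.
- by rewrite eE /e; lra.
exists (C * l.+1%:R `^ `|e|); first by rewrite mulr_ge0 ?powR_ge0.
move=> i N y yI mN; have := hC i (N + l)%N y yI; rewrite -ksum_iter_Dop//.
case/andP: (yI) => y0 y1.
rewrite normrM (ger0_norm (exprn_ge0 l (mulr_ge0 (ler0n R 2) y0))) exprMn -[X in X <= _]mulrA.
rewrite eE => h; apply: (@le_trans _ _ (C * pw (p i - l) e)).
  by apply: le_trans h; rewrite ler_peMl ?mulr_ge0 ?exprn_ge0// exprn_ege1// ler1n.
by rewrite -mulrA ler_wpM2l// pw_subn_le.
Qed.

End Kernels.

(** * Smooth truncation: upper bounds and the peak at the origin *)

Section CutoffKernels.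
Variables (R : realType) (a b : R).
Hypotheses (ba : b <= a) (hb : - 2^-1 <= b).
Variable chi : nat -> nat -> R.
Hypothesis chi_sym : sym 0 chi.
Hypothesis chi_ge0 : forall n k, 0 <= chi n k.
Hypothesis chi_one : forall n k, (0 < n)%N -> (k <= n)%N -> chi n k = 1.
Hypothesis chi_zero : forall n k, (0 < n)%N -> (n.*2 <= k)%N -> chi n k = 0.
Implicit Types (d y : R) (k N l n : nat) (m : nat -> R).

Let a_ge : - 2^-1 <= a. Proof. exact: le_trans ba. Qed.

Lemma ksum_head (I : Type) d (m : I -> nat -> R) :
  bnd d m -> 0 <= d + 2 * a + 1 ->
  exists2 C, 0 <= C & forall i N y, 0 <= y <= 1 ->
    `|ksum a b N (m i) y| <= C * N%:R `^ (d + 2 * a + 2).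
Proof.
move=> bm d0; have [C C0 hC] := bnd_jw ba hb bm; exists C => // i N y yI.
apply: le_trans (ksum_le ba hb N (m i) yI) _.
apply: (@le_trans _ _ (\sum_(k < N) C * pw k (d + 2 * a + 1))).
  by apply: ler_sum => k _; exact: hC.
rewrite -mulr_sumr ler_wpM2l//.
have -> : d + 2 * a + 2 = d + 2 * a + 1 + 1 by ring.
exact: pw_head_sum.
Qed.

Lemma powR_le_neg (x y s : R) : 0 < x -> x <= y -> s <= 0 -> y `^ s <= x `^ s.
Proof.
move=> x0 xy s0; have y0 : 0 < y by exact: lt_le_trans xy.
rewrite -[s]opprK powRN [leRHS]powRN lef_pV2 ?posrE ?powR_gt0//.
by rewrite ge0_ler_powR ?nnegrE ?oppr_ge0// ltW.
Qed.

(** Cut at a frequency [M] close to [y^(-1/2)]: the low part is estimated termwise, the high part by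
    [kernel_decay] with [2 l > P], and both bounds have the size [M^P]. *)
Lemma kernel_upper (I : Type) d (m : I -> nat -> R) :
  sym d m -> 0 <= d + 2 * a + 1 ->
  exists2 C, 0 <= C & forall i N y, 0 < y <= 1 ->
    (forall k, (N <= k)%N -> m i k = 0) ->
    `|ksum a b N (m i) y| <= C * (y `^ (- 2^-1)) `^ (d + 2 * a + 2).
Proof.
move=> sm d0; set P := d + 2 * a + 2.
have P1 : 1 <= P by rewrite /P; lra.
pose l := (Num.truncn P).+1; have lP : P < 2 * l%:R.
  by have := truncnS_gt P; rewrite -/l; lra.
(* The cut depends on [y], so its position joins the index of the family in order to keep the
   constants uniform. *)
pose m1 (iM : I * nat) k := chi iM.2 k * m iM.1 k.
pose m2 (iM : I * nat) k := m iM.1 k - m1 iM k.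
have sm1 : sym d m1.
  rewrite -[d]add0r; apply: symM; first exact: (sym_comp snd chi_sym).
  exact: (sym_comp fst sm).
have sm2 : sym d m2 by apply: symB => //; exact: (sym_comp fst sm).
have [C1 C10 h1] := ksum_head (sym_bnd sm1) d0.
have m2low (iM : I * nat) k : (k < iM.2)%N -> m2 iM k = 0.
  move=> kM; rewrite /m2 /m1 chi_one ?mul1r ?subrr ?(ltnW kM)//.
  exact: leq_ltn_trans kM.
have [C2 C20 h2] := kernel_decay ba hb sm2 m2low lP.
exists (C1 * 4 `^ P + C2); first by rewrite addr_ge0// mulr_ge0 ?powR_ge0.
move=> i N y /andP[y0 y1] mN; set Y := y `^ (- 2^-1).
have yI : 0 <= y <= 1 by rewrite (ltW y0).
have Y1 : 1 <= Y.
  have <- : 1 `^ (- 2^-1) = 1 :> R by rewrite powR1.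
  by apply: powR_le_neg => //; lra.
have Y0 : 0 < Y by lra.
pose M := (Num.truncn Y).+1.
have YM : Y < M%:R := truncnS_gt Y.
have MY : M%:R <= 2 * Y.
  have : (Num.truncn Y)%:R <= Y by rewrite truncn_le// ltW.
  by rewrite /M -natr1; lra.
have -> : ksum a b N (m i) y = ksum a b N (m1 (i, M)) y + ksum a b N (m2 (i, M)) y.
  by rewrite -ksumD; apply: eq_ksum => k _; rewrite /m2 /=; ring.
rewrite (le_trans (ler_normD _ _))// mulrDl lerD//.
  have E : `|ksum a b N (m1 (i, M)) y| <= C1 * (M.*2)%:R `^ P.
    have P0 : 0 <= P by lra.
    have [NM|MN] := leqP N M.*2.
      apply: le_trans (h1 (i, M) N y yI) _.
      by rewrite ler_wpM2l// ge0_ler_powR ?nnegrE ?ler_nat.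
    rewrite (@ksum_widen _ _ _ M.*2 N) ?(ltnW MN)//; first exact: h1.
    by move=> k Mk; rewrite /m1 /= chi_zero ?mul0r.
  apply: le_trans E _; rewrite -mulrA ler_wpM2l// -powRM ?(ltW Y0)//.
  rewrite ge0_ler_powR ?nnegrE ?mulr_ge0 ?(ltW Y0)//; first lra.
  by rewrite -mul2n natrM; lra.
have := h2 (i, M) N y yI; rewrite -/P => /(_ _)/wrap[].
  by move=> k Nk; rewrite /m2 /m1 /= mN// mulr0 subrr.
move=> h3; have yl : 0 < y ^+ l by rewrite exprn_gt0.
rewrite -(ler_pM2l yl) (le_trans h3)//= mulrCA ler_wpM2l//.
have -> : y ^+ l * Y `^ P = Y `^ (P - 2 * l%:R).
  rewrite powRD ?(gt_eqF Y0) ?implybT// mulrC; congr *%R.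
  by rewrite /Y -powRrM -powR_mulrn ?(ltW y0)//; congr powR; field.
rewrite /pw; apply: powR_le_neg => //; last lra.
by rewrite (le_trans (ltW YM))// ler_nat.
Qed.

(** As [chi n] is constant up to [n], a single [Dop] annihilates it below [n]. The other [l]
    applications then act on a symbol supported at frequencies at least [n]. *)
Lemma cutoff_decay l : 2 * a + 2 < 2 * l.+1%:R ->
  exists2 C, 0 <= C & forall n N y, (0 < n)%N -> (n.*2 <= N)%N -> 0 <= y <= 1 ->
    y ^+ l.+1 * `|ksum a b N (chi n) y| <= C * pw n (2 * a + 2 - 2 * l.+1%:R).
Proof.
move=> al.
have sD := sym_Dop ba hb chi_sym.
have low n k : (k < n)%N -> Dop a b (chi n) k = 0.
  move=> kn; have n0 : (0 < n)%N by exact: leq_ltn_trans kn.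
  rewrite /Dop !chi_one ?subrr ?mulr0 ?addr0// ?(ltnW kn)//.
  by rewrite (leq_trans (leq_pred _))// ltnW.
have dl : 0 - 2 + 2 * a + 2 < 2 * l%:R by rewrite -natr1 in al; lra.
have [C C0 hC] := kernel_decay ba hb sD low dl.
exists C => // n N y n0 nN yI.
have chiN k : (N <= k)%N -> chi n k = 0.
  by move=> Nk; rewrite chi_zero// (leq_trans nN).
have := hC n N.+1 y yI (Dop_supp ba hb chiN); rewrite -(ksum_Dop_supp ba hb)//.
have -> : 0 - 2 + 2 * a + 2 - 2 * l%:R = 2 * a + 2 - 2 * l.+1%:R by rewrite -natr1; ring.
apply: le_trans; case/andP: yI => y0 _.
rewrite normrM normrM (ger0_norm y0) gtr0_norm// exprSr -!mulrA ler_wpM2l ?exprn_ge0//.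
by rewrite ler_peMl ?mulr_ge0// ler1n.
Qed.

Lemma pw_head_sum_ge (s : R) n : 0 <= s -> (0 < n)%N ->
  (2 * (s + 1))^-1 * n%:R `^ (s + 1) <= \sum_(1 <= k < n.+1) pw k s.
Proof.
move=> s0 n0; have s1 : 0 < s + 1 by lra.
have step k : (0 < k)%N -> (s + 1)^-1 * (k.+1%:R `^ (s + 1) - k%:R `^ (s + 1)) <= pw k s.
  move=> k0; have [|z /andP[z1 z2]] := @powR_mean_value R (s + 1) k%:R; first by rewrite ltr0n.
  rewrite natr1 addrK => ->; rewrite mulrA mulVf ?gt_eqF// mul1r /pw.
  have zk : 0 < z by rewrite (lt_trans _ z1)// ltr0n.
  by rewrite ge0_ler_powR ?nnegrE ?(ltW zk)// -natr1 ltW.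
apply: (@le_trans _ _ (\sum_(1 <= k < n.+1) (s + 1)^-1 * (k.+1%:R `^ (s + 1) - k%:R `^ (s + 1)))).
  rewrite -mulr_sumr (telescope_sumr (fun k => k%:R `^ (s + 1))) ?ltnS ?n0//.
  rewrite invfM [2^-1 * _]mulrC -mulrA ler_wpM2l ?invr_ge0 ?(ltW s1)//.
  rewrite powR1; have h1 : n%:R `^ (s + 1) <= n.+1%:R `^ (s + 1).
    by rewrite ge0_ler_powR ?nnegrE ?(ltW s1)// ler_nat.
  have h2 : 2 <= n.+1%:R `^ (s + 1).
    apply: (@le_trans _ _ (2 `^ (s + 1))); first by rewrite le1r_powR// ?ler1n//; lra.
    by rewrite ge0_ler_powR ?nnegrE ?(ltW s1)// ler_nat.
  by lra.
by rewrite big_nat_cond [leRHS]big_nat_cond; apply: ler_sum => k /andP[/andP[k0 _] _]; exact: step.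
Qed.

(** For [t] this small every polynomial of degree below [2 n] is at least [1/2], so nothing cancels,
    and the terms [1 <= k <= n], where the cutoff is 1, already give the full power. Index 0 is left
    out because the multiplier may vanish there. *)
Lemma kernel_near0 d (mu : nat -> R) (c0 : R) : 0 <= d + 2 * a + 1 -> 0 < c0 ->
  (forall k, 0 <= mu k) -> (forall k, (0 < k)%N -> c0 * pw k d <= mu k) ->
  exists2 c, 0 < c & forall n N (t : R), (0 < n)%N -> (n.*2 <= N)%N ->
    0 <= t -> 2 * (2 * n%:R + (a + b + 1)) * t <= 1 ->
    c * n%:R `^ (d + 2 * a + 2) <= ksum a b N (fun k => chi n k * mu k) ((1 - cos t) / 2).
Proof.
move=> d0 c00 mu0 mul; have [cw cw0 [Cw hw]] := jw_asymp ba hb.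
set s := d + 2 * a + 1.
exists (2^-1 * (c0 * cw) * (2 * (s + 1))^-1).
  by rewrite !mulr_gt0 ?invr_gt0 ?mulr_gt0//; rewrite /s; lra.
move=> n N t n0 nN t0 tn; set y := (1 - cos t) / 2.
have chin k : (n.*2 <= k)%N -> chi n k * mu k = 0.
  by move=> nk; rewrite chi_zero// mul0r.
rewrite (ksum_widen _ _ _ nN chin).
have Fk k : (k < n.*2)%N -> 2^-1 <= (hpoly a b k).[y].
  move=> kn; apply: le_trans (hpoly_cos_ge ba hb k t0).
  have : (k%:R + (a + b + 1)) * t <= (2 * n%:R + (a + b + 1)) * t.
    by rewrite ler_wpM2r// lerD2r -natrM ler_nat mul2n ltnW.
  by lra.
have pos k : 0 <= chi n k * mu k * jw a b k.
  by apply: mulr_ge0; [apply: mulr_ge0|apply/ltW/jw_gt0].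
have term k : (k < n.*2)%N -> 2^-1 * (chi n k * mu k * jw a b k) <=
    chi n k * mu k * jw a b k * (hpoly a b k).[y].
  by move=> kn; rewrite mulrC ler_wpM2l ?Fk.
apply: (@le_trans _ _ (\sum_(k < n.*2) 2^-1 * (chi n k * mu k * jw a b k))); last first.
  by apply: ler_sum => k _; exact: term.
rewrite -mulr_sumr -!mulrA ler_wpM2l ?invr_ge0//.
rewrite -(big_mkord xpredT (fun k => chi n k * mu k * jw a b k)).
have n2 : (n.+1 <= n.*2)%N by rewrite -addnn; lia.
rewrite (big_cat_nat (n := n.+1)) //= ler_wpDr//.
  by apply: sumr_ge0.
rewrite big_ltn// ler_wpDl//.
have -> : d + 2 * a + 2 = s + 1 by rewrite /s; ring.
apply: (@le_trans _ _ (c0 * (cw * \sum_(1 <= k < n.+1) pw k s))).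
  by rewrite ler_pM2l// ler_pM2l//; exact: pw_head_sum_ge.
rewrite !mulr_sumr.
apply: ler_sum_nat => k /andP[k0 kn].
rewrite chi_one// mul1r.
have -> : c0 * (cw * pw k s) = c0 * pw k d * (cw * pw k (2 * a + 1)).
  by rewrite /s -addrA pwD; ring.
rewrite ler_pM ?mulr_ge0 ?pw_ge0 ?(ltW c00) ?(ltW cw0) ?mul//.
by have /andP[] := hw k.
Qed.

End CutoffKernels.

(** * Kernels equal to powers *)

Section PowerFamily.
Variables (R : realType) (a b r : R).
Hypotheses (ba : b <= a) (hb : - 2^-1 <= b) (r0 : 0 < r).
Implicit Types (d y : R) (k N l n i j : nat).
Let la := a + b + 1.

Let a_gtN1 : -1 < a. Proof. by have := hb; have := ba; lra. Qed.
Let b_gtN1 : -1 < b. Proof. by have := hb; lra. Qed.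
Let la_ge0 : 0 <= la. Proof. by rewrite /la; have := hb; have := ba; lra. Qed.

Let x0 := b + 1 - r / 2.
Let shift := (Num.truncn `|x0|).+1.

Let x0_shift : 0 < x0 + shift%:R.
Proof. by have := truncnS_gt `|x0|; have := ler_norm (- x0); rewrite normrN -/shift; lra. Qed.

(* A solution of the recurrence of [j -> 1 / Gamma (x0 + j)], normalized at [shift]. *)
Let rgam j : R := (\prod_(j <= i < shift) (x0 + i%:R)) / \prod_(shift <= i < j) (x0 + i%:R).

Let rgam_rec j : rgam j = (x0 + j%:R) * rgam j.+1.
Proof.
rewrite /rgam; have [js|sj] := ltnP j shift.
  by rewrite (big_geq (ltnW js)) (big_geq js) !divr1 big_ltn.
have xj : 0 < x0 + j%:R.
  have : shift%:R <= j%:R :> R by rewrite ler_nat.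
  by have := x0_shift; lra.
rewrite (big_geq sj) (big_geq (leqW sj)) big_nat_recr//=.
by rewrite !div1r invfM mulrCA divff ?mulr1 ?lt0r_neq0.
Qed.

Let rgam_gt0 j : (shift <= j)%N -> 0 < rgam j.
Proof.
move=> sj; rewrite /rgam (big_geq sj) div1r invr_gt0 big_nat_cond.
apply: prodr_gt0 => i /andP[/andP[si _] _].
have : shift%:R <= i%:R :> R by rewrite ler_nat.
by have := x0_shift; lra.
Qed.

Let tau := a + 1 + r / 2.

(* Up to a constant, the coefficients of [y ^ (i - tau)]; see [powers_ksum]. *)
Definition bs i k : R :=
  rising (tau - i%:R) k * (rising (b + 1) k / rising (a + 1) k) * rgam (k + i).

Let rising_gt0 (x : R) k : 0 < x -> 0 < rising x k.
Proof. by move=> x1; apply: prodr_gt0 => i _; rewrite ltr_wpDr. Qed.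

(** As for [hcoef], a common factor replaces quotients of neighbours: [rgam] has zeros when [x0] is
    a nonpositive integer. *)
Let bs_neighbours i k : exists Z, [/\
  bs i k = Z * (x0 + k%:R + i%:R) * (x0 + k%:R + i%:R + 1),
  bs i k.+1 = Z * (tau - i%:R + k%:R) * ((b + 1 + k%:R) / (a + 1 + k%:R)) * (x0 + k%:R + i%:R + 1),
  bs i k.+2 = Z * (tau - i%:R + k%:R) * (tau - i%:R + k%:R + 1) *
    ((b + 1 + k%:R) * (b + 2 + k%:R) / ((a + 1 + k%:R) * (a + 2 + k%:R)))
& bs i.+1 k.+1 = Z * (tau - i%:R - 1) * ((b + 1 + k%:R) / (a + 1 + k%:R))].
Proof.
exists (rising (tau - i%:R) k * (rising (b + 1) k / rising (a + 1) k) * rgam (k + i).+2).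
have n0 : rising (a + 1) k != 0 by rewrite gt_eqF// rising_gt0//; have := a_gtN1; lra.
have kk := ler0n R k.
have n1 : a + 1 + k%:R != 0 by rewrite gt_eqF//; have := a_gtN1; lra.
have n2 : a + 2 + k%:R != 0 by rewrite gt_eqF//; have := a_gtN1; lra.
have e1 : rgam (k + i).+1 = (x0 + k%:R + i%:R + 1) * rgam (k + i).+2.
  by rewrite rgam_rec -natr1 natrD !addrA.
have e0 : rgam (k + i) = (x0 + k%:R + i%:R) * rgam (k + i).+1.
  by rewrite rgam_rec natrD addrA.
have s1 (x : R) : rising x k.+2 = rising x k * (x + k%:R) * (x + 1 + k%:R).
  by rewrite !risingS -natr1; ring.
have s2 : rising (tau - i.+1%:R) k.+1 = (tau - i%:R - 1) * rising (tau - i%:R) k.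
  by rewrite risingSl -natr1; congr (_ * rising _ _); ring.
have n3 : a + 1 + 1 + k%:R != 0 by have -> : a + 1 + 1 + k%:R = a + 2 + k%:R by ring.
split; rewrite /bs.
- by rewrite e0 e1; ring.
- by rewrite addSn e1 !risingS; field; rewrite n0 n1.
- by rewrite !addSn !s1; field; rewrite n0 n1 n2.
- by rewrite addSn addnS s2 !risingS; field; rewrite n0 n1.
Qed.

Let bs0 i : [/\ bs i 0 = (x0 + i%:R) * rgam i.+1,
  bs i 1 = (tau - i%:R) * ((b + 1) / (a + 1)) * rgam i.+1 & bs i.+1 0 = rgam i.+1].
Proof.
rewrite /bs !risingS !rising0 mulr0n !addr0 !mul1r invr1 !mul1r !add0n add1n.
by split; first exact: rgam_rec.
Qed.

Let dens k : [/\ 2 * k%:R + la + 1 != 0, 2 * k%:R + la + 2 != 0,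
   2 * k%:R + la + 3 != 0, a + 1 != 0 & la + 1 != 0].
Proof.
have := ler0n R k; have := la_ge0; have := a_gtN1 => h1 h2 h3.
by split; rewrite gt_eqF//; lra.
Qed.

(** Kernel form of multiplying [y^(i - tau)] by [2 y]. The normalization of [bs] omits the factor
    [Gamma (i - r/2)] of the true coefficients, and [2 i - r] is twice the quotient of its values at
    [i + 1] and [i]. *)
Lemma Dop_bs i k : Dop a b (bs i) k = (2 * i%:R - r) * bs i.+1 k.
Proof.
case: k => [|k].
  rewrite /Dop recC0 mul0r addr0; have [-> -> ->] := bs0 i.
  have [_ _ _ d4 d5] := dens 0; rewrite /recA -/la.
  by rewrite /tau /x0 /la in d5 *; field; rewrite d4 d5.
rewrite /Dop /=; have [Z [-> -> -> ->]] := bs_neighbours i k.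
have [d1 d2 d3 d4 d5] := dens k; rewrite recAS recCS -/la.
have n1 : a + 1 + k%:R != 0 by rewrite gt_eqF//; have := ler0n R k; have := a_gtN1; lra.
have n2 : a + 2 + k%:R != 0 by rewrite gt_eqF//; have := ler0n R k; have := a_gtN1; lra.
have d2' : 2 * k%:R + 2 + la != 0 by rewrite addrAC.
by rewrite /tau /x0 /la in d1 d2 d3 d2' *; field; rewrite n1 n2 d1 d2 d3.
Qed.

(** The action on multipliers of [- 2 y (1 - y) d/dy], obtained from the structure relation by
    summation by parts; see [ksum_Mop]. *)
Definition Mop (m : nat -> R) k : R :=
  recA a b k * (k%:R * m k + (k%:R + 1 + la) * m k.+1)
  - recC a b k * ((k%:R - 1) * m k.-1 + (k%:R + la) * m k).

Let sigma i : R := i%:R - tau.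

(** For kernels this reads [y (1 - y) K' = sigma (1 - y) K], the differential equation of
    [y^sigma]. *)
Lemma Mop_bs i k : Mop (bs i) k = - (2 * sigma i) * bs i k + sigma i * Dop a b (bs i) k.
Proof.
case: k => [|k].
  rewrite /Dop /Mop recC0 !mul0r addr0 subr0; have [-> -> _] := bs0 i.
  have [_ _ _ d4 d5] := dens 0; rewrite /recA -/la.
  by rewrite /sigma /tau /x0 /la in d5 *; field; rewrite d4 d5.
rewrite /Dop /Mop /=; have [Z [-> -> -> _]] := bs_neighbours i k.
have [d1 d2 d3 d4 d5] := dens k; rewrite recAS recCS -/la.
have n1 : a + 1 + k%:R != 0 by rewrite gt_eqF//; have := ler0n R k; have := a_gtN1; lra.
have n2 : a + 2 + k%:R != 0 by rewrite gt_eqF//; have := ler0n R k; have := a_gtN1; lra.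
have d2' : 2 * k%:R + 2 + la != 0 by rewrite addrAC.
rewrite -natr1.
by rewrite /sigma /tau /x0 /la in d1 d2 d3 d2' *; field; rewrite n1 n2 d1 d2 d3.
Qed.

Lemma bs_head_neq0 : exists L, forall i, (L <= i)%N -> bs i 0 != 0.
Proof.
exists shift => i si; rewrite /bs !rising0 divr1 !mul1r add0n.
by rewrite gt_eqF// rgam_gt0.
Qed.

Definition eig k : R := k%:R * (k%:R + la).

(* The two sequences agree to leading order, so their kernels have the same singularity. *)
Lemma bs_asymp : exists2 kappa, 0 < kappa &
  sym (r - 1) (fun (_ : unit) k => bs 0 k - kappa * eig k `^ (r / 2)).
Proof.
(* From [shift] on all factors are positive, so both sequences can be compared with powers there;
   the finitely many earlier terms are restored by [sym_addn_inv]. *)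
pose M := shift; have M0 : 0 < M%:R :> R by rewrite ltr0n.
have tau0 : 0 < tau by rewrite /tau; have := a_gtN1; have := r0; lra.
pose h k := bs 0 (k + M).
have h0 k : 0 < h k.
  rewrite /h /bs subr0; apply: mulr_gt0; last by rewrite addn0 rgam_gt0// leq_addl.
  apply: mulr_gt0; first exact: rising_gt0.
  by apply: divr_gt0; apply: rising_gt0; have := b_gtN1; have := a_gtN1; lra.
have hE k : h k.+1 / h k = (k%:R + (tau + M%:R)) / (k%:R + (x0 + M%:R)) *
    ((k%:R + (b + 1 + M%:R)) / (k%:R + (a + 1 + M%:R))).
  apply: (mulIf (lt0r_neq0 (h0 k))); rewrite divfK ?lt0r_neq0//.
  rewrite /h addSn; move: (h0 k); rewrite /h /bs subr0 !addn0 !risingS natrD => hk.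
  have xk : k%:R + (x0 + M%:R) != 0 by rewrite gt_eqF// ltr_wpDl.
  have ak : k%:R + (a + 1 + M%:R) != 0.
    by rewrite gt_eqF// ltr_wpDl//; have := a_gtN1; lra.
  have nr : rising (a + 1) (k + M) != 0 by rewrite gt_eqF// rising_gt0//; have := a_gtN1; lra.
  rewrite (rgam_rec (k + M)) natrD.
  have -> : a + 1 + (k%:R + M%:R) = k%:R + (a + 1 + M%:R) by ring.
  have -> : x0 + (k%:R + M%:R) = k%:R + (x0 + M%:R) by ring.
  by field; rewrite nr xk ak.
have r1 : ratio_like r (fun k => h k.+1 / h k).
  have -> : r = (tau + M%:R - (x0 + M%:R)) + (b + 1 + M%:R - (a + 1 + M%:R)).
    by rewrite /tau /x0; field.
  apply: (ratio_like_ext (fun k => esym (hE k))).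
  apply: ratio_likeM; apply: ratio_like_frac; first exact: x0_shift.
  by have := a_gtN1; lra.
have hE' k : h k / h k.+1 = (k%:R + (x0 + M%:R)) / (k%:R + (tau + M%:R)) *
    ((k%:R + (a + 1 + M%:R)) / (k%:R + (b + 1 + M%:R))).
  by rewrite -[LHS]invrK invf_div hE (invfM (_ / _)) !invf_div.
have r2 : ratio_like (- r) (fun k => h k / h k.+1).
  have -> : - r = (x0 + M%:R - (tau + M%:R)) + (a + 1 + M%:R - (b + 1 + M%:R)).
    by rewrite /tau /x0; field.
  apply: (ratio_like_ext (fun k => esym (hE' k))).
  apply: ratio_likeM; apply: ratio_like_frac; first lra.
  by have := b_gtN1; lra.
have [[kap1 k10 s1] _] := asymp_power h0 r1 r2.
pose g k := eig (k + M) `^ (r / 2).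
have l0 := la_ge0.
have kM k : 0 < k%:R + M%:R :> R by rewrite ltr_wpDl.
have kMl k : 0 < k%:R + (M%:R + la) by rewrite ltr_wpDl//; lra.
have gE k : g k = (k%:R + M%:R) `^ (r / 2) * (k%:R + (M%:R + la)) `^ (r / 2).
  by rewrite /g /eig natrD -[_ + la]addrA powRM// ltW.
have g0 k : 0 < g k by rewrite gE mulr_gt0 ?powR_gt0.
have Ml : 0 < M%:R + la by lra.
have e1 k : k.+1%:R + M%:R = k%:R + 1 + M%:R :> R by rewrite natr1.
have e2 k : k.+1%:R + (M%:R + la) = k%:R + 1 + (M%:R + la) by rewrite natr1.
have q1 : ratio_like r (fun k => g k.+1 / g k).
  have -> : r = r / 2 + r / 2 by field.
  apply: ratio_like_ext (ratio_likeM (ratio_like_powR (r / 2) M0) (ratio_like_powR (r / 2) Ml)).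
  by move=> k; rewrite !gE invfM mulrACA e1 e2.
have q2 : ratio_like (- r) (fun k => g k / g k.+1).
  have -> : - r = - (r / 2) + - (r / 2) by field.
  apply: ratio_like_ext (ratio_likeM (ratio_like_powR (- (r / 2)) M0) (ratio_like_powR (- (r / 2)) Ml)).
  by move=> k; rewrite !gE invfM !powRN !invrK -e1 -e2; ring.
have [[kap2 k20 s2] _] := asymp_power g0 q1 q2.
exists (kap1 / kap2); first by rewrite divr_gt0.
apply: (@sym_addn_inv _ _ _ M).
apply: sym_ext (symB s1 (symZ (kap1 / kap2) s2)) => _ k.
by rewrite /h /g; have := lt0r_neq0 k20 => kk; field.
Qed.

End PowerFamily.

(** * Convergence of the power kernels and identification of their sums *)

Section Limits.
Variable R : realType.

Lemma le_of_invS (x y D : R) : (forall n : nat, x <= y + D / n.+1%:R) -> x <= y.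
Proof.
move=> h; rewrite leNgt; apply/negP => yx; have xy : 0 < x - y by rewrite subr_gt0.
have := h (Num.truncn (`|D| / (x - y))); set n := Num.truncn _.
have : `|D| / (x - y) < n.+1%:R := truncnS_gt _.
rewrite ltr_pdivrMr// => h1 h2; have : x - y <= D / n.+1%:R by move: (D / _) h2 => z; lra.
rewrite ler_pdivlMr// => h3.
by have := ler_norm D; rewrite mulrC in h1; lra.
Qed.

Lemma eq0_of_invS (x D : R) : (forall n : nat, `|x| <= D / n.+1%:R) -> x = 0.
Proof.
move=> h; apply/eqP; rewrite -normr_le0; apply: (@le_of_invS _ _ D) => n.
by rewrite add0r.
Qed.

Lemma poly_le_closed (p : {poly R}) (M : R) :
  (forall y, 0 < y < 1 -> p.[y] <= M) -> forall y, 0 <= y <= 1 -> p.[y] <= M.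
Proof.
move=> h y /andP[y0 y1]; rewrite leNgt; apply/negP => My.
have [|d d0 hd] := @poly_gt0_near R (p - M%:P) y; first by rewrite hornerD hornerN hornerC subr_gt0.
pose e := Num.min d 1 / 3.
have e0 : 0 < e by rewrite divr_gt0// lt_min d0 ltr01.
have ed : e < d.
  have : Num.min d 1 <= d by rewrite ge_min lexx.
  by rewrite /e; lra.
have e1 : e <= 3^-1.
  have : Num.min d 1 <= 1 by rewrite ge_min lexx orbT.
  by rewrite /e; lra.
have [z zI zd] : exists2 z, 0 < z < 1 & `|y - z| < d.
  have [yh|yh] := leP y 2^-1.
    exists (y + e); first by apply/andP; split; lra.
    by rewrite opprD addrA subrr sub0r normrN gtr0_norm.
  exists (y - e); first by apply/andP; split; lra.
  by rewrite opprB addrC subrK gtr0_norm.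
have := hd z zd; rewrite hornerD hornerN hornerC subr_gt0 ltNge.
by rewrite h.
Qed.

End Limits.

Section PowerExpansion.
Variables (R : realType) (a b r : R).
Hypotheses (ba : b <= a) (hb : - 2^-1 <= b) (r0 : 0 < r).
Hypothesis r_not_even : forall i : nat, r != 2 * i%:R.
Implicit Types (d y : R) (k N l n i j : nat) (m : nat -> R).
Let la := a + b + 1.
Local Notation F k y := (hpoly a b k).[y].
Local Notation bs := (bs a b r).

Let a_ge : - 2^-1 <= a. Proof. exact: le_trans ba. Qed.
Let la_ge0 : 0 <= la. Proof. by rewrite /la; have := hb; have := a_ge; lra. Qed.

Definition kpoly N m : {poly R} := \sum_(k < N) (m k * jw a b k) *: hpoly a b k.

Lemma kpolyE N m y : (kpoly N m).[y] = ksum a b N m y.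
Proof. by rewrite horner_sum; apply: eq_bigr => k _; rewrite hornerZ. Qed.

Lemma hpoly_deriv_at k y : - 2 * (y * (1 - y) * (hpoly a b k)^`().[y]) =
  k%:R * recA a b k * (F k y - F k.+1 y) - (k%:R + la) * recC a b k * (F k y - F k.-1 y).
Proof.
case: k => [|k].
  by rewrite hpoly_deriv0 horner0 recC0 !mulr0n !mulr0 !mul0r subrr.
have := congr1 (horner^~ y) (hpoly_deriv ba hb k).
rewrite !(hornerD, hornerN, hornerZ, hornerM, hornerC, hornerX) => h.
by rewrite -h.
Qed.

Lemma ksum_Mop n m y : - 2 * (y * (1 - y) * (kpoly n.+1 m)^`().[y]) =
  ksum a b n.+1 (Mop a b m) y - jw a b n * recA a b n *
    (n%:R * m n * F n.+1 y + (n%:R + 1 + la) * m n.+1 * F n y).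
Proof.
elim: n => [|n IH].
  rewrite /kpoly /ksum !big_ord_recl !big_ord0 !addr0 /= /Mop recC0 !mul0r subr0.
  have := hpoly_deriv_at 0 y; rewrite recC0 => h.
  rewrite derivZ hornerZ.
  transitivity (m 0%N * jw a b 0 * (- 2 * (y * (1 - y) * (hpoly a b 0)^`().[y]))); first by ring.
  by rewrite h /= mulr0n -!/la; ring.
rewrite /kpoly /ksum !(big_ord_recr n.+1) /= -/(kpoly _ _) -!/(ksum _ _ _ _ _).
rewrite derivD hornerD derivZ hornerZ.
transitivity (- 2 * (y * (1 - y) * (kpoly n.+1 m)^`().[y]) +
  m n.+1 * jw a b n.+1 * (- 2 * (y * (1 - y) * (hpoly a b n.+1)^`().[y]))); first by ring.
rewrite IH hpoly_deriv_at jw_rec// [Mop a b m n.+1]/Mop /= -!/la -[n.+1%:R]natr1; ring.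
Qed.

Lemma iter_Dop_bs l k : iter l (Dop a b) (bs 0) k =
  (\prod_(i < l) (2 * i%:R - r)) * bs l k.
Proof.
elim: l k => [|l IH] k; first by rewrite big_ord0 mul1r.
rewrite /= (_ : iter l (Dop a b) (bs 0) = (fun k => (\prod_(i < l) (2 * i%:R - r)) * bs l k)).
  rewrite big_ord_recr /= -mulrA -Dop_bs// /Dop; ring.
by apply/funext.
Qed.

Lemma prod_neq0 l : \prod_(i < l) (2 * i%:R - r) != 0.
Proof.
apply/prodf_neq0 => i _; rewrite subr_eq0 eq_sym; exact: r_not_even.
Qed.

Lemma sym_eig : sym r (fun (_ : unit) k => eig a b k `^ (r / 2)).
Proof.
apply: sym_S_inv; last by exists `|eig a b 0 `^ (r / 2)|.
have l0 := la_ge0; have l1 : 0 < 1 + la by lra.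
have := symM (sym_powR (r / 2) ltr01) (sym_powR (r / 2) l1).
have -> : r / 2 + r / 2 = r by field.
apply: sym_ext => _ k.
rewrite /eig -(powRM _ (addr_ge0 (ler0n R k) ler01) (addr_ge0 (ler0n R k) (ltW l1))).
by rewrite addrA natr1.
Qed.

Lemma sym_bs l : sym (r - 2 * l%:R) (fun (_ : unit) k => bs l k).
Proof.
have [kap kap0 sk] := bs_asymp ba hb r0.
have s0 : sym r (fun (_ : unit) k => bs 0 k).
  have sk' : sym r (fun (_ : unit) k => bs 0 k - kap * eig a b k `^ (r / 2)).
    by apply: symW sk; lra.
  by apply: sym_ext (symD sk' (symZ kap sym_eig)) => _ k; rewrite subrK.
apply: sym_ext (symZ (\prod_(i < l) (2 * i%:R - r))^-1 (sym_iter_Dop ba hb l s0)) => _ k.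
by rewrite iter_Dop_bs mulrA mulVf ?mul1r// prod_neq0.
Qed.

Let tau := a + 1 + r / 2.

Section Level.
Variable l : nat.
(** Room for absolute convergence: the terms of the kernel of [bs l] have order
    [r - 2 l + 2 a + 1 <= -3], and one power of [k] is spent on the boundary terms of [ksum_ode]. *)
Hypothesis l_large : r + 2 * a + 4 <= 2 * l%:R.
Let sigma := l%:R - tau.

Let sigma_gt0 : 0 < sigma.
Proof. by rewrite /sigma /tau; have := l_large; lra. Qed.

Let ksum_step : exists2 C, 0 <= C & forall k y, 0 <= y <= 1 ->
  `|ksum a b k.+1 (bs l) y - ksum a b k (bs l) y| <= C / (k.+1%:R * k.+2%:R).
Proof.
have [C C0 hC] := bnd_jw ba hb (sym_bnd (sym_bs l)).
have b2 : bnd (-2) (fun (_ : unit) k => `|bs l k| * jw a b k).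
  exists C => _ k; rewrite ger0_norm; last by apply: mulr_ge0 => //; apply/ltW/jw_gt0.
  by rewrite (le_trans (hC tt k))// ler_wpM2l// ler_pw//; have := l_large; lra.
have [D hD] := bnd2_telescope b2.
exists `|D| => // k y yI.
rewrite /ksum big_ord_recr /= addrAC subrr add0r normrM.
apply: (@le_trans _ _ (`|bs l k| * jw a b k)).
  rewrite (normrM (bs l k)) (gtr0_norm (jw_gt0 ba hb k)) ler_piMr ?hpoly_le1//.
  by apply: mulr_ge0 => //; apply/ltW/jw_gt0.
have := hD k; rewrite ger0_norm; last by apply: mulr_ge0 => //; apply/ltW/jw_gt0.
by move=> /le_trans; apply; rewrite ler_wpM2r ?ler_norm.
Qed.

(** [ksum_Dop], [ksum_Mop] and [Mop_bs] combine to the differential equation of [y^sigma] for the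
    partial sums, up to boundary terms at [n] that the choice of [l] makes small. *)
Let ksum_ode : exists2 C, 0 <= C & forall n y, 0 <= y <= 1 ->
  `|2 * (1 - y) * (y * (kpoly n.+1 (bs l))^`().[y] - sigma * ksum a b n.+1 (bs l) y)|
    <= C / n.+1%:R.
Proof.
have sA : sym 0 (fun (_ : unit) k => recA a b k).
  have l1 : (-1 : R) <= 0 by lra.
  apply: sym_ext (symD (symW l1 (sym_recA ba hb)) (sym_cst unit 2^-1)) => _ k.
  by rewrite subrK.
have s1 : sym 1 (fun (_ : unit) k => k%:R + (1 + la)) by apply: sym_id_add; have := la_ge0; lra.
pose e n := `|recA a b n| * (n%:R + (1 + la) + `|sigma|) * (`|bs l n| + `|bs l n.+1|).
have be : bnd (1 + (r - 2 * l%:R)) (fun (_ : unit) n => e n).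
  have b1 : bnd 1 (fun (_ : unit) n => n%:R + (1 + la) + `|sigma|).
    apply: bndD; first exact: sym_bnd s1.
    by apply: bndW (sym_bnd (sym_cst unit `|sigma|)); lra.
  have bA : bnd 0 (fun (_ : unit) n => `|recA a b n|).
    by have [C hC] := sym_bnd sA; exists C => i n; rewrite normr_id; exact: hC.
  have bb : bnd (r - 2 * l%:R) (fun (_ : unit) n => `|bs l n| + `|bs l n.+1|).
    apply: bndD.
      by have [C hC] := sym_bnd (sym_bs l); exists C => i n; rewrite normr_id; exact: hC.
    by have [C hC] := bndS (sym_bnd (sym_bs l)); exists C => i n; rewrite normr_id; exact: hC.
  have := bndM (bndM bA b1) bb; by rewrite add0r.
have e0 n : 0 <= e n.
  rewrite /e; apply: mulr_ge0; last by rewrite addr_ge0.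
  apply: mulr_ge0 => //; apply: addr_ge0 => //; apply: addr_ge0 => //.
  by have := la_ge0; lra.
have [C C0 hC] := bnd_jw ba hb be.
exists C => // n y yI.
have -> : 2 * (1 - y) * (y * (kpoly n.+1 (bs l))^`().[y] - sigma * ksum a b n.+1 (bs l) y) =
  jw a b n * (recA a b n * ((n%:R * bs l n * F n.+1 y + (n%:R + 1 + la) * bs l n.+1 * F n y) +
     sigma * (bs l n.+1 * F n y - bs l n * F n.+1 y))).
  have h1 := ksum_Mop n (bs l) y.
  have h2 := ksum_Dop ba hb n (bs l) y.
  have h3 : ksum a b n.+1 (Mop a b (bs l)) y =
      - (2 * sigma) * ksum a b n.+1 (bs l) y + sigma * ksum a b n.+1 (Dop a b (bs l)) y.
    rewrite -!ksumZ -ksumD; apply: eq_ksum => k _.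
    exact: Mop_bs.
  rewrite h3 in h1.
  set S' := _^`().[y] in h1 *; set S := ksum a b n.+1 (bs l) y in h1 h2 *.
  set SD := ksum a b n.+1 (Dop _ _ _) y in h1 h2 *.
  have -> : 2 * (1 - y) * (y * S' - sigma * S) =
    - (- 2 * (y * (1 - y) * S')) - 2 * sigma * S + sigma * (2 * y * S) by ring.
  by rewrite h1 h2; ring.
rewrite (normrM (jw a b n)) (gtr0_norm (jw_gt0 ba hb n)) mulrC.
have F1 k : `|F k y| <= 1 by apply: hpoly_le1.
apply: (@le_trans _ _ (e n * jw a b n)).
  rewrite ler_wpM2r ?(ltW (jw_gt0 ba hb n))// normrM /e -[leRHS]mulrA ler_wpM2l//.
  have le1 (c z : R) : `|z| <= 1 -> `|c * z| <= `|c|.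
    by move=> z1; rewrite normrM ler_piMr.
  rewrite (le_trans (ler_normD _ _))// [leRHS]mulrDl lerD//.
    rewrite (le_trans (ler_normD _ _))// mulrDr lerD//.
      rewrite (le_trans (le1 _ _ (F1 _)))// normrM ler_wpM2r// ger0_norm//.
      by rewrite lerDl; have := la_ge0; lra.
    rewrite (le_trans (le1 _ _ (F1 _)))// normrM ler_wpM2r//.
    have nl : 0 <= n%:R + 1 + la by have := la_ge0; have := ler0n R n; lra.
    by rewrite (ger0_norm nl); lra.
  rewrite normrM ler_wpM2l// (le_trans (ler_normB _ _))// addrC lerD//; exact: le1.
have := hC tt n; rewrite ger0_norm// => /le_trans; apply.
by rewrite ler_wpM2l// -pwN1 ler_pw//; have := l_large; lra.
Qed.

Let sigmaN (y : R) : 0 < y -> y `^ (- sigma) * y `^ sigma = 1.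
Proof. by move=> y0; rewrite powRN mulVf// gt_eqF// powR_gt0. Qed.

(** The product of [y^(- sigma)] with a partial sum has derivative [O(1/n)] away from 0 and 1, so
    its limit is a constant [K]; working with partial sums avoids differentiating the limit. If [K]
    were 0, the sums would tend to 0 uniformly and [coef0_le] would force [bs l 0 = 0]. *)
Lemma powers_ksum : bs l 0 != 0 -> exists2 K, K != 0 & exists2 C, 0 <= C &
  forall N (y : R), 0 < y < 1 -> `|ksum a b N (bs l) y - K * y `^ sigma| <= C / N.+1%:R.
Proof.
move=> bl0; have [C C0 hC] := ksum_step; have [D D0 hD] := ksum_ode.
have /choice[f hf] (y : R) : exists f, 0 <= y <= 1 ->
    forall k, `|ksum a b k (bs l) y - f| <= C / k.+1%:R.
  have [yI|yI] := boolP (0 <= y <= 1); last by exists 0.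
  by have [f hf] := telescoping_cvg (fun k => hC k y yI); exists f.
have inc n : (n.+2%:R)^-1 <= (n.+1%:R)^-1 :> R by rewrite lef_pV2 ?posrE// ler_nat.
have cst (y1 y2 : R) : 0 < y1 -> y1 < y2 -> y2 < 1 ->
    y2 `^ (- sigma) * f y2 = y1 `^ (- sigma) * f y1.
  move=> y10 y12 y21; have y20 : 0 < y2 by lra.
  (* The factor [1 / (2 (1 - y2))] comes from dividing the estimate of [ksum_ode] by [2 (1 - y)],
     and the negative power of [y] is largest at [y1]. *)
  pose D' := y1 `^ (- sigma - 1) * (D / (2 * (1 - y2))) * (y2 - y1).
  apply/eqP; rewrite -subr_eq0; apply/eqP.
  apply: (@eq0_of_invS _ _ (D' + (y2 `^ (- sigma) * C + y1 `^ (- sigma) * C))) => n.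
  pose S (y : R) := ksum a b n.+1 (bs l) y.
  pose S' (y : R) := (kpoly n.+1 (bs l))^`().[y].
  have dphi (y : R) : y \in `]y1, y2[ -> is_derive y 1 (fun y => y `^ (- sigma) * S y)
      (y `^ (- sigma - 1) * (y * S' y - sigma * S y)).
    rewrite in_itv /= => /andP[h1 h2]; have y0 : 0 < y by lra.
    have dS : is_derive y 1 S (S' y).
      have -> : S = horner (kpoly n.+1 (bs l)) by apply/funext => z; rewrite kpolyE.
      exact: is_derive_poly.
    apply: trigger_derive (is_deriveM (is_derive1_powR (- sigma) y0) dS) _.
    have -> : y `^ (- sigma) = y `^ (- sigma - 1) * y.
      by rewrite powRB ?(gt_eqF y0) ?implybT// powRr1 ?(ltW y0)// divfK ?gt_eqF.
    by rewrite /GRing.scale /=; ring.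
  have cphi : {within `[y1, y2], continuous (fun y => y `^ (- sigma) * S y)}.
    apply: itv_within_continuous => y /andP[h1 h2].
    apply: continuousM; first by apply: continuous_powR; lra.
    have -> : S = horner (kpoly n.+1 (bs l)) by apply/funext => z; rewrite kpolyE.
    exact: continuous_horner.
  have [z] := MVT y12 dphi cphi; rewrite in_itv /= => /andP[h1 h2] E.
  have z0 : 0 < z by lra.
  have zI : 0 <= z <= 1 by apply/andP; split; lra.
  have bphi : `|y2 `^ (- sigma) * S y2 - y1 `^ (- sigma) * S y1| <= D' / n.+1%:R.
    rewrite E /D' normrM (gtr0_norm (_ : 0 < y2 - y1)) ?subr_gt0// [leRHS]mulrAC.
    rewrite ler_wpM2r ?subr_ge0 ?(ltW y12)// normrM ger0_norm ?powR_ge0// -[leRHS]mulrA.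
    apply: ler_pM => //; rewrite ?powR_ge0//.
      by apply: powR_le_neg => //; [exact: ltW|have := sigma_gt0; lra].
    have := hD n z zI; rewrite normrM (gtr0_norm (_ : 0 < 2 * (1 - z))); last lra.
    move=> hz; have y2p : 0 < 2 * (1 - y2) by lra.
    rewrite mulrAC ler_pdivlMr// [leLHS]mulrC; apply: le_trans hz.
    by rewrite ler_wpM2r//; lra.
  have b2 : `|y2 `^ (- sigma) * (S y2 - f y2)| <= y2 `^ (- sigma) * C / n.+1%:R.
    rewrite normrM ger0_norm ?powR_ge0// -mulrA ler_wpM2l ?powR_ge0//.
    have := hf y2 _ n.+1; rewrite (ltW y20) (ltW y21) => /(_ isT) /le_trans; apply.
    by rewrite ler_wpM2l.
  have b1 : `|y1 `^ (- sigma) * (S y1 - f y1)| <= y1 `^ (- sigma) * C / n.+1%:R.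
    rewrite normrM ger0_norm ?powR_ge0// -mulrA ler_wpM2l ?powR_ge0//.
    have := hf y1 _ n.+1; rewrite (ltW y10) (ltW (lt_trans y12 y21)) => /(_ isT) /le_trans; apply.
    by rewrite ler_wpM2l.
  have -> : y2 `^ (- sigma) * f y2 - y1 `^ (- sigma) * f y1 =
    (y2 `^ (- sigma) * S y2 - y1 `^ (- sigma) * S y1) - (y2 `^ (- sigma) * (S y2 - f y2)
      - y1 `^ (- sigma) * (S y1 - f y1)) by ring.
  rewrite (le_trans (ler_normB _ _))// mulrDl lerD// mulrDl.
  by rewrite (le_trans (ler_normB _ _))// lerD.
pose h := 2^-1 : R; pose K := h `^ (- sigma) * f h.
have fK (y : R) : 0 < y < 1 -> f y = K * y `^ sigma.
  move=> /andP[y0 y1]; rewrite /K.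
  have -> : h `^ (- sigma) * f h = y `^ (- sigma) * f y.
    have [yh|yh|->//] := ltgtP y h; first by apply: cst => //; rewrite /h; lra.
    by apply/esym/cst => //; rewrite /h; lra.
  by rewrite mulrAC sigmaN// mul1r.
have main N (y : R) : 0 < y < 1 -> `|ksum a b N (bs l) y - K * y `^ sigma| <= C / N.+1%:R.
  move=> yI; rewrite -fK//; apply: hf.
  by case/andP: yI => y0 y1; rewrite !ltW.
exists K; last by exists C.
apply/eqP => K0; move/eqP: bl0; apply.
have : bs l 0 * jw a b 0 = 0.
  apply: (@eq0_of_invS _ _ C) => n.
  have := @coef0_le R a b ba hb n (fun k => bs l k * jw a b k) (C / n.+1%:R).
  apply => y yI; rewrite -/(kpoly n.+1 (bs l)).
  have hh (z : R) : 0 < z < 1 -> `|(kpoly n.+1 (bs l)).[z]| <= C / n.+1%:R.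
    move=> zI; have := main n.+1 z zI; rewrite K0 mul0r subr0 kpolyE => /le_trans; apply.
    by rewrite ler_wpM2l.
  rewrite ler_norml lerNl -hornerN; apply/andP; split.
    apply: (poly_le_closed _ yI) => z zI; rewrite hornerN (le_trans (ler_norm _))// normrN.
    exact: hh.
  by apply: (poly_le_closed _ yI) => z zI; rewrite (le_trans (ler_norm _))// hh.
by move/eqP; rewrite mulf_eq0 (gt_eqF (jw_gt0 ba hb 0)) orbF => /eqP.
Qed.

End Level.

End PowerExpansion.

(** * Lower bound for the kernel away from the origin *)

Section TailLowerBound.
Variables (R : realType) (a b r : R).
Hypotheses (ba : b <= a) (hb : - 2^-1 <= b) (r0 : 0 < r).
Hypothesis r_not_even : forall i : nat, r != 2 * i%:R.
Variable chi : nat -> nat -> R.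
Hypothesis chi_sym : sym 0 chi.
Hypothesis chi_one : forall n k, (0 < n)%N -> (k <= n)%N -> chi n k = 1.
Hypothesis chi_zero : forall n k, (0 < n)%N -> (n.*2 <= k)%N -> chi n k = 0.
Implicit Types (d y : R) (k N l n i j : nat) (m : nat -> R).
Local Notation bs := (bs a b r).
Let tau := a + 1 + r / 2.

Let a_ge : - 2^-1 <= a. Proof. exact: le_trans ba. Qed.

Lemma iter_DopB l m1 m2 k : iter l (Dop a b) (fun k => m1 k - m2 k) k =
  iter l (Dop a b) m1 k - iter l (Dop a b) m2 k.
Proof.
elim: l k => [//|l IH] k /=.
have -> : iter l (Dop a b) (fun k => m1 k - m2 k) =
  (fun k => iter l (Dop a b) m1 k - iter l (Dop a b) m2 k) by apply/funext.
by rewrite /Dop; ring.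
Qed.

(** Multiply by [(2 y)^l]. The untruncated kernel becomes [C1 K y^sigma] by [powers_ksum], while the
    truncation error, carried by frequencies at least [n - l], is [O(n^(-2 sigma))]; the main term
    wins once [n^2 y] is large. *)
Lemma bs_kernel_tail : exists c A : R, [/\ 0 < c, 0 < A & forall n y, (0 < n)%N ->
  0 < y < 1 -> A <= n%:R ^+ 2 * y ->
  c * y `^ (- tau) <= `|ksum a b n.*2 (fun k => chi n k * bs 0 k) y|].
Proof.
have [L hL] := bs_head_neq0 a b r.
pose l := maxn L (Num.truncn (r + 2 * a + 4)).+1.
have ll : r + 2 * a + 4 <= 2 * l%:R.
  have h1 : (Num.truncn (r + 2 * a + 4)).+1%:R <= l%:R :> R by rewrite ler_nat leq_maxr.
  by have := truncnS_gt (r + 2 * a + 4); have := r0; have := a_ge; lra.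
have bl0 : bs l 0 != 0 by apply: hL; rewrite leq_maxl.
have [K K0 [C C0 hK]] := powers_ksum ba hb r0 r_not_even ll bl0.
set sigma := l%:R - (a + 1 + r / 2) in hK.
have sigma0 : 0 < sigma by rewrite /sigma; lra.
pose C1 := \prod_(i < l) (2 * i%:R - r).
have C10 : C1 != 0 by exact: prod_neq0.
pose m n k := (1 - chi n k) * bs 0 k.
have sbs : sym r (fun (_ : unit) k => bs 0 k).
  by have := sym_bs ba hb r0 r_not_even 0; rewrite mulr0 subr0.
have sm : sym r m.
  rewrite -[r]add0r; apply: symM.
    by apply: symB => //; exact: sym_cst.
  exact: (sym_comp (fun=> tt) sbs).
have mlow n k : (k < n)%N -> m n k = 0.
  move=> kn; rewrite /m chi_one ?subrr ?mul0r// ?(ltnW kn)//.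
  exact: leq_ltn_trans kn.
set e := r - 2 * l%:R + 2 * a + 2.
have eE : e = - (2 * sigma) by rewrite /e /sigma; field.
have e0 : e < 0 by rewrite eE; lra.
have [C2 C20 hC2] := ksum_tail ba hb (sym_bnd (sym_iter_Dop ba hb l sm))
  (fun n => iter_Dop_low ba hb (mlow n)) e0.
pose C3 := C2 * l.+1%:R `^ `|e|.
have C30 : 0 <= C3 by rewrite mulr_ge0 ?powR_ge0.
have key n y : (0 < n)%N -> 0 < y < 1 ->
    `|(2 * y) ^+ l * ksum a b n.*2 (fun k => chi n k * bs 0 k) y - C1 * K * y `^ sigma|
      <= C3 * pw n e.
  move=> n0 yI; have yI' : 0 <= y <= 1 by case/andP: yI => h1 h2; rewrite !ltW.
  have chin k : (n.*2 <= k)%N -> chi n k * bs 0 k = 0.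
    by move=> nk; rewrite chi_zero// mul0r.
  rewrite ksum_iter_Dop//.
  apply: (@le_of_invS _ _ _ (`|C1| * C)) => N.
  have h1 := iter_Dop_supp ba hb (l := l) chin.
  rewrite -(ksum_widen a b y (leq_addl N (n.*2 + l)) h1).
  set N' := (N + (n.*2 + l))%N.
  have -> : ksum a b N' (iter l (Dop a b) (fun k => chi n k * bs 0 k)) y =
      C1 * ksum a b N' (bs l) y - ksum a b N' (iter l (Dop a b) (m n)) y.
    rewrite -ksumZ -[X in _ - X]mul1r -mulNr -ksumZ -ksumD; apply: eq_ksum => k _.
    rewrite -iter_Dop_bs// mulN1r -iter_DopB.
    have -> // : (fun k => chi n k * bs 0 k) = (fun k => bs 0 k - m n k).
    by apply/funext => j; rewrite /m; ring.
  have -> : forall x z w : R, C1 * x - z - C1 * K * w = C1 * (x - K * w) - z by move=> *; ring.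
  rewrite (le_trans (ler_normB _ _))// addrC lerD//.
    rewrite (le_trans (hC2 n N' y yI'))// /C3 -mulrA ler_wpM2l//; exact: pw_subn_le.
  rewrite normrM -mulrA ler_wpM2l// (le_trans (hK N' y yI))// ler_wpM2l//.
  by rewrite lef_pV2 ?posrE// ler_nat ltnS leq_addr.
pose kap := `|C1 * K|; have kap0 : 0 < kap by rewrite normr_gt0 mulf_neq0.
(* [B] exceeds [2 C3 / kap] and [A^sigma = B], so the error is at most half of the main term as soon
   as [n^2 y >= A]. *)
pose B := 2 * C3 / kap + 1.
have B0 : 0 < B by rewrite ltr_wpDl// divr_ge0 ?mulr_ge0// ltW.
pose A := B `^ sigma^-1; have A0 : 0 < A by rewrite powR_gt0.
exists (kap / 2 / 2 ^+ l), A; split => //; first by rewrite !divr_gt0 ?exprn_gt0.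
move=> n y n0 yI An; have /andP[y0 y1] := yI.
have n0' : 0 < n%:R :> R by rewrite ltr0n.
have small : C3 * pw n e <= kap / 2 * y `^ sigma.
  have p1 : pw n e <= (n%:R ^+ 2) `^ (- sigma).
    rewrite -powR_mulrn ?(ltW n0')// -powRrM mulrN -eE /pw powR_le_neg ?(ltW e0)//.
    by rewrite ler_nat.
  have p2 : (n%:R ^+ 2) `^ (- sigma) <= (A / y) `^ (- sigma).
    apply: powR_le_neg; [by rewrite divr_gt0| |lra].
    by rewrite ler_pdivrMr.
  have p3 : (A / y) `^ (- sigma) = B^-1 * y `^ sigma.
    rewrite powRM ?(ltW A0) ?invr_ge0 ?(ltW y0)//.
    rewrite -(powR_inv1 (ltW y0)) -powRrM mulN1r opprK; congr (_ * _).
    by rewrite powRN /A -powRrM mulVf ?gt_eqF// powRr1// ltW.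
  have p4 := le_trans p1 p2; rewrite p3 in p4.
  apply: le_trans (ler_wpM2l C30 p4) _; rewrite mulrA ler_wpM2r ?powR_ge0//.
  rewrite ler_pdivrMr// /B mulrDr mulr1.
  have -> : kap / 2 * (2 * C3 / kap) = C3 by field; rewrite gt_eqF.
  by lra.
have := key n y n0 yI; set S := ksum _ _ _ _ _ => h.
have h2 : kap / 2 * y `^ sigma <= (2 * y) ^+ l * `|S|.
  have : `|C1 * K * y `^ sigma| <= `|(2 * y) ^+ l * S| + C3 * pw n e.
    rewrite -[C1 * K * y `^ sigma](subKr ((2 * y) ^+ l * S)) (le_trans (ler_normB _ _))//.
    by rewrite lerD.
  rewrite normrM -/kap (ger0_norm (powR_ge0 _ _)) normrM ger0_norm ?exprn_ge0 ?mulr_ge0 ?(ltW y0)//.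
  by lra.
have y2 : 0 < (2 * y) ^+ l by rewrite exprn_gt0// mulr_gt0.
rewrite -(ler_pM2l y2); apply: le_trans h2.
have -> : y `^ (- tau) = y `^ sigma / y ^+ l.
  rewrite -powR_mulrn ?(ltW y0)// -powRB ?(gt_eqF y0) ?implybT//.
  by congr powR; rewrite /sigma /tau; ring.
rewrite exprMn; have yl : y ^+ l != 0 by rewrite gt_eqF// exprn_gt0.
have tl : 2 ^+ l != 0 :> R by rewrite gt_eqF// exprn_gt0.
move: (y ^+ l) (2 ^+ l) yl tl => u v u0 v0.
by rewrite le_eqVlt; apply/orP; left; apply/eqP; field; rewrite u0 v0.
Qed.

(** Up to the factor [kap] the multiplier differs from [bs 0] by a symbol of lower order. The kernel
    of the difference is smaller than [y^(- tau)] by a positive power of [y], and is absorbed for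
    [y <= delta]. *)
Lemma kernel_tail : exists c A delta : R, [/\ 0 < c, 0 < A, 0 < delta
  & forall n N y, (0 < n)%N -> (n.*2 <= N)%N -> 0 < y <= delta -> A <= n%:R ^+ 2 * y ->
    c * y `^ (- tau) <= `|ksum a b N (fun k => chi n k * eig a b k `^ (r / 2)) y|].
Proof.
have [c [A [c0 A0 hc]]] := bs_kernel_tail.
have [kap kap0 sk] := bs_asymp ba hb r0.
(* Of the whole order gained only [eps] is used: then [r - eps] is nonnegative, which secures the
   condition on the order in [kernel_upper]. *)
pose eps := Num.min r 1; have eps0 : 0 < eps by rewrite lt_min r0 ltr01.
have epsr : eps <= r by rewrite ge_min lexx.
have eps1 : eps <= 1 by rewrite ge_min lexx orbT.
pose m n k := chi n k * (bs 0 k - kap * eig a b k `^ (r / 2)).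
have sm : sym (r - eps) m.
  rewrite -[r - eps]add0r; apply: symM => //.
  have sk' : sym (r - eps) (fun (_ : unit) k => bs 0 k - kap * eig a b k `^ (r / 2)).
    by apply: symW sk; lra.
  exact: (sym_comp (fun=> tt) sk').
have [|C C0 hC] := kernel_upper ba hb chi_sym chi_one chi_zero sm.
  by have := a_ge; lra.
(* The second entry makes [C y^(eps / 2)] at most [c / 2]; the first keeps [y] below 1, where
   [bs_kernel_tail] applies. *)
pose delta := Num.min 2^-1 ((c / (2 * (C + 1))) `^ (2 / eps)).
have q0 : 0 < c / (2 * (C + 1)) by rewrite divr_gt0// mulr_gt0//; lra.
have delta0 : 0 < delta by rewrite lt_min invr_gt0 powR_gt0// andbT.
exists (c / (2 * kap)), A, delta; split => //; first by rewrite divr_gt0// mulr_gt0.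
move=> n N y n0 nN /andP[y0 yd] An.
have y2 : y <= 2^-1 by rewrite (le_trans yd)// ge_min lexx.
have chin m' k : (n.*2 <= k)%N -> chi n k * m' k = 0 by move=> nk; rewrite chi_zero// mul0r.
rewrite (ksum_widen _ _ _ nN (chin _)).
have h1 : c * y `^ (- tau) <= `|ksum a b n.*2 (fun k => chi n k * bs 0 k) y|.
  by apply: hc => //; apply/andP; split => //; lra.
have h2 : `|ksum a b n.*2 (m n) y| <= c / 2 * y `^ (- tau).
  have yI : 0 < y <= 1 by apply/andP; split => //; lra.
  apply: le_trans (hC n n.*2 y yI (chin _)) _.
  have -> : (y `^ (- 2^-1)) `^ (r - eps + 2 * a + 2) = y `^ (eps / 2) * y `^ (- tau).
    by rewrite -powRrM -powRD ?(gt_eqF y0) ?implybT//; congr powR; rewrite /tau; field.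
  rewrite mulrA ler_wpM2r ?powR_ge0//.
  have h3 : y `^ (eps / 2) <= c / (2 * (C + 1)).
    apply: (@le_trans _ _ (((c / (2 * (C + 1))) `^ (2 / eps)) `^ (eps / 2))).
      rewrite ge0_ler_powR ?nnegrE ?powR_ge0 ?(ltW y0)//; first by rewrite divr_ge0// ltW.
      by rewrite (le_trans yd)// ge_min lexx orbT.
    rewrite -powRrM (_ : 2 / eps * (eps / 2) = 1) ?powRr1 ?(ltW q0)//.
    by field; rewrite gt_eqF.
  apply: le_trans (ler_wpM2l C0 h3) _.
  have C1 : 0 < C + 1 by lra.
  rewrite mulrA ler_pdivrMr ?mulr_gt0//.
  have -> : c / 2 * (2 * (C + 1)) = c * (C + 1) by field.
  by rewrite mulrC ler_wpM2l ?(ltW c0)//; lra.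
have E : kap * ksum a b n.*2 (fun k => chi n k * eig a b k `^ (r / 2)) y =
    ksum a b n.*2 (fun k => chi n k * bs 0 k) y - ksum a b n.*2 (m n) y.
  rewrite -ksumZ -[X in _ - X]mul1r -mulNr -ksumZ -ksumD; apply: eq_ksum => k _.
  by rewrite /m; ring.
have h4 : c / 2 * y `^ (- tau) <= kap * `|ksum a b n.*2 (fun k => chi n k * eig a b k `^ (r / 2)) y|.
  rewrite -[X in _ <= X * _](gtr0_norm kap0) -normrM E.
  have := ler_normB (ksum a b n.*2 (fun k => chi n k * bs 0 k) y - ksum a b n.*2 (m n) y)
     (- ksum a b n.*2 (m n) y).
  by rewrite opprK subrK normrN; lra.
rewrite invfM mulrA -[c / 2 / kap * _]mulrAC ler_pdivrMr// [leRHS]mulrC.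
exact: h4.
Qed.

End TailLowerBound.

(** * Weighted integrals *)

Section WeightedIntegrals.
Variable R : realType.
Notation mu := (@lebesgue_measure R).
Implicit Types (f g : R -> R) (t s x y z c : R).

Lemma continuous_abs_powR s : 0 <= s -> continuous (fun x : R => `|x| `^ s).
Proof.
rewrite le_eqVlt => /predU1P[<- x|s0 x].
  by have -> : (fun x : R => `|x| `^ 0) = cst 1; [apply/funext => z; rewrite powRr0|exact: cst_continuous].
have [->|x0] := eqVneq x 0; last first.
  have nx : 0 < `|x| by rewrite normr_gt0.
  apply: (@continuous_comp _ _ _ (fun z : R => `|z|) (fun u => u `^ s) x).
    exact: norm_continuous.
  exact: continuous_powR.
rewrite /prop_for /continuous_at normr0 powR0 ?gt_eqF//; apply/cvgrPdist_le => e e0.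
have h : \forall z \near (0 : R), `|z| <= e `^ s^-1 by apply: nbhs0_le; rewrite powR_gt0.
apply: filterS h => z ze.
rewrite sub0r normrN ger0_norm ?powR_ge0//.
have -> : e = (e `^ s^-1) `^ s by rewrite -powRrM mulVf ?gt_eqF// powRr1// ltW.
by rewrite ge0_ler_powR ?nnegrE ?powR_ge0 ?(ltW s0).
Qed.

Lemma sin_half_le t : 0 <= t -> sin (t / 2) <= t / 2.
Proof.
rewrite le_eqVlt => /predU1P[<-|t0]; first by rewrite mul0r sin0.
have t2 : 0 < t / 2 by rewrite divr_gt0.
have d x : x \in `]0, t / 2[ -> is_derive x 1 (@sin R) (cos x) by move=> _; exact: is_derive_sin.
have [|c _] := MVT t2 d.
  by apply: continuous_subspaceT => x; exact: continuous_sin.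
rewrite sin0 !subr0 => ->; rewrite -[leRHS]mul1r ler_wpM2r ?(ltW t2)//; exact: cos_le1.
Qed.

Lemma cos_ge_sub x : 0 <= x -> 1 - x <= cos x.
Proof.
rewrite le_eqVlt => /predU1P[<-|x0]; first by rewrite cos0 subr0.
have d y : y \in `]0, x[ -> is_derive y 1 (@cos R) (- sin y) by move=> _; exact: is_derive_cos.
have [|c _] := MVT x0 d.
  by apply: continuous_subspaceT => y; exact: continuous_cos.
rewrite cos0 subr0 => E.
have : sin c * x <= 1 * x by rewrite ler_wpM2r ?(ltW x0)// sin_le1.
by lra.
Qed.

Lemma sin_ge_half x : 0 <= x <= 2^-1 -> x / 2 <= sin x.
Proof.
move=> /andP[]; rewrite le_eqVlt => /predU1P[<-|x0 x2]; first by rewrite mul0r sin0.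
have d y : y \in `]0, x[ -> is_derive y 1 (@sin R) (cos y) by move=> _; exact: is_derive_sin.
have [|c cI] := MVT x0 d.
  by apply: continuous_subspaceT => y; exact: continuous_sin.
rewrite sin0 !subr0 => ->; move: cI; rewrite in_itv /= => /andP[c0 cx].
by rewrite mulrC ler_wpM2r ?(ltW x0)//; have := cos_ge_sub (ltW c0); lra.
Qed.

Lemma cos_half_ge t : 0 <= t <= 1 -> 2^-1 <= cos (t / 2).
Proof. by move=> /andP[t0 t1]; have : 1 - t / 2 <= cos (t / 2); [apply: cos_ge_sub|]; lra. Qed.

Lemma pi_le4 : pi <= 4 :> R.
Proof. by have := @pihalf_lt2 R; lra. Qed.

Lemma pi_ge1 : 1 <= pi :> R.
Proof. by have := @pi_ge2 R; lra. Qed.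

(** For [t > 1] monotonicity gives [sin (t / 2) >= sin (1 / 2) >= 1 / 4], and [t <= pi <= 4] turns
    this into [t / 16]; smaller [t] do better. *)
Lemma sin_half_ge t : 0 <= t <= pi -> t / 16 <= sin (t / 2).
Proof.
move=> /andP[t0 tp]; have [t1|t1] := leP t 1.
  have /sin_ge_half : 0 <= t / 2 <= 2^-1 by apply/andP; split; lra.
  by lra.
have h : 2^-1 / 2 <= sin (2^-1) :> R.
  by apply: sin_ge_half; apply/andP; split; lra.
have : sin (2^-1) <= sin (t / 2).
  have p1 := pi_ge1.
  have h1 : 2^-1 \in `[- (pi / 2), pi / 2 : R] by rewrite in_itv /=; apply/andP; split; lra.
  have h2 : t / 2 \in `[- (pi / 2), pi / 2 : R] by rewrite in_itv /=; apply/andP; split; lra.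
  by apply: ltW; rewrite ltr_sin//; lra.
by have := pi_le4; lra.
Qed.

Lemma Rint_split f x y z : x <= y -> y <= z ->
  (forall t, x <= t <= z -> {for t, continuous f}) ->
  \int[mu]_(t in `[x, z]) f t = \int[mu]_(t in `[x, y]) f t + \int[mu]_(t in `[y, z]) f t.
Proof.
move=> xy yz cf; have iz := itv_integrable cf.
have := @Rintegral_itvB R f (BLeft x) (BRight z) y iz.
rewrite !bnd_simp => /(_ xy yz) h.
rewrite -(@Rintegral_itv_obnd_cbnd _ y); first by rewrite -h addrC subrK.
by apply: integrableS iz => //; apply: subset_itv; rewrite bnd_simp.
Qed.

Lemma Rint_sub f x x' y' y : x <= x' -> x' <= y' -> y' <= y ->
  (forall t, x <= t <= y -> {for t, continuous f}) ->
  (forall t, x <= t <= y -> 0 <= f t) ->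
  \int[mu]_(t in `[x', y']) f t <= \int[mu]_(t in `[x, y]) f t.
Proof.
move=> xx xy yy cf f0.
rewrite (@Rint_split f x x' y)//; last exact: le_trans yy.
rewrite (@Rint_split f x' y' y)//; last first.
  by move=> t /andP[h1 h2]; apply: cf; rewrite h2 (le_trans xx).
rewrite addrA -[leLHS]add0r -[leLHS]addr0 !lerD//.
  apply: Rintegral_ge0 => t; rewrite /= in_itv /= => /andP[h1 h2]; apply: f0.
  by rewrite h1 (le_trans h2)// (le_trans xy).
apply: Rintegral_ge0 => t; rewrite /= in_itv /= => /andP[h1 h2]; apply: f0.
by rewrite h2 andbT (le_trans xx)// (le_trans xy).
Qed.

End WeightedIntegrals.

Section JacobiWeight.
Variable R : realType.
Notation mu := (@lebesgue_measure R).
Variables (a b p : R).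
Hypotheses (ba : b <= a) (hb : - 2^-1 <= b) (p0 : 0 < p).
Implicit Types (f : R -> R) (t x y K M q : R).

(** The absolute values make the weight continuous on the whole line, since the integration lemmas
    ask for two-sided continuity at the end points; on [[0, pi]] they change nothing. *)
Definition jweight t := `|sin (t / 2)| `^ (2 * a + 1) * `|cos (t / 2)| `^ (2 * b + 1).

Definition wint f := \int[mu]_(t in `[0, pi]) (`|f t| `^ p * jweight t).

Let a0 : 0 <= 2 * a + 1. Proof. by move: ba hb; lra. Qed.
Let b0 : 0 <= 2 * b + 1. Proof. by move: ba hb; lra. Qed.

Lemma sin_half_ge0 t : 0 <= t <= pi -> 0 <= sin (t / 2).
Proof. by move=> tp; have := sin_half_ge tp; lra. Qed.

Lemma cos_half_ge0 t : 0 <= t <= pi -> 0 <= cos (t / 2).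
Proof.
by move=> /andP[t0 tp]; apply: cos_ge0_pihalf; have := @pi_gt0 R; rewrite ?in_itv/=; move=> ?; apply/andP; split; lra.
Qed.

Lemma jacobi_norm_wint (g : R -> R) :
  jacobi_norm a b p g = wint (fun t => g (cos t)) `^ p^-1.
Proof.
rewrite /jacobi_norm /wint; congr (_ `^ _); apply: eq_Rintegral => t.
rewrite inE /= in_itv /= => tp.
by rewrite /jweight mulrA (ger0_norm (sin_half_ge0 tp)) (ger0_norm (cos_half_ge0 tp)).
Qed.

Lemma jweight_ge0 t : 0 <= jweight t.
Proof. by rewrite /jweight; apply: mulr_ge0; exact: powR_ge0. Qed.

Lemma continuous_half t : {for t, continuous (fun t : R => t / 2)}.
Proof. exact: mulrr_continuous. Qed.

Lemma continuous_jweight t : {for t, continuous jweight}.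
Proof.
apply: continuousM.
  apply: (@continuous_comp _ _ _ (fun t : R => sin (t / 2)) (fun x => `|x| `^ _)).
    apply: (@continuous_comp _ _ _ (fun t : R => t / 2) sin).
      exact: continuous_half.
    exact: continuous_sin.
  exact: continuous_abs_powR.
apply: (@continuous_comp _ _ _ (fun t : R => cos (t / 2)) (fun x => `|x| `^ _)).
  apply: (@continuous_comp _ _ _ (fun t : R => t / 2) cos).
    exact: continuous_half.
  exact: continuous_cos.
exact: continuous_abs_powR.
Qed.

Lemma continuous_wintegrand f : continuous f ->
  forall t, {for t, continuous (fun t => `|f t| `^ p * jweight t)}.
Proof.
move=> cf t; apply: continuousM; last exact: continuous_jweight.
apply: (@continuous_comp _ _ _ f (fun x => `|x| `^ p)); first exact: cf.
by apply: continuous_abs_powR; exact: ltW.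
Qed.

Lemma wintegrand_ge0 f t : 0 <= `|f t| `^ p * jweight t.
Proof. by rewrite mulr_ge0 ?powR_ge0 ?jweight_ge0. Qed.

Lemma jweight_le t : 0 <= t <= pi -> jweight t <= t `^ (2 * a + 1).
Proof.
move=> tp; have /andP[t0 _] := tp.
rewrite /jweight -[leRHS]mulr1; apply: ler_pM; rewrite ?powR_ge0//.
  rewrite ge0_ler_powR ?nnegrE// ger0_norm ?sin_half_ge0//.
  by have := sin_half_le t0; lra.
apply: (@le_trans _ _ (1 `^ (2 * b + 1))); last by rewrite powR1.
rewrite ge0_ler_powR ?nnegrE ?normr_ge0//.
by rewrite ger0_norm ?cos_half_ge0// cos_le1.
Qed.

Definition jwc : R := 16^-1 `^ (2 * a + 1) * 2^-1 `^ (2 * b + 1).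

Lemma jwc_gt0 : 0 < jwc.
Proof. by rewrite mulr_gt0 ?powR_gt0 ?invr_gt0. Qed.

Lemma jweight_ge t : 0 <= t <= 1 -> jwc * t `^ (2 * a + 1) <= jweight t.
Proof.
move=> t01; have /andP[t0 t1] := t01.
have tp : 0 <= t <= pi by rewrite t0 (le_trans t1)// pi_ge1.
rewrite /jweight /jwc mulrAC -powRM ?invr_ge0//; apply: ler_pM; rewrite ?powR_ge0//.
  rewrite ge0_ler_powR ?nnegrE ?normr_ge0 ?mulr_ge0 ?invr_ge0// ger0_norm ?sin_half_ge0//.
  by rewrite mulrC sin_half_ge.
rewrite ge0_ler_powR ?nnegrE ?normr_ge0 ?invr_ge0// ger0_norm ?cos_half_ge0//.
exact: cos_half_ge.
Qed.

Lemma Rint_powR x y q : 0 < x -> x < y -> q != 0 ->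
  \int[mu]_(t in `[x, y]) t `^ (q - 1) = (y `^ q - x `^ q) / q.
Proof.
move=> x0 xy q0.
have D t : x <= t <= y -> is_derive t 1 (fun t => q^-1 * t `^ q) (t `^ (q - 1)).
  move=> /andP[xt _]; have h := is_deriveZ q^-1 (is_derive1_powR q (lt_le_trans x0 xt)).
  by apply: trigger_derive h _; rewrite /GRing.scale /= mulrA mulVf// mul1r.
rewrite (Rint_FTC xy D); first by rewrite mulrBl !(mulrC q^-1).
by move=> t /andP[xt _]; apply: continuous_powR; exact: lt_le_trans xt.
Qed.

Lemma Rint_inv x y : 0 < x -> x < y ->
  \int[mu]_(t in `[x, y]) t `^ (0 - 1) = ln y - ln x.
Proof.
move=> x0 xy.
have D t : x <= t <= y -> is_derive t 1 (@ln R) (t `^ (0 - 1)).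
  move=> /andP[xt _]; have h := is_derive1_ln (lt_le_trans x0 xt).
  by apply: trigger_derive h _; rewrite sub0r powR_inv1// (le_trans (ltW x0)).
rewrite (Rint_FTC xy D)//.
by move=> t /andP[xt _]; apply: continuous_powR; exact: lt_le_trans xt.
Qed.

Lemma wint_upper f x M K q : continuous f -> 0 < x < pi -> 0 <= M -> 0 <= K ->
  (forall t, 0 <= t <= x -> `|f t| <= M) ->
  (forall t, x <= t <= pi -> `|f t| <= K * t `^ (- q)) ->
  wint f <= M `^ p * x `^ (2 * a + 2) +
    K `^ p * \int[mu]_(t in `[x, pi]) t `^ (2 * a + 2 - q * p - 1).
Proof.
move=> cf /andP[x0 xp] M0 K0 hM hK; have cF := continuous_wintegrand cf.
rewrite /wint (@Rint_split _ _ 0 x pi) ?(ltW x0) ?(ltW xp)//.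
apply: lerD.
  apply: (@le_trans _ _ (\int[mu]_(t in `[0, x]) (M `^ p * x `^ (2 * a + 1)))).
    apply: le_Rint_itv => [t _|t _|t tx]; [exact: cF|exact: cst_continuous|].
    have /andP[t0 tx'] := tx.
    apply: ler_pM; rewrite ?powR_ge0 ?jweight_ge0//.
      by rewrite ge0_ler_powR ?nnegrE ?normr_ge0 ?(ltW p0)// hM.
    apply: (le_trans (jweight_le _)); first by rewrite t0 (le_trans tx' (ltW xp)).
    by rewrite ge0_ler_powR ?nnegrE// ltW.
  rewrite Rint_cst_itv ?(ltW x0)// subr0 -mulrA -[X in _ * (_ * X)](powRr1 (ltW x0)).
  rewrite -powRD ?(gt_eqF x0) ?implybT//.
  by have -> : 2 * a + 1 + 1 = 2 * a + 2 by ring.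
have cI t : x <= t <= pi -> {for t, continuous (fun t => t `^ (2 * a + 2 - q * p - 1))}.
  by move=> /andP[xt _]; apply: continuous_powR; exact: lt_le_trans xt.
rewrite -RintegralZl//; last exact: itv_integrable.
apply: le_Rint_itv => [t _|t tI|t tI]; [exact: cF| |].
  by apply: continuousM; [exact: cst_continuous|exact: cI].
have /andP[xt tp] := tI; have t0 := lt_le_trans x0 xt.
have -> : 2 * a + 2 - q * p - 1 = - q * p + (2 * a + 1) by ring.
rewrite powRD ?(gt_eqF t0) ?implybT// powRrM mulrA -powRM ?powR_ge0//.
apply: ler_pM; rewrite ?powR_ge0 ?jweight_ge0//.
  by rewrite ge0_ler_powR ?nnegrE ?normr_ge0 ?(ltW p0) ?mulr_ge0 ?powR_ge0 ?hK.
by apply: jweight_le; rewrite (ltW t0).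
Qed.

Lemma wint_lower f x y K q : continuous f -> 0 < x <= y -> y <= 1 -> 0 <= K ->
  (forall t, x <= t <= y -> K * t `^ (- q) <= `|f t|) ->
  jwc * (K `^ p * \int[mu]_(t in `[x, y]) t `^ (2 * a + 2 - q * p - 1)) <= wint f.
Proof.
move=> cf /andP[x0 xy] y1 K0 hK; have cF := continuous_wintegrand cf.
apply: (@le_trans _ _ (\int[mu]_(t in `[x, y]) (`|f t| `^ p * jweight t))); last first.
  apply: Rint_sub => //; first exact: ltW.
    by rewrite (le_trans y1)// pi_ge1.
  by move=> t _; exact: wintegrand_ge0.
have cI t : x <= t <= y -> {for t, continuous (fun t => t `^ (2 * a + 2 - q * p - 1))}.
  by move=> /andP[xt _]; apply: continuous_powR; exact: lt_le_trans xt.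
rewrite mulrA -RintegralZl//; last exact: itv_integrable.
apply: le_Rint_itv => [t tI|t _|t tI]; [|exact: cF|].
  by apply: continuousM; [exact: cst_continuous|exact: cI].
have /andP[xt ty] := tI; have t0 := lt_le_trans x0 xt.
have -> : 2 * a + 2 - q * p - 1 = - q * p + (2 * a + 1) by ring.
rewrite powRD ?(gt_eqF t0) ?implybT// powRrM [jwc * _]mulrC mulrACA -powRM ?powR_ge0//.
apply: ler_pM; rewrite ?powR_ge0//; first by rewrite mulr_ge0 ?powR_ge0 ?(ltW jwc_gt0).
  by rewrite ge0_ler_powR ?nnegrE ?normr_ge0 ?(ltW p0) ?mulr_ge0 ?powR_ge0 ?hK.
by apply: jweight_ge; rewrite (ltW t0) (le_trans ty).
Qed.

End JacobiWeight.

(** * Growth in [n] of the weighted integrals *)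

Section WintAsymptotics.
Variable R : realType.
Notation mu := (@lebesgue_measure R).
Variables (a b p : R).
Hypotheses (ba : b <= a) (hb : - 2^-1 <= b) (p0 : 0 < p).
Variables (f : nat -> R -> R) (Q : R).
Hypothesis cf : forall n, continuous (f n).
Implicit Types (t x y K M q c C : R).

Let d := 2 * a + 2.
Let d0 : 1 <= d. Proof. by move: ba hb; rewrite /d; lra. Qed.

Lemma powR_div (x y s : R) : 0 <= x -> 0 < y -> (x / y) `^ s = x `^ s * y `^ (- s).
Proof.
by move=> x0 y0; rewrite powRM ?invr_ge0 ?(ltW y0)// -(powR_inv1 (ltW y0)) -powRrM mulN1r.
Qed.

Lemma powR_invl (x s : R) : 0 < x -> x^-1 `^ s = x `^ (- s).
Proof. by move=> x0; rewrite -[x^-1]mul1r powR_div// powR1 mul1r. Qed.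

Lemma powR_natD (n : nat) (s t : R) : (0 < n)%N -> n%:R `^ (s + t) = n%:R `^ s * n%:R `^ t :> R.
Proof. by move=> n0; rewrite powRD// pnatr_eq0 -lt0n n0 implybT. Qed.

Section Upper.
(** Two choices of [q] occur: [q = Q] for the singular kernels, whose tail bound is free of [n], and
    a large [q] for the rapidly decaying kernel with [r = 0]. *)
Variables (C q : R).
Hypotheses (C0 : 0 <= C).
Hypothesis f_le : forall n t, (0 < n)%N -> 0 <= t <= pi -> `|f n t| <= C * n%:R `^ Q.
Hypothesis f_decay : forall n t, (0 < n)%N -> 0 < t <= pi ->
  `|f n t| <= C * n%:R `^ (Q - q) * t `^ (- q).

Let inv_itv n : (0 < n)%N -> 0 < (n%:R^-1 : R) < pi.
Proof.
move=> n0; rewrite invr_gt0 ltr0n n0 /=; apply: (@le_lt_trans _ _ 1).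
  by rewrite invf_le1 ?ler1n ?ltr0n.
by have := @pi_ge2 R; lra.
Qed.

(** The split point is [1 / n], where both bounds on [f n] have the size [n^Q]. *)
Lemma wint_upper_nat n : (0 < n)%N -> wint a b p (f n) <= C `^ p * (n%:R `^ (Q * p - d) +
  n%:R `^ ((Q - q) * p) * \int[mu]_(t in `[n%:R^-1, pi]) t `^ (d - q * p - 1)).
Proof.
move=> n0; have nI := inv_itv n0; have /andP[i0 ip] := nI.
have n0' : 0 < n%:R :> R by rewrite ltr0n.
have M0 s : 0 <= C * n%:R `^ s by rewrite mulr_ge0 ?powR_ge0.
have h1 t : 0 <= t <= n%:R^-1 -> `|f n t| <= C * n%:R `^ Q.
  by move=> /andP[t0 ti]; apply: f_le; rewrite ?t0 ?(le_trans ti (ltW ip)).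
have h2 t : n%:R^-1 <= t <= pi -> `|f n t| <= C * n%:R `^ (Q - q) * t `^ (- q).
  by move=> /andP[ti tp]; apply: f_decay; rewrite ?tp ?(lt_le_trans i0 ti).
have h := wint_upper ba hb p0 (@cf n) nI (M0 _) (M0 _) h1 h2.
apply: (le_trans h).
rewrite -/d !powRM ?powR_ge0// -!powRrM mulrDr !mulrA; apply: lerD => //.
by rewrite -mulrA powR_invl ?ltr0n// -powR_natD.
Qed.

Lemma wint_upper_gt : d < q * p ->
  exists2 c, 0 <= c & forall n, (0 < n)%N -> wint a b p (f n) <= c * n%:R `^ (Q * p - d).
Proof.
move=> dq; have e0 : 0 < q * p - d by rewrite subr_gt0.
exists (C `^ p * (1 + (q * p - d)^-1)); first by rewrite mulr_ge0 ?powR_ge0 ?addr_ge0 ?invr_ge0 ?(ltW e0).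
move=> n n0; apply: (le_trans (wint_upper_nat n0)); have /andP[i0 ip] := inv_itv n0.
rewrite -mulrA ler_wpM2l ?powR_ge0// [leRHS]mulrDl mul1r lerD2l.
rewrite Rint_powR//; last by rewrite lt_eqF// subr_lt0.
rewrite -[d - q * p]opprB invrN mulrN -mulNr [- (_ `^ _ - _)]opprB powR_invl ?ltr0n// opprK.
have -> : Q * p - d = (Q - q) * p + (q * p - d) by ring.
rewrite (powR_natD ((Q - q) * p) (q * p - d) n0) [leRHS]mulrCA ler_wpM2l ?powR_ge0//.
by rewrite [leRHS]mulrC ler_wpM2r ?invr_ge0 ?(ltW e0)// gerBl powR_ge0.
Qed.

Lemma wint_upper_lt : q = Q -> q * p < d ->
  exists2 c, 0 <= c & forall n, (0 < n)%N -> wint a b p (f n) <= c.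
Proof.
move=> qQ qd; have e0 : 0 < d - q * p by rewrite subr_gt0.
exists (C `^ p * (1 + pi `^ (d - q * p) / (d - q * p))).
  by rewrite mulr_ge0 ?powR_ge0 ?addr_ge0 ?mulr_ge0 ?powR_ge0 ?invr_ge0 ?(ltW e0).
move=> n n0; apply: (le_trans (wint_upper_nat n0)); have /andP[i0 ip] := inv_itv n0.
rewrite ler_wpM2l ?powR_ge0// qQ subrr mul0r powRr0 mul1r; apply: lerD.
  rewrite -[leRHS](powRr0 n%:R) ler_powR ?ler1n// -qQ.
  by move: e0; lra.
rewrite -qQ Rint_powR ?gt_eqF// ler_wpM2r ?invr_ge0 ?(ltW e0)// gerBl powR_ge0//.
Qed.

Lemma wint_upper_eq : q = Q -> q * p = d ->
  exists2 c, 0 <= c & forall n, (1 < n)%N -> wint a b p (f n) <= c * ln n%:R.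
Proof.
move=> qQ qd; have l2 : 0 < ln 2 :> R by rewrite ln_gt0// ltr1n.
(* For [n >= 2] the constant term is at most [ln n / ln 2], and [ln pi <= 2 ln 2] gives
   [ln pi + ln n <= 3 ln n]. *)
exists (C `^ p * ((ln 2)^-1 + 3)).
  by rewrite mulr_ge0 ?powR_ge0 ?addr_ge0 ?invr_ge0 ?(ltW l2).
move=> n n1; have n0 := ltnW n1; apply: (le_trans (wint_upper_nat n0)).
have /andP[i0 ip] := inv_itv n0.
have ln2 : ln 2 <= ln n%:R :> R by rewrite ler_ln ?posrE ?ltr0n// ler_nat.
rewrite -mulrA ler_wpM2l ?powR_ge0// -qQ qd !subrr mul0r !powRr0 mul1r.
rewrite Rint_inv// lnV ?posrE ?ltr0n// opprK mulrDl; apply: lerD.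
  by rewrite ler_pdivlMl// mulr1.
have : ln pi <= ln (2 * 2) :> R.
  by rewrite ler_ln ?posrE ?pi_gt0//; have := @pi_le4 R; lra.
by rewrite lnM ?posrE//; lra.
Qed.

End Upper.

Section Lower.
Variables (c kap : R).
Hypotheses (c0 : 0 < c) (kap0 : 0 < kap) (kap1 : kap <= 1).
Hypothesis f_ge : forall n t, (0 < n)%N -> 0 <= t <= kap / n%:R -> c * n%:R `^ Q <= `|f n t|.

(** Integrating over [[kap / (2 n), kap / n]] only keeps the power primitive away from its singular
    base point 0 and costs no more than a constant. *)
Lemma wint_near0 : exists2 C, 0 < C &
  forall n, (0 < n)%N -> C * n%:R `^ (Q * p - d) <= wint a b p (f n).
Proof.
have dd : 0 < d by move: d0; lra.
pose E := (kap `^ d - (kap / 2) `^ d) / d.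
have E0 : 0 < E.
  have k2 : kap / 2 < kap by move: kap0; lra.
  by rewrite divr_gt0// subr_gt0 gt0_ltr_powR ?nnegrE ?divr_ge0 ?(ltW kap0).
exists (jwc a b * (c `^ p * E)); first by rewrite (mulr_gt0 (jwc_gt0 a b))// mulr_gt0 ?powR_gt0.
move=> n n0; have n0' : 0 < n%:R :> R by rewrite ltr0n.
have x0 : 0 < kap / 2 / n%:R by rewrite !divr_gt0.
have xy : kap / 2 / n%:R < kap / n%:R by rewrite ltr_pM2r ?invr_gt0//; move: kap0; lra.
have y1 : kap / n%:R <= 1 by rewrite ler_pdivrMr// mul1r (le_trans kap1)// ler1n.
apply: le_trans (@wint_lower R a b p ba hb p0 (f n) (kap / 2 / n%:R) (kap / n%:R)
  (c * n%:R `^ Q) 0 (@cf n) _ y1 _ _).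
- rewrite mul0r subr0 -/d Rint_powR// ?gt_eqF// [(kap / 2 / _) `^ _]powR_div ?divr_ge0 ?(ltW kap0)// [(kap / n%:R) `^ _]powR_div ?(ltW kap0)//.
  rewrite -mulrBl -mulrA (ler_pM2l (jwc_gt0 a b)) powRM ?(ltW c0) ?powR_ge0// -powRrM powR_natD//.
  by rewrite le_eqVlt; apply/orP; left; apply/eqP; rewrite /E; ring.
- by rewrite x0 ltW.
- by rewrite mulr_ge0 ?powR_ge0 ?(ltW c0).
- move=> t /andP[t1 t2]; rewrite oppr0 powRr0 mulr1; apply: f_ge => //.
  by rewrite t2 andbT (le_trans (ltW x0)).
Qed.

Variables (c2 A del : R).
Hypotheses (c20 : 0 < c2) (A0 : 0 < A) (del0 : 0 < del) (del1 : del <= 1).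
Hypothesis f_tail : forall n t, (0 < n)%N -> 0 < t <= del -> A <= n%:R * t ->
  c2 * t `^ (- Q) <= `|f n t|.

Lemma wint_tail_lt : Q * p < d ->
  exists2 C, 0 < C & forall n, (0 < n)%N -> C <= wint a b p (f n).
Proof.
move=> Qd; have e0 : 0 < d - Q * p by rewrite subr_gt0.
have [C1 C10 hC1] := wint_near0.
pose x := del / 2; have x0 : 0 < x by rewrite /x divr_gt0.
have xd : x < del by rewrite /x; move: del0; lra.
(* Beyond [M] the tail estimate covers all of [[del / 2, del]]; the finitely many smaller [n] are
   handled by the bound near 0. *)
pose M := 1 + A / x.
have M0 : 0 < M by rewrite addr_gt0 ?divr_gt0.
pose C2 := jwc a b * (c2 `^ p * \int[mu]_(t in `[x, del]) t `^ (2 * a + 2 - Q * p - 1)).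
have C20 : 0 < C2.
  rewrite mulr_gt0 ?jwc_gt0// mulr_gt0 ?powR_gt0// -/d Rint_powR ?gt_eqF//.
  by rewrite divr_gt0// subr_gt0 gt0_ltr_powR ?nnegrE ?(ltW del0) ?(ltW x0).
exists (Num.min C2 (C1 * M `^ (Q * p - d))); first by rewrite lt_min C20 mulr_gt0 ?powR_gt0.
move=> n n0; have n0' : 0 < n%:R :> R by rewrite ltr0n.
rewrite ge_min; have [nM|nM] := leP n%:R M.
  apply/orP; right; apply: le_trans (hC1 n n0); rewrite (ler_pM2l C10).
  by apply: powR_le_neg => //; move: e0; lra.
apply/orP; left; apply: (@wint_lower R a b p ba hb p0 (f n) x del c2 Q (@cf n)) => //.
- by rewrite x0 ltW.
- exact: ltW.
move=> t /andP[xt td]; apply: f_tail => //; first by rewrite td (lt_le_trans x0 xt).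
apply: (@le_trans _ _ (n%:R * x)); last by rewrite ler_pM2l.
by rewrite -ler_pdivrMr//; apply: le_trans (ltW nM); rewrite /M lerDr.
Qed.

Lemma wint_tail_eq : Q * p = d ->
  exists2 C, 0 < C & forall n, (1 < n)%N -> C * ln n%:R <= wint a b p (f n).
Proof.
move=> Qd; have [C1 C10 hC1] := wint_near0.
(* For [n > (A / del)^2] the integral of [1 / t] from [A / n] to [del], that is
   [ln n - ln (A / del)], is at least half of [ln n]. The summand 2 makes [ln M] positive for the
   division in the range [n <= M]. *)
pose M := 2 + (A / del) ^+ 2.
have M1 : 1 < M by rewrite /M; have := sqr_ge0 (A / del); lra.
have lM : 0 < ln M by rewrite ln_gt0.
pose C2 := jwc a b * (c2 `^ p * 2^-1).
have C20 : 0 < C2 by rewrite /C2 mulr_gt0 ?jwc_gt0// mulr_gt0 ?powR_gt0.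
exists (Num.min C2 (C1 / ln M)); first by rewrite lt_min C20 divr_gt0.
move=> n n1; have n0 := ltnW n1; have n0' : 0 < n%:R :> R by rewrite ltr0n.
have ln0 : 0 < ln n%:R :> R by rewrite ln_gt0// ltr1n.
have [nM|nM] := leP n%:R M.
  apply: le_trans (hC1 n n0); rewrite Qd subrr powRr0 mulr1.
  apply: (@le_trans _ _ (C1 / ln M * ln n%:R)).
    by rewrite (ler_pM2r ln0) ge_min lexx orbT.
  rewrite mulrAC ler_pdivrMr// (ler_pM2l C10) ler_ln ?posrE//.
  exact: lt_trans M1.
apply: (@le_trans _ _ (C2 * ln n%:R)); first by rewrite (ler_pM2r ln0) ge_min lexx.
have Ad0 : 0 < A / del by rewrite divr_gt0.
have Ad : (A / del) ^+ 2 < n%:R by apply: lt_trans nM; rewrite /M ltrDr.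
have x0 : 0 < A / n%:R by rewrite divr_gt0.
have lnAd : 2 * ln (A / del) <= ln n%:R.
  have -> : 2 * ln (A / del) = ln ((A / del) ^+ 2) by rewrite lnXn// mulr_natl.
  by rewrite ler_ln ?posrE ?exprn_gt0// ltW.
have xd : A / n%:R < del.
  have An : A / del < n%:R.
    have [h|h] := leP (A / del) 1.
      by apply: (le_lt_trans h); rewrite ltr1n.
    by apply: le_lt_trans Ad; rewrite expr2 ler_peMl// ltW.
  by rewrite ltr_pdivrMr// mulrC -ltr_pdivrMr.
apply: le_trans (@wint_lower R a b p ba hb p0 (f n) (A / n%:R) del c2 Q (@cf n) _ del1 _ _).
- rewrite /C2 -(mulrA (jwc a b)) (ler_pM2l (jwc_gt0 a b)) -(mulrA (c2 `^ p)) (ler_pM2l (powR_gt0 p c20)) -/d Qd.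
  rewrite subrr Rint_inv// lnM ?posrE ?invr_gt0// lnV ?posrE//.
  by move: lnAd; rewrite lnM ?posrE ?invr_gt0// lnV ?posrE//; lra.
- by rewrite x0 ltW.
- exact: ltW.
move=> t /andP[xt td]; apply: f_tail => //; first by rewrite td (lt_le_trans x0 xt).
by rewrite mulrC -ler_pdivrMr.
Qed.

End Lower.
End WintAsymptotics.

(** * The kernels of the theorem as functions of the angle *)

Section JacobiKernel.
Variable R : realType.
Variables (eta : R -> R) (a b : R).
Hypotheses (eta_smooth : smooth eta) (eta_ge0 : forall x : R, 0 <= eta x).
Hypotheses (eta_eq1 : forall x : R, `|x| <= 1 -> eta x = 1)
  (eta_eq0 : forall x : R, 2 <= `|x| -> eta x = 0).
Hypotheses (ba : b <= a) (hb : - 2^-1 <= b).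
Implicit Types (n k : nat) (r t y : R).

Definition jkernel r n t : R :=
  ksum a b n.*2 (fun k => eta (k%:R / n%:R) * eig a b k `^ (r / 2)) ((1 - cos t) / 2).

Local Notation Q r := (r + 2 * a + 2).

(** The cutoff vanishes from [2 n] on, so the partial sums of the series are eventually constant. *)
Lemma jacobiG_jkernel r n t : (0 < n)%N -> jacobiG eta a b n r (cos t) = jkernel r n t.
Proof.
move=> n0; rewrite /jacobiG; apply: lim_near_cst => //.
exists n.*2 => // N /= nN; rewrite /series /= /jkernel big_mkord.
rewrite -(ksum_widen a b _ nN) => [|k nk]; last by rewrite (cutoff_zero eta_eq0)// mul0r.
apply: eq_bigr => k _; rewrite jacobiE_hpoly// /eig !addrA mulrA.
by rewrite -[k%:R + a + b + 1]addrA.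
Qed.

Lemma continuous_jkernel r n : continuous (jkernel r n).
Proof.
pose P := \sum_(k < n.*2) (eta (k%:R / n%:R) * eig a b k `^ (r / 2) * jw a b k) *: hpoly a b k.
have -> : jkernel r n = fun t => P.[(1 - cos t) * 2^-1].
  apply/funext => t; rewrite /jkernel /ksum /P horner_sum.
  by apply: eq_bigr => k _; rewrite hornerZ.
move=> t; apply: (@continuous_comp _ _ _ (fun t : R => (1 - cos t) * 2^-1) (horner P)).
  apply: continuousM; last exact: cst_continuous.
  by apply: continuousB; [exact: cst_continuous|exact: continuous_cos].
exact: continuous_horner.
Qed.

Lemma half_versine t : (1 - cos t) / 2 = sin (t / 2) ^+ 2.
Proof.
rewrite {1}(_ : t = t / 2 + t / 2); last by lra.
by rewrite cosD -!expr2 cos2sin2; field.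
Qed.

Lemma half_versine_bounds t : 0 <= t <= pi ->
  (t / 16) ^+ 2 <= (1 - cos t) / 2 <= (t / 2) ^+ 2.
Proof.
move=> tp; have /andP[t0 _] := tp; rewrite half_versine.
by rewrite !lerXn2r ?nnegrE ?divr_ge0 ?sin_half_ge ?sin_half_le ?sin_half_ge0.
Qed.

Lemma half_versine_itv t : 0 <= (1 - cos t) / 2 <= 1.
Proof. by have := cos_le1 t; have := cos_geN1 t; move=> *; apply/andP; split; lra. Qed.

Let la0 : 0 <= a + b + 1. Proof. by move: ba hb; lra. Qed.
Let d0 r : 0 <= r -> 0 <= r + 2 * a + 1. Proof. by move: ba hb; lra. Qed.

Lemma sym_jkernel r :
  sym r (fun n k => eta (k%:R / n%:R) * eig a b k `^ (r / 2)).
Proof.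
have := symM (sym_cutoff eta_smooth eta_eq0) (sym_comp (fun=> tt) (sym_eig r ba hb)).
by rewrite add0r.
Qed.

Lemma jkernel_le r : 0 <= r -> exists2 C, 0 <= C &
  forall n t, (0 < n)%N -> `|jkernel r n t| <= C * n%:R `^ Q r.
Proof.
move=> r0; have [C C0 hC] := ksum_head ba hb (sym_bnd (sym_jkernel r)) (d0 r0).
exists (C * 2 `^ Q r); first by rewrite mulr_ge0 ?powR_ge0.
move=> n t n0; apply: (le_trans (hC n n.*2 _ (half_versine_itv t))).
by rewrite -mulrA -powRM// -natrM mul2n.
Qed.

Lemma jkernel_decay r : 0 <= r -> exists2 C, 0 <= C &
  forall n t, (0 < n)%N -> 0 < t <= pi -> `|jkernel r n t| <= C * t `^ (- Q r).
Proof.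
move=> r0.
have c1 n k := @cutoff_one _ _ eta_eq1 n k; have c0 n k := @cutoff_zero _ _ eta_eq0 n k.
have [C C0 hC] := kernel_upper ba hb (sym_cutoff eta_smooth eta_eq0) c1 c0 (sym_jkernel r) (d0 r0).
have Q0 : 0 <= Q r by have := d0 r0; lra.
exists (C * 16 `^ Q r); first by rewrite mulr_ge0 ?powR_ge0.
move=> n t n0 /andP[t0 tp]; have tI : 0 <= t <= pi by rewrite ltW.
have /andP[h1 _] := half_versine_bounds tI.
have t16 : 0 < t / 16 by rewrite divr_gt0.
have y0 : 0 < (1 - cos t) / 2 by apply: lt_le_trans h1; rewrite exprn_gt0.
have yI : 0 < (1 - cos t) / 2 <= 1 by rewrite y0; case/andP: (half_versine_itv t).
apply: (le_trans (hC n n.*2 _ yI _)).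
  by move=> k nk; rewrite (cutoff_zero eta_eq0)// mul0r.
rewrite -mulrA ler_wpM2l// -powR_invl// -powRM ?invr_ge0 ?(ltW t0)//.
rewrite ge0_ler_powR ?nnegrE ?mulr_ge0 ?invr_ge0 ?powR_ge0 ?(ltW t0)//.
apply: (@le_trans _ _ (((t / 16) ^+ 2) `^ (- 2^-1))).
  by apply: powR_le_neg; rewrite ?exprn_gt0// oppr_le0 invr_ge0.
rewrite -powR_mulrn ?(ltW t16)// -powRrM mulrN divff ?pnatr_eq0// powR_inv1 ?(ltW t16)//.
by rewrite invf_div mulrC.
Qed.

Lemma jkernel0_decay (l : nat) : 2 * a + 2 < 2 * l.+1%:R -> exists2 C, 0 <= C &
  forall n t, (0 < n)%N -> 0 < t <= pi ->
    `|jkernel 0 n t| <= C * n%:R `^ (Q 0 - 2 * l.+1%:R) * t `^ (- (2 * l.+1%:R)).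
Proof.
move=> dl.
have c1 n k := @cutoff_one _ _ eta_eq1 n k; have c0 n k := @cutoff_zero _ _ eta_eq0 n k.
have [C C0 hC] := cutoff_decay ba hb (sym_cutoff eta_smooth eta_eq0) c1 c0 dl.
exists (C * 16 `^ (2 * l.+1%:R)); first by rewrite mulr_ge0 ?powR_ge0.
move=> n t n0 /andP[t0 tp]; have tI : 0 <= t <= pi by rewrite ltW.
have /andP[h1 _] := half_versine_bounds tI.
have t16 : 0 < t / 16 by rewrite divr_gt0.
have E : jkernel 0 n t = ksum a b n.*2 (fun k => eta (k%:R / n%:R)) ((1 - cos t) / 2).
  by apply: eq_bigr => k _; rewrite mul0r powRr0 mulr1.
have := hC n n.*2 _ n0 (leqnn _) (half_versine_itv t); rewrite -E => h.
have h2 : C * pw n (2 * a + 2 - 2 * l.+1%:R) <= C * n%:R `^ (Q 0 - 2 * l.+1%:R).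
  rewrite ler_wpM2l// /pw add0r; apply: powR_le_neg; rewrite ?ltr0n ?ler_nat//.
  by move: dl; lra.
have h3 : (t / 16) `^ (2 * l.+1%:R) * `|jkernel 0 n t| <= C * n%:R `^ (Q 0 - 2 * l.+1%:R).
  apply: le_trans h2; apply: le_trans h; rewrite ler_wpM2r//.
  rewrite powRrM !powR_mulrn ?(ltW t16) ?exprn_ge0 ?(ltW t16)//.
  by rewrite lerXn2r ?nnegrE ?exprn_ge0 ?(ltW t16)//; case/andP: (half_versine_itv t).
set s := 2 * l.+1%:R in h3 *; have u0 := powR_gt0 s t16.
have E2 : ((t / 16) `^ s)^-1 = 16 `^ s * t `^ (- s).
  by rewrite powR_div ?(ltW t0)// invfM -!powRN opprK mulrC.
rewrite mulrAC -(mulrA C) -E2 mulrAC ler_pdivlMr// mulrC.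
exact: h3.
Qed.

Lemma jkernel_near0 r : 0 <= r -> exists c kap, [/\ 0 < c, 0 < kap, kap <= 1 &
  forall n t, (0 < n)%N -> 0 <= t <= kap / n%:R -> c * n%:R `^ Q r <= `|jkernel r n t|].
Proof.
move=> r0.
have c1 n k := @cutoff_one _ _ eta_eq1 n k; have c0 n k := @cutoff_zero _ _ eta_eq0 n k.
have e0 k : 0 <= eig a b k by apply: mulr_ge0 => //; apply: addr_ge0.
have mu_ge k : (0 < k)%N -> 2^-1 `^ r * pw k r <= eig a b k `^ (r / 2).
  move=> k0; rewrite /pw -powRM ?invr_ge0//.
  have k1 : 1 <= k%:R :> R by rewrite ler1n.
  have -> : (2^-1 * k.+1%:R) `^ r = ((2^-1 * k.+1%:R) ^+ 2) `^ (r / 2).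
    by rewrite -powR_mulrn ?mulr_ge0 ?invr_ge0// -powRrM mulrCA divff ?pnatr_eq0// mulr1.
  rewrite ge0_ler_powR ?nnegrE ?e0 ?exprn_ge0 ?mulr_ge0 ?invr_ge0//.
  by rewrite /eig -[k.+1%:R]natr1; move: k1 la0; nra.
have i2 : 0 < 2^-1 `^ r :> R by rewrite powR_gt0 ?invr_gt0.
have [c c00 hc] := kernel_near0 ba hb (fun n k => eta_ge0 (k%:R / n%:R)) c1 c0 (d0 r0) i2
  (fun k => powR_ge0 (eig a b k) (r / 2)) mu_ge.
(* As [n >= 1], [2 (2 n + la) <= n D], so [t <= 1 / (D n)] implies the smallness condition of
   [kernel_near0]. *)
pose D := 2 * (2 + (a + b + 1)); have D2 : 2 <= D by rewrite /D; move: la0; lra.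
exists c, D^-1; split => //.
- by rewrite invr_gt0; lra.
- by rewrite invf_le1; lra.
move=> n t n0 /andP[t0 tn].
apply: le_trans (ler_norm _); apply: hc => //.
have n1 : 1 <= n%:R :> R by rewrite ler1n.
have nt : n%:R * D * t <= 1.
  have D0 : 0 < D by move: D2; lra.
  move: tn; rewrite ler_pdivlMr ?ltr0n// -[D^-1]mul1r ler_pdivlMr//.
  by rewrite -mulrA mulrC.
apply: le_trans nt; rewrite ler_wpM2r//.
by rewrite /D; move: la0 n1; nra.
Qed.

Lemma jkernel_tail r : 0 < r -> (forall i : nat, r != 2 * i%:R) ->
  exists c A del, [/\ 0 < c, 0 < A, 0 < del, del <= 1 &
    forall n t, (0 < n)%N -> 0 < t <= del -> A <= n%:R * t ->
      c * t `^ (- Q r) <= `|jkernel r n t|].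
Proof.
move=> r0 rne.
have c1 n k := @cutoff_one _ _ eta_eq1 n k; have c0 n k := @cutoff_zero _ _ eta_eq0 n k.
have [c [A [del [c00 A0 del0 hc]]]] :=
  kernel_tail ba hb r0 rne (sym_cutoff eta_smooth eta_eq0) c1 c0.
(* Since [y >= (t / 16)^2], the condition on [n t] yields [n^2 y >= (A + 1)^2 >= A]; and [t <= 1]
   gives [y <= t^2 <= t <= del]. *)
exists c, (16 * (A + 1)), (Num.min 1 del); split => //.
- by rewrite mulr_gt0 ?addr_gt0.
- by rewrite lt_min ltr01.
- by rewrite ge_min lexx.
move=> n t n0 /andP[t0]; rewrite le_min => /andP[t1 td] At.
have tI : 0 <= t <= pi by rewrite (ltW t0) (le_trans t1)// pi_ge1.
have /andP[h1 h2] := half_versine_bounds tI.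
have y0 : 0 < (1 - cos t) / 2 by apply: lt_le_trans h1; rewrite exprn_gt0 ?divr_gt0.
have yt2 : (1 - cos t) / 2 <= t ^+ 2.
  by apply: le_trans h2 _; rewrite lerXn2r ?nnegrE ?divr_ge0 ?(ltW t0)//; lra.
apply: le_trans (hc n n.*2 _ n0 (leqnn _) _ _); last 1 first.
- have : (A + 1) ^+ 2 <= (n%:R * (t / 16)) ^+ 2.
    by rewrite lerXn2r ?nnegrE ?addr_ge0 ?mulr_ge0 ?invr_ge0 ?(ltW A0) ?(ltW t0)//; lra.
  rewrite exprMn => h3; apply: (@le_trans _ _ ((A + 1) ^+ 2)); first by nra.
  by apply: (le_trans h3); rewrite ler_wpM2l ?exprn_ge0.
- rewrite (ler_pM2l c00); apply: (@le_trans _ _ ((t ^+ 2) `^ (- (a + 1 + r / 2)))).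
    rewrite -powR_mulrn ?(ltW t0)// -powRrM.
    by rewrite (_ : 2 * - (a + 1 + r / 2) = - Q r)//; field.
  apply: powR_le_neg => //.
  by have := d0 (ltW r0); lra.
- by rewrite y0 (le_trans yt2)// (le_trans _ td)// expr2 ler_piMr// ltW.
Qed.

End JacobiKernel.

(** * Comparison of the two norms *)

Lemma equiv_from2_ratio (R : realType) (X Y u v : nat -> R) (s : R) : 0 <= s ->
  (forall n, (1 < n)%N -> 0 <= u n) -> (forall n, (1 < n)%N -> 0 < v n) ->
  (exists2 c, 0 < c & forall n, (1 < n)%N -> c * u n <= X n) ->
  (exists2 c, 0 <= c & forall n, (1 < n)%N -> X n <= c * u n) ->
  (exists2 c, 0 < c & forall n, (1 < n)%N -> c * v n <= Y n) ->
  (exists2 c, 0 <= c & forall n, (1 < n)%N -> Y n <= c * v n) ->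
  equiv_from2 (fun n => X n `^ s / Y n `^ s) (fun n => (u n / v n) `^ s).
Proof.
move=> s0 u0 v0 [c1 c10 h1] [C1 C10 H1] [c2 c20 h2] [C2 C20 H2].
pose K1 := (C1 / c2) `^ s; pose K2 := (C2 / c1) `^ s.
have K10 : 0 <= K1 by exact: powR_ge0.
have K20 : 0 <= K2 by exact: powR_ge0.
exists (K1 + K2 + 1); first by rewrite ltr_wpDl ?addr_ge0.
move=> n n1; have un := u0 n n1; have vn := v0 n n1.
have Y0 : 0 < Y n by apply: lt_le_trans (h2 n n1); rewrite mulr_gt0.
have X0 : 0 <= X n by apply: le_trans (h1 n n1); rewrite mulr_ge0 ?(ltW c10).
have E : X n `^ s / Y n `^ s = (X n / Y n) `^ s by rewrite powR_div// powRN.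
have K0 : 0 < K1 + K2 + 1 by rewrite ltr_wpDl ?addr_ge0.
have uv0 : 0 <= u n / v n by rewrite divr_ge0 ?(ltW vn).
have XY0 : 0 <= X n / Y n by rewrite divr_ge0 ?(ltW Y0).
rewrite E; apply/andP; split.
  rewrite ler_pdivrMl//; apply: (@le_trans _ _ (K2 * (X n / Y n) `^ s)); last first.
    by rewrite ler_wpM2r ?powR_ge0//; lra.
  rewrite /K2 -powRM ?XY0 ?divr_ge0 ?(ltW c10)// ge0_ler_powR ?nnegrE// ?mulr_ge0 ?invr_ge0 ?(ltW c10) ?(ltW Y0)//.
  rewrite ler_pdivrMr//.
  have -> : C2 / c1 * (X n / Y n) * v n = X n * (C2 * v n) / (c1 * Y n).
    by field; rewrite (gt_eqF c10) (gt_eqF Y0).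
  rewrite ler_pdivlMr ?mulr_gt0// mulrCA mulrA.
  by apply: ler_pM; rewrite ?mulr_ge0 ?h1 ?H2 ?(ltW c10) ?(ltW Y0).
apply: (@le_trans _ _ (K1 * (u n / v n) `^ s)); last first.
  by rewrite ler_wpM2r ?powR_ge0//; lra.
rewrite /K1 -powRM ?uv0 ?divr_ge0 ?(ltW c20)// ge0_ler_powR ?nnegrE// ?mulr_ge0 ?invr_ge0 ?(ltW c20) ?(ltW vn)//.
rewrite ler_pdivrMr//.
have -> : C1 / c2 * (u n / v n) * Y n = C1 * u n * Y n / (c2 * v n).
  by field; rewrite (gt_eqF c20) (gt_eqF vn).
rewrite ler_pdivlMr ?mulr_gt0//.
by apply: ler_pM; rewrite ?mulr_ge0 ?h2 ?H1 ?(ltW c20) ?(ltW vn).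
Qed.

Lemma equiv_from2_ext (R : realType) (A A' B B' : nat -> R) :
  (forall n, (1 < n)%N -> A n = A' n) -> (forall n, (1 < n)%N -> B n = B' n) ->
  equiv_from2 A B -> equiv_from2 A' B'.
Proof.
by move=> AA BB [c c0 h]; exists c => // n n1; rewrite -AA// -BB//; exact: h.
Qed.

Theorem theorem2p2 (R : realType) (eta : R -> R) (a b p r : R)
  (eta_smooth : smooth eta)
  (eta_ge0 : forall x : R, 0 <= eta x)
  (eta_eq1 : forall x : R, `|x| <= 1 -> eta x = 1)
  (eta_eq0 : forall x : R, 2 <= `|x| -> eta x = 0)
  (ba : b <= a) (hb : - 2^-1 <= b)
  (p_gt0 : 0 < p) (p_lt1 : p < 1) (r_gt0 : 0 < r)
  (r_not_even : 0 < a + b + 1 -> ~ exists m : int, r = 2 * m%:~R)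
  (r_not_int : a + b + 1 = 0 -> ~ exists m : int, r = m%:~R) :
  let ratio := fun n : nat =>
    jacobi_norm a b p (jacobiG eta a b n r)
      / jacobi_norm a b p (jacobiG eta a b n 0) in
  let s := (2 * a + 2) * (p^-1 - 1) in
  [/\ s < r -> equiv_from2 ratio (fun n => n%:R `^ r),
      r < s -> equiv_from2 ratio (fun n => n%:R `^ s)
    & r = s -> equiv_from2 ratio
                 (fun n => n%:R `^ s * (ln n%:R) `^ p^-1)].
Proof.
move=> ratio s.
have la0 : 0 <= a + b + 1 by move: ba hb; lra.
have rne (i : nat) : r != 2 * i%:R.
  apply/eqP => ri; move: la0; rewrite le_eqVlt => /predU1P[l0|lp].
    (* When [a + b + 1 = 0], an even [r] is excluded as being in particular an integer. *)
    by apply: (r_not_int (esym l0)); exists (2 * i%:Z); rewrite ri intrM.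
  by apply: (r_not_even lp); exists i%:Z.
pose d := 2 * a + 2.
have d1 : 1 <= d by move: ba hb; rewrite /d; lra.
have pV0 : 0 < p^-1 by rewrite invr_gt0.
pose X n := wint a b p (jkernel eta a b r n).
pose Y n := wint a b p (jkernel eta a b 0 n).
have ratioE n : (1 < n)%N -> X n `^ p^-1 / Y n `^ p^-1 = ratio n.
  move=> /ltnW n0; rewrite /ratio !jacobi_norm_wint.
  have F q : (fun t => jacobiG eta a b n q (cos t)) = jkernel eta a b q n.
    by apply/funext => t; rewrite jacobiG_jkernel.
  by rewrite !F.
have cf q n := @continuous_jkernel R eta a b q n.
have Q0 : 0 + 2 * a + 2 = d by rewrite /d; ring.
have QE : r + 2 * a + 2 = r + d by rewrite /d; ring.
have Ylow : exists2 c, 0 < c & forall n, (1 < n)%N -> c * n%:R `^ (d * p - d) <= Y n.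
  have [c [kap [c0 k0 k1 h]]] := jkernel_near0 eta_ge0 eta_eq1 eta_eq0 ba hb (lexx 0).
  rewrite Q0 in h.
  have [C C0 hC] := wint_near0 ba hb p_gt0 (cf 0) c0 k0 k1 h.
  by exists C => // n /ltnW; exact: hC.
have Yup : exists2 c, 0 <= c & forall n, (1 < n)%N -> Y n <= c * n%:R `^ (d * p - d).
  have [C1 C10 h1] := jkernel_le eta_smooth eta_eq0 ba hb (lexx 0).
  (* The decay exponent [2 (l + 1)] is taken so large that [2 (l + 1) p > d]: the integral of the
     tail then does not exceed the order [n^(d p - d)] of the peak. As [p < 1], also
     [2 (l + 1) > d]. *)
  pose l := Num.truncn (d / p).
  have dl : d < l.+1%:R * p by rewrite -ltr_pdivrMr// truncnS_gt.
  have lp : l.+1%:R * p <= l.+1%:R by rewrite ler_piMr// ltW.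
  have dl2 : 2 * a + 2 < 2 * l.+1%:R.
    by rewrite -/d; apply: (lt_le_trans dl); apply: (le_trans lp); rewrite ler_peMl// ler1n.
  have [C2 C20 h2] := jkernel0_decay eta_smooth eta_eq1 eta_eq0 ba hb dl2.
  rewrite Q0 in h1 h2.
  have C0 : 0 <= C1 + C2 by rewrite addr_ge0.
  have h1' n t : (0 < n)%N -> 0 <= t <= pi -> `|jkernel eta a b 0 n t| <= (C1 + C2) * n%:R `^ d.
    by move=> n0 _; apply: (le_trans (h1 n t n0)); rewrite ler_wpM2r ?powR_ge0// lerDl.
  have h2' n t : (0 < n)%N -> 0 < t <= pi -> `|jkernel eta a b 0 n t| <=
      (C1 + C2) * n%:R `^ (d - 2 * l.+1%:R) * t `^ (- (2 * l.+1%:R)).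
    move=> n0 tI; apply: (le_trans (h2 n t n0 tI)).
    by rewrite -!mulrA ler_wpM2r ?mulr_ge0 ?powR_ge0// lerDr.
  have dq : 2 * a + 2 < 2 * l.+1%:R * p.
    by rewrite -/d -mulrA; apply: (lt_le_trans dl); rewrite ler_peMl ?mulr_ge0 ?(ltW p_gt0)// ler1n.
  have [C CC hC] := wint_upper_gt ba hb p_gt0 (cf 0) C0 h1' h2' dq.
  by exists C => // n /ltnW; exact: hC.
have [cl [kap [cl0 k0 k1 hl]]] := jkernel_near0 eta_ge0 eta_eq1 eta_eq0 ba hb (ltW r_gt0).
have [ct [A [del [ct0 A0 del0 del1 ht]]]] := jkernel_tail eta_smooth eta_eq1 eta_eq0 ba hb r_gt0 rne.
have [C1 C10 h1] := jkernel_le eta_smooth eta_eq0 ba hb (ltW r_gt0).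
have [C2 C20 h2] := jkernel_decay eta_smooth eta_eq1 eta_eq0 ba hb (ltW r_gt0).
rewrite QE in hl ht h1 h2.
have C0 : 0 <= C1 + C2 by rewrite addr_ge0.
have h1' n t : (0 < n)%N -> 0 <= t <= pi -> `|jkernel eta a b r n t| <= (C1 + C2) * n%:R `^ (r + d).
  by move=> n0 _; apply: (le_trans (h1 n t n0)); rewrite ler_wpM2r ?powR_ge0// lerDl.
have h2' n t : (0 < n)%N -> 0 < t <= pi -> `|jkernel eta a b r n t| <=
    (C1 + C2) * n%:R `^ (r + d - (r + d)) * t `^ (- (r + d)).
  move=> n0 tI; apply: (le_trans (h2 n t n0 tI)).
  by rewrite subrr powRr0 mulr1 ler_wpM2r ?powR_ge0// lerDr.
have sE : s = d * p^-1 - d by rewrite /s mulrBr mulr1.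
have pw0 q n : (1 < n)%N -> 0 < n%:R `^ q :> R by move=> /ltnW n0; rewrite powR_gt0 ?ltr0n.
have pwE q n : (1 < n)%N -> n%:R `^ q / n%:R `^ (d * p - d) = n%:R `^ (q - (d * p - d)) :> R.
  by move=> /ltnW n0; rewrite powR_natD// powRN.
have vsE : (- (d * p - d)) * p^-1 = s.
  by rewrite sE; field; rewrite gt_eqF.
split.
(* Both integrals are governed by their peaks, of orders [n^((r + d) p - d)] and [n^(d p - d)]; the
   [p]-th root of the quotient is [n^r]. *)
- move=> sr; have dP : d < (r + d) * p.
    by rewrite -ltr_pdivrMr//; move: sr; rewrite sE; lra.
  apply: (equiv_from2_ext ratioE _ (@equiv_from2_ratio R X Y (fun n => n%:R `^ ((r + d) * p - d))
    (fun n => n%:R `^ (d * p - d)) p^-1 (ltW pV0) _ _ _ _ Ylow Yup)).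
  + move=> n n1; rewrite pwE// -powRrM; congr (_ `^ _).
    by field; rewrite gt_eqF.
  + by move=> n _; exact: powR_ge0.
  + by move=> n; exact: pw0.
  + have [C CC hC] := wint_near0 ba hb p_gt0 (cf r) cl0 k0 k1 hl.
    by exists C => // n /ltnW; exact: hC.
  + have [C CC hC] := wint_upper_gt ba hb p_gt0 (cf r) C0 h1' h2' dP.
    by exists C => // n /ltnW; exact: hC.
(* The numerator now lies between positive constants, so the exponent [s] comes from the norm of
   [G_n] alone. *)
- move=> rs; have dP : (r + d) * p < d.
    by rewrite -ltr_pdivlMr//; move: rs; rewrite sE; lra.
  apply: (equiv_from2_ext ratioE _ (@equiv_from2_ratio R X Y (fun n => 1)
    (fun n => n%:R `^ (d * p - d)) p^-1 (ltW pV0) _ _ _ _ Ylow Yup)).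
  + by move=> n n1; rewrite mul1r -powRN -powRrM vsE.
  + by [].
  + by move=> n; exact: pw0.
  + have [C CC hC] := wint_tail_lt ba hb p_gt0 (cf r) cl0 k0 k1 hl ct0 A0 del0 del1 ht dP.
    by exists C => // n /ltnW n0; rewrite mulr1; exact: hC.
  + have [C CC hC] := wint_upper_lt ba hb p_gt0 (cf r) C0 h1' h2' erefl dP.
    by exists C => // n /ltnW n0; rewrite mulr1; exact: hC.
- move=> rs; have dP : (r + d) * p = d.
    by rewrite rs sE subrK divfK// gt_eqF.
  have ln0 n : (1 < n)%N -> 0 <= ln n%:R :> R by move=> n1; rewrite ln_ge0// ler1n ltnW.
  apply: (equiv_from2_ext ratioE _ (@equiv_from2_ratio R X Y (fun n => ln n%:R)
    (fun n => n%:R `^ (d * p - d)) p^-1 (ltW pV0) ln0 _ _ _ Ylow Yup)).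
  + by move=> n n1; rewrite -powRN powRM ?ln0 ?powR_ge0// -powRrM vsE mulrC.
  + by move=> n; exact: pw0.
  + exact: (wint_tail_eq ba hb p_gt0 (cf r) cl0 k0 k1 hl ct0 A0 del0 del1 ht dP).
  + exact: (wint_upper_eq ba hb p_gt0 (cf r) C0 h1' h2' erefl dP).
Qed.
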